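(* Let $H\in(0,1)$, let $B^H$ be a fractional Brownian motion with Hurst index $H$, and let $u:\mathbb{R}_+\to\mathbb{R}$ be measurable with $u(0)\ge0$ and $P_0\in(0,1)$. Let $f\in\mathcal{H}$ be such that $f(x_0)>0$ for some $x_0\in(0,\infty)$. Then there is a unique $\widehat f\in\mathcal{H}$ with $\widehat f\ge f$ such that $$\inf_{g\in\mathcal{H},\ g\ge f}\|g\|_{\mathcal{H}}=\|\widehat f\|_{\mathcal{H}},$$ and $$\ln P_{\gamma f}\ge-(1+o(1))\frac{\gamma^2}{2}\|\widehat f\|_{\mathcal{H}}^2,\qquad\gamma\to\infty.$$
   Context: $\mathbb{R}_+=[0,\infty)$. $B^H$ is a (continuous) centered Gaussian process with covariance $R_H(s,t)=\frac12(t^{2H}+s^{2H}-|t-s|^{2H})$, $s,t\ge0$. For a function $g$ on $\mathbb{R}_+$, $P_g:=P(B^H(t)+g(t)\le u(t),\ t\in\mathbb{R}_+)$; in particular $P_0=P(B^H(t)\le u(t),\ t\in\mathbb{R}_+)$. Inequalities $g\ge f$ are pointwise on $\mathbb{R}_+$. $\mathcal{H}$ is the reproducing kernel Hilbert space of $B^H$ on $\mathbb{R}_+$ (with kernel $R_H$): the set of functions $f(t)=\int_0^tK_H(t,s)\phi(s)\,ds$ with $\phi\in L_2(\mathbb{R}_+)$, with norm $\|f\|_{\mathcal{H}}=\|\phi\|_{L_2(\mathbb{R}_+)}$, where for $t>s$ $$K_H(t,s)=\frac{C_1}{\Gamma(H+1/2)}\Big(\big(\tfrac ts\big)^{H-1/2}(t-s)^{H-1/2}-(H-\tfrac12)s^{1/2-H}\int_s^t(u-s)^{H-1/2}u^{H-3/2}\,du\Big),$$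 $C_1=\left(\frac{2H\Gamma(H+1/2)\Gamma(3/2-H)}{\Gamma(2-2H)}\right)^{1/2}$. *)

(* Defs.v *)
From HB Require Import structures.
From mathcomp Require Import all_boot all_order all_algebra.
From mathcomp Require Import all_classical all_reals all_analysis.

Set Implicit Arguments.
Unset Strict Implicit.
Unset Printing Implicit Defensive.

Import Order.TTheory GRing.Theory Num.Theory.
Import numFieldNormedType.Exports.

Local Open Scope classical_set_scope.
Local Open Scope ring_scope.

(* Functions on [0, +oo[ are represented by functions R -> R of which only the
   values on [0, +oo[ are ever used. *)

Definition Rplus (R : realType) : set R := `[0, +oo[%classic.
Arguments Rplus {R}.

Definition Gamma (R : realType) (x : R) : R :=
  Rintegral (@lebesgue_measure R) `]0, +oo[
    (fun y => y `^ (x - 1) * expR (- y)).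

Definition fbm_cov (R : realType) (H s t : R) : R :=
  2^-1 * (t `^ (2 * H) + s `^ (2 * H) - `|t - s| `^ (2 * H)).

(* The Dirac case is stated separately because the library's [normal_prob m 0]
   is not the point mass at [m]. *)
Definition gaussian_law (R : realType) (mu : probability R R) : Prop :=
  (exists m s : R, s != 0 /\
     forall A : set R, measurable A -> mu A = normal_prob m s A) \/
  (exists m : R, forall A : set R, measurable A -> mu A = \d_m A).

Definition gaussian_process (R : realType) (d : measure_display)
    (T : measurableType d) (P : probability T R) (X : R -> {RV P >-> R}) : Prop :=
  forall (n : nat) (t a : 'I_n -> R), (forall i, Rplus (t i)) ->
    gaussian_law
      (distribution P (\sum_(i < n) a i *: (X (t i) : {mfun T >-> R}))).

Definition fbm (R : realType) (d : measure_display) (T : measurableType d)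
    (P : probability T R) (H : R) (B : R -> {RV P >-> R}) : Prop :=
  [/\ gaussian_process B,
      forall t, Rplus t -> ('E_P[B t] = 0)%E,
      forall s t, Rplus s -> Rplus t ->
        covariance P (B s) (B t) = (fbm_cov H s t)%:E
    & forall w : T, {within Rplus, continuous (fun t => B t w)}].

(* P(B(t) + g(t) <= u(t), t >= 0).  The event is measurable when the paths of
   [B] and [g] are continuous on [0, +oo[, whatever [u] is. *)
Definition prob_below (R : realType) (d : measure_display)
    (T : measurableType d) (P : probability T R) (B : R -> {RV P >-> R})
    (u g : R -> R) : \bar R :=
  P [set w | forall t, Rplus t -> B t w + g t <= u t].

Definition C1 (R : realType) (H : R) : R :=
  Num.sqrt (2 * H * Gamma (H + 2^-1) * Gamma (3 / 2 - H) / Gamma (2 - 2 * H)).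

Definition K_fbm (R : realType) (H t s : R) : R :=
  C1 H / Gamma (H + 2^-1) *
  ((t / s) `^ (H - 2^-1) * (t - s) `^ (H - 2^-1)
   - (H - 2^-1) * s `^ (2^-1 - H) *
     Rintegral (@lebesgue_measure R) `[s, t]
       (fun v => (v - s) `^ (H - 2^-1) * v `^ (H - 3 / 2))).

Definition L2plus (R : realType) (phi : R -> R) : Prop :=
  phi \_ Rplus \in Lfun (@lebesgue_measure R) 2%:E.

Definition L2plus_norm (R : realType) (phi : R -> R) : R :=
  fine ('N[@lebesgue_measure R]_2%:E[EFin \o (phi \_ Rplus)])%E.

Definition K_repr (R : realType) (H : R) (f phi : R -> R) : Prop :=
  L2plus phi /\
  forall t, Rplus t ->
    f t = Rintegral (@lebesgue_measure R) `[0, t]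
            (fun s => K_fbm H t s * phi s).

Definition in_rkhs (R : realType) (H : R) (f : R -> R) : Prop :=
  exists phi, K_repr H f phi.

(* [rkhs_norm H f r] reads: f belongs to the RKHS and its norm is r.  It is
   single-valued in r because f determines phi almost everywhere. *)
Definition rkhs_norm (R : realType) (H : R) (f : R -> R) (r : R) : Prop :=
  exists phi, K_repr H f phi /\ r = L2plus_norm phi.

Definition ge_plus (R : realType) (g f : R -> R) : Prop :=
  forall t, Rplus t -> f t <= g t.

Definition min_rkhs_norm (R : realType) (H : R) (f : R -> R) : R :=
  inf [set r | exists g, rkhs_norm H g r /\ ge_plus g f].

(* Main.v *)
(* Put k_t = K_H(t, .) on ]0, t[. Then f(t) = <k_t, phi> in L2(R), so the RKHS
   functions above f correspond to a nonempty closed convex subset of L2, which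
   has a unique element phi of least norm: this is fhat. Moreover
   <k_s, k_t> = R_H(s, t), by Tonelli and Beta integrals.

   For the lower bound, f <= fhat gives P_{c f} >= P_{c fhat}, and by continuity
   of the paths the event only involves countably many times, hence it is a limit
   of events {X_i + g_i <= u_i for all i < n} with X Gaussian and
   g_i = <k_{t_i}, c phi>. On finitely many times g_i = E[X_i Z] for some
   Z = sum_j b_j X_j of variance v <= |c phi|^2. Since X - (g / v) Z is independent
   of Z, shifting X by g amounts to shifting the N(0, v) variable Z by v, which
   multiplies its density by exp(z - v/2). Bounding the exponential from below by
   a tangent line gives, for p = P(X_i <= u_i for all i),
     P(X_i + g_i <= u_i for all i) >= p exp(- v/2 - sqrt v / p),
   where sqrt v / p is of lower order than v/2 as c tends to infinity. *)
Require Import Defs.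
From HB Require Import structures.
From mathcomp Require Import all_boot all_order all_algebra.
From mathcomp Require Import all_classical all_reals all_analysis.
From mathcomp Require Import measurable_realfun.
From mathcomp Require Import ring lra.

Set Implicit Arguments.
Unset Strict Implicit.
Unset Printing Implicit Defensive.

Import Order.TTheory GRing.Theory Num.Theory.
Import numFieldNormedType.Exports.

Local Open Scope classical_set_scope.
Local Open Scope ring_scope.

(** * Integration on the half line *)

(** The covariance matrix of finitely many values may be singular, and [gaussian_law] speaks of
    scalar laws only, so no density of a Gaussian vector is used. The only density is that of the
    scalar Z; independence of Z and X - (g / v) Z is realised on a product space whose
    characteristic function is compared with that of X. Going from characteristic functions to
    probabilities needs no Fourier inversion: cylinder events are reached from cosines by products
    and bounded limits. The computation of <k_s, k_t> is arranged so that every integrand is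
    nonnegative and Tonelli applies without integrability checks. The sign of H - 1/2 decides which
    integration by parts removes the subtraction in K_H, hence two separate computations. As u is
    only measurable, its values at rational times do not determine the event; the times are chosen
    so that the graph of (u, f) above them is dense. The error eps is explicit: it is solved from an
    equality valid for every large c. *)

Section substitution.
Context {R : realType}.
Notation mu := (@lebesgue_measure R).
Implicit Types (f F G : R -> R) (a b c : R).

Lemma ninv_nincr (n : nat) : (n.+1%:R^-1 : R) <= n.+1%:R.
Proof. by rewrite (@le_trans _ _ 1)// ?invf_le1 ?ler1n// ltr0n. Qed.

Lemma bigcup_itv_0y : \bigcup_n `[n.+1%:R^-1 : R, n.+1%:R]%classic = `]0, +oo[%classic.
Proof.
apply/seteqP; split => x /=.
  case=> n _ /=; rewrite !in_itv/= => /andP[nx _]; rewrite andbT.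
  by apply: lt_le_trans nx; rewrite invr_gt0 ltr0n.
rewrite in_itv/= andbT => x0.
have [n nx] : exists n : nat, x + x^-1 < n%:R.
  by exists (Num.bound (x + x^-1)); rewrite archi_boundP// addr_ge0 ?invr_ge0 ?ltW.
have xV0 : 0 < x^-1 by rewrite invr_gt0.
have nn : n%:R <= n.+1%:R :> R by rewrite ler_nat.
exists n => //=; rewrite in_itv/=; apply/andP; split; last by lra.
by rewrite -[x]invrK lef_pV2 ?posrE//; lra.
Qed.

Lemma is_derive_continuous f (df : R) c : is_derive c 1 f df -> {for c, continuous f}.
Proof.
by move=> fc; apply/differentiable_continuous/derivable1_diffP; case: fc.
Qed.

Lemma continuous_measurable_itvcc f a b : {in `[a, b], continuous f} ->
  measurable_fun `[a, b] f.
Proof.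
move=> cf; apply: subspace_continuous_measurable_fun => //.
by apply: continuous_in_subspaceT => x /set_mem /= /cf.
Qed.

(** The compact intervals [[1/(n+1), n+1]] exhaust the half line; substitution holds on each and
    monotone convergence gives the limit. Nonnegativity stands in for integrability, so both sides
    may be [+oo], and nothing is asked of [F] at [0] or at infinity. *)
Lemma ge0_substitution_0y F f G :
  (forall z : R, 0 < z -> is_derive z 1 F (f z)) ->
  (forall x y : R, 0 < x -> x < y -> F x < F y) ->
  (forall z : R, 0 < z -> {for z, continuous f}) ->
  (forall z : R, 0 < z -> {for (F z), continuous G}) ->
  (forall z : R, 0 < z -> 0 <= f z) ->
  (forall z : R, 0 < z -> 0 <= G (F z)) ->
  (\int[mu]_(x in F @` `]0%R, +oo[) (G x)%:E =
   \int[mu]_(z in `]0%R, +oo[) (G (F z) * f z)%:E)%E.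
Proof.
move=> dF incF cf cG f0 G0.
have N0 n : 0 < n.+1%:R^-1 :> R by rewrite invr_gt0.
have IE n (x : R) : x \in `[n.+1%:R^-1, n.+1%:R] -> 0 < x.
  by rewrite in_itv/= => /andP[h _]; apply: lt_le_trans h.
have cF (x : R) : 0 < x -> {for x, continuous F}.
  by move=> x0; apply: is_derive_continuous (dF x x0).
have FI n : F @` `[n.+1%:R^-1, n.+1%:R] = `[F n.+1%:R^-1, F n.+1%:R]%classic.
  have incF' : {in `[n.+1%:R^-1, n.+1%:R] &, {homo F : x y / x <= y}}.
    move=> x y /IE x0 _; rewrite le_eqVlt => /predU1P[->//|xy].
    exact/ltW/incF.
  have n1 : n.+1%:R^-1 \in `[n.+1%:R^-1, n.+1%:R : R].
    by rewrite in_itv/= lexx ninv_nincr.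
  have n2 : n.+1%:R \in `[n.+1%:R^-1, n.+1%:R : R].
    by rewrite in_itv/= lexx ninv_nincr.
  apply/seteqP; split => y /=.
    case=> x xI <-; rewrite in_itv/=; apply/andP; split; apply: incF' => //.
      by move: xI; rewrite in_itv/= => /andP[].
    by move: xI; rewrite in_itv/= => /andP[].
  move=> yI.
  have := @segment_continuous_le_surjective R _ _ F (ninv_nincr n).
  case/(_ _ _ y yI).
  - exact: incF' (ninv_nincr n).
  - apply: continuous_in_subspaceT => x /set_mem /= /IE; exact: cF.
  - by move=> x /= xI yE; exists x => //; rewrite yE.
have lhs : (\int[mu]_(x in `[F n.+1%:R^-1%R, F n.+1%:R%R]) (G x)%:E @[n --> \oo] -->
    \int[mu]_(x in F @` `]0%R, +oo[) (G x)%:E)%E.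
  have -> : F @` `]0%R, +oo[ = \bigcup_n `[F n.+1%:R^-1, F n.+1%:R]%classic.
    by rewrite -bigcup_itv_0y image_bigcup; apply: eq_bigcupr => n _; exact: FI.
  apply: ge0_nondecreasing_set_cvg_integral => //.
  - move=> n m nm; rewrite -!FI; apply/subsetPset/image_subset => x /=.
    rewrite !in_itv/= => /andP[h1 h2]; apply/andP; split.
      by rewrite (le_trans _ h1)// lef_pV2 ?posrE// ler_nat.
    by rewrite (le_trans h2)// ler_nat.
  - move=> n; apply/measurable_EFinP; apply: continuous_measurable_itvcc => y.
    move=> yI; have : (F @` `[n.+1%:R^-1, n.+1%:R]) y by rewrite FI.
    by case=> x /= /IE x0 <-; exact: cG.
  - move=> n y yI; have : (F @` `[n.+1%:R^-1, n.+1%:R]) y by rewrite FI.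
    by case=> x /= /IE x0 <-; rewrite lee_fin; exact: G0.
have rhs : (\int[mu]_(z in `[n.+1%:R^-1%R, n.+1%:R%R]) (G (F z) * f z)%:E @[n --> \oo] -->
    \int[mu]_(z in `]0%R, +oo[) (G (F z) * f z)%:E)%E.
  rewrite -bigcup_itv_0y.
  apply: ge0_nondecreasing_set_cvg_integral => //.
  - move=> n m nm; apply/subsetPset => x /=.
    rewrite !in_itv/= => /andP[h1 h2]; apply/andP; split.
      by rewrite (le_trans _ h1)// lef_pV2 ?posrE// ler_nat.
    by rewrite (le_trans h2)// ler_nat.
  - move=> n; apply/measurable_EFinP; apply: continuous_measurable_itvcc => y /IE y0.
    apply: cvgM; last exact: cf.
    by apply: continuous_comp; [exact: cF|exact: cG].
  - by move=> n x /IE x0; rewrite lee_fin mulr_ge0 ?f0 ?G0.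
suff E n : (\int[mu]_(x in `[F n.+1%:R^-1%R, F n.+1%:R%R]) (G x)%:E =
    \int[mu]_(z in `[n.+1%:R^-1%R, n.+1%:R%R]) (G (F z) * f z)%:E)%E.
  apply: (cvg_unique _ lhs) => //; apply: cvg_trans rhs.
  by apply: near_eq_cvg; apply: nearW => n; rewrite E.
have dFE (x : R) : 0 < x -> F^`()%classic x = f x by move=> x0; rewrite derive1E; case: (dF x x0).
have ftoF (x : R) : 0 < x -> F^`()%classic y @[y --> x] --> f x.
  move=> x0; apply: cvg_trans (cf x x0).
  apply: near_eq_cvg; near=> y; rewrite dFE//.
  by near: y; exact: lt_nbhsr.
rewrite integration_by_substitution_increasing.
- by apply: eq_integral => x /set_mem/= /IE x0; rewrite fctE /= -dFE.
- exact: ninv_nincr.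
- by move=> x y /IE x0 _; exact: incF.
- move=> x xI; have x0 : 0 < x.
    by apply: (IE n); move: xI; rewrite !in_itv/= => /andP[/ltW-> /ltW->].
  by rewrite /continuous_at; have := ftoF x x0; rewrite -(dFE x x0).
- by apply/cvg_ex; exists (f n.+1%:R^-1); apply: cvg_at_right_filter; exact: ftoF.
- by apply/cvg_ex; exists (f n.+1%:R); apply: cvg_at_left_filter; exact: ftoF.
- split.
  + move=> x xI; have x0 : 0 < x.
      by apply: (IE n); move: xI; rewrite !in_itv/= => /andP[/ltW-> /ltW->].
    by case: (dF x x0).
  + by apply: cvg_at_right_filter; exact: cF.
  + by apply: cvg_at_left_filter; exact: cF.
- apply: continuous_in_subspaceT => y /set_mem /= yI.
  have : (F @` `[n.+1%:R^-1, n.+1%:R]) y by rewrite FI.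
  by case=> x /= /IE x0 <-; exact: cG.
Unshelve. all: by end_near. Qed.

(** The integrand may blow up at [a], as powers with negative exponent do; only [F] has a limit
    there. Monotone convergence along [[s n, b]] replaces continuity of [f] at the endpoint. *)
Lemma ge0_FTC_oc f F a b : a < b ->
  (forall x : R, a < x <= b -> is_derive x 1 F (f x)) ->
  (forall x : R, a < x <= b -> {for x, continuous f}) ->
  (forall x : R, a < x <= b -> 0 <= f x) ->
  F x @[x --> a^'+] --> F a ->
  (\int[mu]_(x in `]a, b]) (f x)%:E = (F b - F a)%:E)%E.
Proof.
move=> ab dF cf f0 cFa.
(* With [n.+2] the point [s n] is strictly between [a] and [b] already for [n = 0]. *)
pose s n : R := a + (b - a) * n.+2%:R^-1.
have ba : 0 < b - a by lra.
have sa n : a < s n by rewrite /s ltrDl mulr_gt0// invr_gt0.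
have sb n : s n < b.
  have : (b - a) * n.+2%:R^-1 < (b - a) * 1.
    by rewrite ltr_pM2l// invf_lt1// ltr1n.
  by rewrite /s mulr1 -ltrBrDl.
have sI n x : x \in `[s n, b] -> a < x <= b.
  by rewrite in_itv/= => /andP[h ->]; rewrite (lt_le_trans (sa n) h).
have scv : s n @[n --> \oo] --> a.
  rewrite -[X in _ --> X]addr0 -[X in _ + X](mulr0 (b - a)).
  apply: cvgD; first exact: cvg_cst.
  apply: cvgMr.
  by have := @cvg_harmonic R; rewrite -(cvg_shiftS (fun n => n.+1%:R^-1 : R)).
have lhs : (\int[mu]_(x in `[s n, b]) (f x)%:E @[n --> \oo] -->
    \int[mu]_(x in `]a, b]) (f x)%:E)%E.
  have -> : `]a, b]%classic = \bigcup_n `[s n, b]%classic.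
    apply/seteqP; split => x /=; last by case=> n _ /= /sI; rewrite in_itv.
    rewrite in_itv/= => /andP[ax xb].
    have xa : x \in `]a, +oo[ by rewrite in_itv/= ax.
    have [n _ /(_ n (leqnn n))/= nx] := cvgr_lt a scv x ax.
    by exists n => //=; rewrite in_itv/= ltW.
  apply: ge0_nondecreasing_set_cvg_integral => //.
  - move=> n m nm; apply/subsetPset => x /=.
    rewrite !in_itv/= => /andP[h1 ->]; rewrite andbT (le_trans _ h1)//.
    rewrite lerD2l ler_pM2l// lef_pV2 ?posrE//.
    by rewrite ler_nat.
  - by move=> n; apply/measurable_EFinP; apply: continuous_measurable_itvcc => y /sI /cf.
  - by move=> n x /sI x0; rewrite lee_fin f0.
apply: (cvg_unique _ lhs) => //.
have E n : (\int[mu]_(x in `[s n, b]) (f x)%:E = (F b - F (s n))%:E)%E.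
  have ooI x : x \in `]s n, b[ -> a < x <= b.
    by move=> xI; apply: (sI n); move: xI; rewrite !in_itv/= => /andP[/ltW-> /ltW->].
  rewrite (@continuous_FTC2 _ _ F)//.
  - apply: continuous_in_subspaceT => y /set_mem /= /sI; exact: cf.
  - split.
    + by move=> x /ooI /dF[].
    + apply/cvg_at_right_filter/(is_derive_continuous (dF _ _)).
      by rewrite sa ltW.
    + apply/cvg_at_left_filter/(is_derive_continuous (dF _ _)).
      by rewrite ab lexx.
  - by move=> x /ooI xab; rewrite derive1E; case: (dF x xab).
have -> : (fun n => \int[mu]_(x in `[s n, b]) (f x)%:E)%E =
    (fun n => (F b - F (s n))%:E) by apply/funext.
apply: cvg_EFin; first exact: nearW.
apply: cvgB; first exact: cvg_cst.
by move/cvg_at_rightP: cFa; apply.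
Qed.

End substitution.

Section elementary_integrals.
Context {R : realType}.
Notation mu := (@lebesgue_measure R).
Implicit Types (a b c x y z p k : R).

Lemma continuous_powR p y : 0 < y -> {for y, continuous (fun x => x `^ p)}.
Proof. by move=> y0; apply: is_derive_continuous (is_derive1_powR p y0). Qed.

Lemma measurable_powR_comp d (T : measurableType d) (g : T -> R) p :
  measurable_fun setT g -> measurable_fun setT (fun t => g t `^ p).
Proof. by move=> mg; exact: (measurableT_comp (measurable_powR p) mg). Qed.

Lemma measurable_lt_pair : measurable [set p : R * R | p.1 < p.2].
Proof.
rewrite -[X in measurable X]setTI.
have mf : measurable_fun setT (fun p : R * R => p.1 < p.2).
  by apply: measurable_fun_ltr.
by have := mf measurableT [set true] I.
Qed.

(** Meant for domains whose slices depend on the outer variable, such as triangles. The domain is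
    absorbed into the integrand as a restriction, after which Tonelli on the whole plane applies. *)
Lemma tonelli_set (A B : set R) (D : set (R * R)) (f : R -> R -> R) :
  measurable A -> measurable B -> measurable D ->
  measurable_fun setT (fun p : R * R => f p.1 p.2) ->
  (forall x y, 0 <= f x y) ->
  (\int[mu]_(x in A) \int[mu]_(y in B `&` [set y | D (x, y)]) (f x y)%:E =
   \int[mu]_(y in B) \int[mu]_(x in A `&` [set x | D (x, y)]) (f x y)%:E)%E.
Proof.
move=> mA mB mD mf f0.
pose g (p : R * R) : \bar R := (EFin \o (fun p : R * R => f p.1 p.2)) \_ (A `*` B `&` D) p.
have mg : measurable_fun setT g.
  apply/(measurable_restrictT (EFin \o (fun p : R * R => f p.1 p.2))).
    by apply: measurableI => //; exact: measurableX.
  by apply/measurable_EFinP; apply: measurable_funS mf.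
have g0 (q : R * R) : (0 <= g q)%E.
  by apply: erestrict_ge0 => r _; rewrite lee_fin.
transitivity (\int[mu]_x \int[mu]_y g (x, y))%E.
  rewrite integral_mkcond; apply: eq_integral => x _.
  rewrite /patch; case: ifPn => [/set_mem Ax|/negP nAx].
    rewrite integral_mkcond; apply: eq_integral => y _.
    rewrite /g /patch; congr (if _ then _ else _).
    apply/idP/idP => /set_mem H; apply/mem_set; first by case: H.
    by case: H => -[].
  rewrite integral0_eq// => y _; rewrite /g patchE; case: ifPn => // /set_mem [[/= Ax _] _].
  by exfalso; apply: nAx; exact/mem_set.
rewrite (@fubini_tonelli _ _ _ _ _ mu mu g mg g0).
rewrite [RHS]integral_mkcond; apply: eq_integral => y _.
rewrite [RHS]/patch; case: ifPn => [/set_mem By|/negP nBy].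
  rewrite [RHS]integral_mkcond; apply: eq_integral => x _.
  rewrite /g /patch; congr (if _ then _ else _).
  apply/idP/idP => /set_mem H; apply/mem_set; last by case: H.
  by case: H => -[].
rewrite integral0_eq// => x _; rewrite /g patchE; case: ifPn => // /set_mem [[/= _ By] _].
by exfalso; apply: nBy; exact/mem_set.
Qed.

Lemma integral_scale_0y k (G : R -> R) : 0 < k ->
  (forall z : R, 0 < z -> {for z, continuous G}) ->
  (forall z : R, 0 < z -> 0 <= G z) ->
  (\int[mu]_(x in `]0%R, +oo[) (G x)%:E =
   \int[mu]_(z in `]0%R, +oo[) (G (k * z) * k)%:E)%E.
Proof.
move=> k0 cG G0.
have imE : ( *%R k) @` `]0, +oo[%classic = `]0, +oo[%classic.
  apply/seteqP; split => x /=; rewrite in_itv/= andbT.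
    by case=> y; rewrite in_itv/= andbT => y0 <-; exact: mulr_gt0.
  move=> x0; exists (k^-1 * x); last by rewrite mulrA mulfV ?mul1r// gt_eqF.
  by rewrite in_itv/= andbT mulr_gt0// invr_gt0.
have dF (z : R) : 0 < z -> is_derive z 1 ( *%R k) (cst k z).
  by move=> _; apply: is_derive_eq; rewrite /GRing.scale/= mulr1.
rewrite -{1}imE (ge0_substitution_0y dF)//.
- by move=> x y _ xy; rewrite ltr_pM2l.
- by move=> z z0; exact: cvg_cst.
- by move=> z z0; apply: cG; exact: mulr_gt0.
- by move=> z _; exact: ltW.
- by move=> z z0; apply: G0; exact: mulr_gt0.
Qed.

Lemma integral_powR p y : -1 < p -> 0 < y ->
  (\int[mu]_(x in `]0%R, y]) (x `^ p)%:E = (y `^ (p + 1) / (p + 1))%:E)%E.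
Proof.
move=> p1 y0; have p10 : 0 < p + 1 by lra.
have dF (x : R) : 0 < x <= y ->
    is_derive x 1 (fun x => x `^ (p + 1) / (p + 1)) (x `^ p).
  move=> /andP[x0 _].
  apply: is_derive_eq; first by apply: is_deriveM; exact: is_derive1_powR.
  rewrite /GRing.scale/= mulr0 add0r addrK mulrA mulVf ?mul1r// gt_eqF//.
rewrite (ge0_FTC_oc y0 dF)//.
- by rewrite powR0 ?gt_eqF// mul0r subr0.
- by move=> x /andP[x0 _]; exact: continuous_powR.
- by move=> x _; exact: powR_ge0.
- apply: cvgM; last exact: cvg_cst.
  by rewrite powR0 ?gt_eqF//; exact: powR_cvg0.
Qed.

Lemma integral_expRN k a : 0 < k ->
  (\int[mu]_(x in `[a, +oo[) (expR (- (k * x)))%:E = (expR (- (k * a)) / k)%:E)%E.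
Proof.
move=> k0.
have dF (x : R) : is_derive x 1 (fun x => - k^-1 * expR (- (k * x))) (expR (- (k * x))).
  apply: is_derive_eq; rewrite /GRing.scale/=.
  by field; rewrite gt_eqF. 
have cf : continuous (fun x => expR (- (k * x))).
  move=> x; apply: (@is_derive_continuous _ _ (expR (- (k * x)) * - k)).
  by apply: is_derive_eq; rewrite /GRing.scale/= mulr1.
rewrite (@ge0_continuous_FTC2y _ _ (fun x => - k^-1 * expR (- (k * x))) a 0)//.
- by rewrite -EFinB; congr EFin; rewrite sub0r mulNr opprK mulrC.
- apply: continuous_subspaceT; exact: cf.
- rewrite -(mulr0 (- k^-1)); apply: cvgMr.
  apply: (@cvg_comp _ _ _ ( *%R k) (fun x => expR (- x)) _ (pinfty_nbhs R)); last exact: cvgr_expR.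
  exact: gt0_cvgMry.
- by apply: cvg_at_right_filter; exact: is_derive_continuous (dF a).
- by move=> x _; rewrite derive1E; case: (dF x).
Qed.

End elementary_integrals.

(** * Gamma and Beta integrals *)

Section Gamma.
Context {R : realType}.
Notation mu := (@lebesgue_measure R).
Implicit Types (a b c x y z k : R).

Lemma continuous_gamma_integrand x y : 0 < y ->
  {for y, continuous (fun y => y `^ (x - 1) * expR (- y))}.
Proof.
move=> y0; apply: cvgM; first exact: continuous_powR.
by apply: continuous_comp; [exact: continuousN|exact: continuous_expR].
Qed.

Lemma measurable_gamma_integrand x (D : set R) :
  measurable_fun D (fun y => y `^ (x - 1) * expR (- y)).
Proof.
apply: measurable_funTS; apply: measurable_funM; first exact: measurable_powR.
by apply: measurableT_comp; [exact: measurable_expR|exact: oppr_measurable].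
Qed.

Lemma gamma_integrand_ge0 x y : 0 <= y `^ (x - 1) * expR (- y).
Proof. by rewrite mulr_ge0 ?powR_ge0 ?expR_ge0. Qed.

Lemma measurable_expRN k (D : set R) : measurable_fun D (fun y => expR (- (k * y))).
Proof.
apply: measurable_funTS; apply: measurableT_comp; first exact: measurable_expR.
apply: measurableT_comp; first exact: oppr_measurable.
by apply: measurable_funM => //; exact: measurable_cst.
Qed.

Lemma gamma_integral_split x : (\int[mu]_(y in `]0%R, +oo[) (y `^ (x - 1) * expR (- y))%:E =
  \int[mu]_(y in `]0%R, 1%R]) (y `^ (x - 1) * expR (- y))%:E +
  \int[mu]_(y in `]1%R, +oo[) (y `^ (x - 1) * expR (- y))%:E)%E.
Proof.
rewrite -ge0_integral_setU//=.
- congr (integral _ _ _); apply/seteqP; split => y /=; rewrite !in_itv/= !andbT.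
    by move=> y0; case: (leP y 1) => h; [left|right]; rewrite ?y0.
  by case=> [/andP[]//|]; apply: lt_trans.
- by apply/measurable_EFinP; exact: measurable_gamma_integrand.
- by move=> y _; rewrite lee_fin gamma_integrand_ge0.
- apply/disj_setPS => y /= []; rewrite !in_itv/= andbT => /andP[_ y1] y1'; lra.
Qed.

(** On []0, 1]] the power alone dominates; on []1, +oo[] half of the exponential absorbs the power
    and the other half is integrable. *)
Lemma gamma_integral_lty x : 0 < x ->
  (\int[mu]_(y in `]0%R, +oo[) (y `^ (x - 1) * expR (- y))%:E < +oo)%E.
Proof.
move=> x0; rewrite gamma_integral_split; apply: lte_add_pinfty.
  apply: (@le_lt_trans _ _ (\int[mu]_(y in `]0%R, 1%R]) (y `^ (x - 1))%:E)%E).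
    apply: ge0_le_integral => //=.
    - by move=> y _; rewrite lee_fin gamma_integrand_ge0.
    - by apply/measurable_EFinP; exact: measurable_gamma_integrand.
    - apply/measurable_EFinP; apply: measurable_funTS; exact: measurable_powR.
    move=> y; rewrite in_itv/= => /andP[y0 _]; rewrite lee_fin.
    by rewrite ler_piMr ?powR_ge0// expR_le1; lra.
  by rewrite integral_powR// ?ltry//; lra.
(* Since [t <= exp t] at [t = y / (2 x)], one has [y <= 2 x exp(y / (2 x))], hence
   [y^x <= C exp(y / 2)]. *)
pose C := (2 * x) `^ x.
apply: (@le_lt_trans _ _ (\int[mu]_(y in `[1%R, +oo[) (C%:E * (expR (- (2^-1 * y)))%:E))%E).
  rewrite -[X in (_ <= X)%E]integral_itv_obnd_cbnd; last first.
    apply/measurable_funeM/measurable_EFinP; exact: measurable_expRN.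
  apply: ge0_le_integral => //=.
  - by move=> y _; rewrite lee_fin gamma_integrand_ge0.
  - by apply/measurable_EFinP; exact: measurable_gamma_integrand.
  - apply/measurable_funeM/measurable_EFinP; exact: measurable_expRN.
  move=> y; rewrite in_itv/= andbT => y1; rewrite -EFinM lee_fin.
  have y0 : 0 < y by lra.
  rewrite (@le_trans _ _ (y `^ x * expR (- y)))//.
    by rewrite ler_wpM2r ?expR_ge0// ler_powR//; lra.
  rewrite (_ : - y = - (2^-1 * y) + - (2^-1 * y)); last by lra.
  rewrite expRD mulrA ler_wpM2r ?expR_ge0//.
  rewrite -ler_pdivlMr ?expR_gt0// -expRN opprK.
  have -> : C * expR (2^-1 * y) = (2 * x * expR (y / (2 * x))) `^ x.
    rewrite powRM ?expR_ge0//; last by lra.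
    by rewrite -expRM; congr (_ * expR _); field; rewrite gt_eqF.
  apply: ge0_ler_powR; rewrite ?nnegrE; [lra|lra|by rewrite mulr_ge0 ?expR_ge0//; lra|].
  rewrite mulrC -ler_pdivrMr; last by lra.
  by rewrite (le_trans _ (expR_ge1Dx _))//; lra.
rewrite ge0_integralZl//=.
- by rewrite integral_expRN// -EFinM ltry.
- by apply/measurable_EFinP; exact: measurable_expRN.
- by rewrite lee_fin powR_ge0.
Qed.

Lemma Gamma_EFin x : 0 < x ->
  (\int[mu]_(y in `]0%R, +oo[) (y `^ (x - 1) * expR (- y))%:E = (Gamma x)%:E)%E.
Proof.
move=> x0; rewrite /Gamma /Rintegral fineK// ge0_fin_numE ?gamma_integral_lty//.
by apply: integral_ge0 => y _; rewrite lee_fin gamma_integrand_ge0.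
Qed.

Lemma Gamma_gt0 x : 0 < x -> 0 < Gamma x.
Proof.
move=> x0; rewrite -lte_fin -Gamma_EFin// gamma_integral_split.
apply: (@lt_le_trans _ _ (\int[mu]_(y in `]0%R, 1%R]) ((expR (-1))%:E * (y `^ (x - 1))%:E))%E).
  rewrite ge0_integralZl//=.
  - rewrite integral_powR// -?EFinM ?lte_fin; last by lra.
    by rewrite subrK mulr_gt0 ?expR_gt0 ?divr_gt0 ?powR_gt0.
  - apply/measurable_EFinP; apply: measurable_funTS; exact: measurable_powR.
  - by move=> y _; rewrite lee_fin powR_ge0.
apply: (@le_trans _ _ (\int[mu]_(y in `]0%R, 1%R]) (y `^ (x - 1) * expR (- y))%:E)%E); last first.
  by rewrite leeDl// integral_ge0// => y _; rewrite lee_fin gamma_integrand_ge0.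
apply: ge0_le_integral => //=.
- by move=> y _; rewrite -EFinM lee_fin mulr_ge0 ?powR_ge0 ?expR_ge0.
- apply/measurable_funeM/measurable_EFinP; apply: measurable_funTS; exact: measurable_powR.
- by apply/measurable_EFinP; exact: measurable_gamma_integrand.
move=> y; rewrite in_itv/= => /andP[y0 y1]; rewrite -EFinM lee_fin mulrC.
by rewrite ler_wpM2l ?powR_ge0// ler_expR lerN2.
Qed.

Lemma Gamma1 : Gamma 1 = 1 :> R.
Proof.
apply: EFin_inj; rewrite -Gamma_EFin//.
transitivity (\int[mu]_(y in `]0%R, +oo[) (expR (- (1 * y)))%:E)%E.
  by apply: eq_integral => y _; rewrite subrr powRr0 !mul1r.
rewrite integral_itv_obnd_cbnd ?integral_expRN//.
  by rewrite mulr0 oppr0 expR0 divr1.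
by apply/measurable_EFinP; exact: measurable_expRN.
Qed.

(** Writing [y^x] as the integral of [x z^(x-1)] over [0 < z < y] and exchanging the integrals
    leaves the tail integral of [exp(-y)] over [y > z], which is [exp(-z)]. This avoids the boundary
    terms of an integration by parts. *)
Lemma GammaS x : 0 < x -> Gamma (x + 1) = x * Gamma x.
Proof.
move=> x0; have x10 : 0 < x + 1 by lra.
apply: EFin_inj; rewrite -Gamma_EFin// EFinM -Gamma_EFin//.
transitivity (\int[mu]_(y in `]0%R, +oo[) \int[mu]_(z in `]0%R, +oo[ `&` [set z | (z < y)%R])
   (x * z `^ (x - 1) * expR (- y))%:E)%E.
  apply: eq_integral => y /set_mem/=; rewrite in_itv/= andbT => y0.
  rewrite addrK.
  have -> : `]0, +oo[%classic `&` [set z | z < y] = `]0, y[%classic.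
    by apply/seteqP; split => z /=; rewrite !in_itv/= andbT; [case=> -> ->|move=> /andP[]].
  under eq_integral do rewrite mulrAC EFinM.
  rewrite ge0_integralZl//=.
  - rewrite integral_itv_bndo_bndc.
      rewrite integral_powR//; last by lra.
      by rewrite subrK -EFinM; congr EFin; field; rewrite gt_eqF.
    apply/measurable_EFinP; apply: measurable_funTS; exact: measurable_powR.
  - apply/measurable_EFinP; apply: measurable_funTS; exact: measurable_powR.
  - by move=> z _; rewrite lee_fin powR_ge0.
  - by rewrite lee_fin mulr_ge0 ?expR_ge0// ltW.
have mD : measurable [set p : R * R | p.2 < p.1].
  have mf : measurable_fun setT (fun p : R * R => p.2 < p.1) by apply: measurable_fun_ltr.
  by rewrite -[X in measurable X]setTI; exact: (mf measurableT [set true] I).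
rewrite (@tonelli_set _ _ _ [set p | p.2 < p.1] (fun y z => x * z `^ (x - 1) * expR (- y)))//; last 2 first.
- apply: measurable_funM.
    apply: measurable_funM; first exact: measurable_cst.
    exact: measurable_powR_comp.
  by apply: measurableT_comp; [exact: measurable_expR|apply: measurableT_comp; first exact: oppr_measurable].
- by move=> y z; rewrite !mulr_ge0 ?powR_ge0 ?expR_ge0 ?ltW.
rewrite -ge0_integralZl//=; last 3 first.
- by apply/measurable_EFinP; exact: measurable_gamma_integrand.
- by move=> y _; rewrite lee_fin gamma_integrand_ge0.
- by rewrite lee_fin ltW.
apply: eq_integral => z /set_mem/=; rewrite in_itv/= andbT => z0.
have -> : `]0, +oo[%classic `&` [set y | z < y] = `]z, +oo[%classic.
  apply/seteqP; split => y /=; rewrite !in_itv/= !andbT; first by case.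
  by move=> zy; split => //; apply: lt_trans zy.
transitivity ((x * z `^ (x - 1))%:E * \int[mu]_(y in `]z, +oo[) (expR (- (1 * y)))%:E)%E.
  rewrite -ge0_integralZl; [|exact: measurable_itv| | |].
  - by apply: eq_integral => y _; rewrite mul1r EFinM.
  - by apply/measurable_EFinP; exact: measurable_expRN.
  - by move=> y _; rewrite lee_fin expR_ge0.
  - by rewrite lee_fin mulr_ge0 ?powR_ge0 ?(ltW x0).
rewrite integral_itv_obnd_cbnd ?integral_expRN//.
  by rewrite mul1r divr1 -!EFinM mulrA.
by apply/measurable_EFinP; exact: measurable_expRN.
Qed.

End Gamma.

Section Beta.
Context {R : realType}.
Notation mu := (@lebesgue_measure R).
Implicit Types (a b c x y z k p q w u v : R).

Lemma integralZl_ge0 d (T : measurableType d) (m : {measure set T -> \bar R})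
    (D : set T) k (f : T -> R) :
  measurable D -> 0 <= k -> measurable_fun D f -> (forall t, D t -> 0 <= f t) ->
  (\int[m]_(t in D) (k * f t)%:E = k%:E * \int[m]_(t in D) (f t)%:E)%E.
Proof.
move=> mD k0 mf f0; under eq_integral do rewrite EFinM.
rewrite ge0_integralZl//.
exact/measurable_EFinP.
Qed.

(** Positive bases written as exponentials turn an identity between products of real powers into a
    polynomial identity between exponents, which [ring] closes. *)
Lemma pos_expR x : 0 < x -> exists l, x = expR l.
Proof. by move=> x0; exists (ln x); rewrite lnK ?posrE. Qed.

(** The product [Gamma a * Gamma b] is a double integral over the quadrant. Scaling the second
    variable by the first, [y = x z], and integrating over [x] first produces
    [Gamma (a + b) (1 + z)^-(a+b)], by the scaling of [x] by [1 + z]. *)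
Lemma beta_integral a b : 0 < a -> 0 < b ->
  (\int[mu]_(z in `]0%R, +oo[) (z `^ (b - 1) * (1 + z) `^ (- (a + b)))%:E =
   (Gamma a * Gamma b / Gamma (a + b))%:E)%E.
Proof.
move=> a0 b0; have ab0 : 0 < a + b by lra.
suff H : ((Gamma (a + b))%:E * \int[mu]_(z in `]0%R, +oo[)
    (z `^ (b - 1) * (1 + z) `^ (- (a + b)))%:E = (Gamma a * Gamma b)%:E)%E.
  have Gn0 : Gamma (a + b) != 0 by rewrite gt_eqF ?Gamma_gt0.
  rewrite [RHS]EFinM -H muleC muleA -EFinM mulVf// mul1e//.
rewrite -integralZl_ge0//; first last.
- by move=> z _; rewrite mulr_ge0 ?powR_ge0.
- apply: measurable_funTS; apply: measurable_funM; apply: measurable_powR_comp => //.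
  by apply: measurable_funD => //; exact: measurable_cst.
- exact/ltW/Gamma_gt0.
rewrite [RHS]EFinM -(Gamma_EFin a0) -ge0_integralZr//=; first last.
- by rewrite lee_fin ltW// Gamma_gt0.
- by move=> y _; rewrite lee_fin gamma_integrand_ge0.
- by apply/measurable_EFinP; exact: measurable_gamma_integrand.
transitivity (\int[mu]_(x in `]0%R, +oo[) \int[mu]_(z in `]0%R, +oo[ `&` [set z | setT (x, z)])
   (x `^ (a + b - 1) * expR (- ((1 + z) * x)) * z `^ (b - 1))%:E)%E; last first.
  apply: eq_integral => x /set_mem/=; rewrite in_itv/= andbT => x0.
  rewrite (_ : [set z | setT (x, z)] = setT)// setIT.
  rewrite -(Gamma_EFin b0) [in RHS](@integral_scale_0y _ x)//; last 2 first.
  - by move=> z z0; exact: continuous_gamma_integrand.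
  - by move=> z z0; exact: gamma_integrand_ge0.
  rewrite -integralZl_ge0//; first last.
  - by move=> z _; rewrite !mulr_ge0 ?powR_ge0 ?expR_ge0// ltW.
  - apply: measurable_funTS; apply: measurable_funM => //; apply: measurable_funM.
      by apply: measurable_powR_comp; apply: measurable_funM => //.
    exact: measurable_expRN.
  - exact: gamma_integrand_ge0.
  apply: eq_integral => z /set_mem/=; rewrite in_itv/= andbT => z0.
  congr EFin; rewrite (_ : - ((1 + z) * x) = - x - x * z); last by ring.
  rewrite expRD; move: (expR (- x)) (expR (- (x * z))) (expR_gt0 (- x)) (expR_gt0 (- (x * z))) => c d c0 d0.
  have [? ->] := pos_expR x0; have [? ->] := pos_expR z0.
  have [? ->] := pos_expR c0; have [? ->] := pos_expR d0.
  by rewrite -?(expRD,expRM); congr expR; ring.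
rewrite tonelli_set//; last 2 first.
- apply: measurable_funM; last exact: measurable_powR_comp.
  apply: measurable_funM; first exact: measurable_powR_comp.
  apply: measurableT_comp; first exact: measurable_expR.
  apply: measurableT_comp; first exact: oppr_measurable.
  by apply: measurable_funM => //; apply: measurable_funD => //; exact: measurable_cst.
- by move=> x z; rewrite !mulr_ge0 ?powR_ge0 ?expR_ge0.
apply: eq_integral => z /set_mem/=; rewrite in_itv/= andbT => z0.
rewrite (_ : [set x | setT (x, z)] = setT)// setIT.
have z10 : 0 < 1 + z by lra.
transitivity ((z `^ (b - 1) * (1 + z) `^ (- (a + b)))%:E * (Gamma (a + b))%:E)%E.
  by rewrite -EFinM mulrC.
rewrite -(Gamma_EFin ab0) [in LHS](@integral_scale_0y _ (1 + z))//; last 2 first.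
- by move=> y y0; exact: continuous_gamma_integrand.
- by move=> y y0; exact: gamma_integrand_ge0.
rewrite -integralZl_ge0//; first last.
- by move=> y _; rewrite !mulr_ge0 ?powR_ge0 ?expR_ge0// ltW.
- apply: measurable_funTS; apply: measurable_funM => //; apply: measurable_funM.
    by apply: measurable_powR_comp; apply: measurable_funM => //.
  exact: measurable_expRN.
- by rewrite mulr_ge0 ?powR_ge0.
apply: eq_integral => x /set_mem/=; rewrite in_itv/= andbT => x0.
congr EFin; move: (1 + z) z10 => y y0.
move: (expR (- (y * x))) (expR_gt0 (- (y * x))) => c c0.
have [? ->] := pos_expR x0; have [? ->] := pos_expR z0; have [? ->] := pos_expR y0.
have [? ->] := pos_expR c0.
by rewrite -?(expRD,expRM); congr expR; ring.
Qed.

Lemma continuous_powR_comp (g : R -> R) p z : 0 < g z -> {for z, continuous g} ->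
  {for z, continuous (fun x => g x `^ p)}.
Proof. by move=> gz cg; exact: (continuous_comp cg (@continuous_powR R p (g z) gz)). Qed.

Lemma measurable_affine p q (D : set R) : measurable_fun D (fun z => p + q * z).
Proof.
by apply: measurable_funTS; apply: measurable_funD; [exact: measurable_cst|exact: measurable_funM].
Qed.

Lemma measurable_powR_affine p q w (D : set R) :
  measurable_fun D (fun z => (p + q * z) `^ w).
Proof. by apply: measurable_funTS; apply: measurable_powR_comp; exact: measurable_affine. Qed.

Lemma continuous_affine p q z : {for z, continuous (fun z => p + q * z)}.
Proof. by apply: cvgD; [exact: cvg_cst|apply: cvgMr]. Qed.

Lemma beta_integral_affine a b p q : 0 < a -> 0 < b -> 0 < p -> 0 < q ->
  (\int[mu]_(z in `]0%R, +oo[) (z `^ (b - 1) * (p + q * z) `^ (- (a + b)))%:E =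
   (p `^ (- a) * q `^ (- b) * (Gamma a * Gamma b / Gamma (a + b)))%:E)%E.
Proof.
move=> a0 b0 p0 q0; have pq0 : 0 < p / q by rewrite divr_gt0.
rewrite (@integral_scale_0y _ (p / q))//; last 2 first.
- move=> z z0; apply: cvgM; first exact: continuous_powR.
  apply: (@continuous_powR_comp (fun z => p + q * z)); first by rewrite addr_gt0// mulr_gt0.
  exact: continuous_affine.
- by move=> z z0; rewrite mulr_ge0 ?powR_ge0.
rewrite EFinM -beta_integral// -integralZl_ge0//; first last.
- by move=> y _; rewrite !mulr_ge0 ?powR_ge0.
- apply: measurable_funTS; apply: measurable_funM; apply: measurable_powR_comp => //.
  by apply: measurable_funD => //; exact: measurable_cst.
- by rewrite mulr_ge0 ?powR_ge0.
apply: eq_integral => z /set_mem/=; rewrite in_itv/= andbT => z0.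
congr EFin; have z10 : 0 < 1 + z by lra.
have -> : p + q * (p / q * z) = p * (1 + z) by field; rewrite gt_eqF.
move: (1 + z) z10 => y y0.
have [l ->] := pos_expR z0; have [m ->] := pos_expR y0; have [n ->] := pos_expR p0.
by have [? ->] := pos_expR q0; rewrite -?(expRN,expRD,expRM); congr expR; ring.
Qed.

(** With [r = u z / (1 + z)] one has [u - r = u / (1 + z)] and [v - r = (v + (v - u) z) / (1 + z)],
    so only powers of [z], of [1 + z] and of one affine function remain. In the two uses below the
    exponent of [1 + z] is [0] or [-1]. *)
Lemma integral_moebius u v p q w : 0 < u -> u < v ->
  (\int[mu]_(r in `]0%R, u[) (r `^ p * (u - r) `^ q * (v - r) `^ w)%:E =
   (u `^ (p + q + 1))%:E * \int[mu]_(z in `]0%R, +oo[)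
      (z `^ p * (1 + z) `^ (- (p + q + w + 2)) * (v + (v - u) * z) `^ w)%:E)%E.
Proof.
move=> u0 uv; pose F z := u * (z / (1 + z)); pose f z := u * (1 + z) `^ (- 2).
have imE : F @` `]0, +oo[%classic = `]0, u[%classic.
  apply/seteqP; split => x /=; rewrite in_itv/=.
    case=> z; rewrite in_itv/= andbT => z0 <-; rewrite /F mulr_gt0 ?divr_gt0//=; last by lra.
    by rewrite gtr_pMr// ltr_pdivrMr; lra.
  move=> /andP[x0 xu]; exists (x / (u - x)); rewrite ?in_itv/= ?andbT.
    by rewrite divr_gt0//; lra.
  by rewrite /F; field; apply/andP; split; apply/eqP; lra.
have dF z : 0 < z -> is_derive z 1 F (f z).
  move=> z0; have z1 : 1 + z != 0 by apply/eqP; lra.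
  rewrite /F; apply: is_derive_eq.
  rewrite /GRing.scale/= /f powRN -[2]/(2%:R) powR_mulrn; last by lra.
  by field.
rewrite -imE (ge0_substitution_0y dF).
- rewrite -integralZl_ge0; first last.
  + by move=> y _; rewrite !mulr_ge0 ?powR_ge0.
  + apply: measurable_funTS; apply: measurable_funM.
      by apply: measurable_funM; [exact: measurable_powR|exact/measurable_powR_comp/measurable_funD].
    exact: measurable_powR_affine.
  + exact: powR_ge0.
  + exact: measurable_itv.
  apply: eq_integral => z /set_mem/=; rewrite in_itv/= andbT => z0; congr EFin.
  have z1 : 0 < 1 + z by lra.
  have y0 : 0 < v + (v - u) * z by rewrite addr_gt0 ?mulr_gt0//; lra.
  have z1' : 1 + z != 0 by rewrite gt_eqF.
  rewrite (_ : u - F z = u / (1 + z)); last by rewrite /F; field.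
  rewrite (_ : v - F z = (v + (v - u) * z) / (1 + z)); last by rewrite /F; field.
  rewrite /f /F; move: (1 + z) (v + (v - u) * z) z1 y0 {z1'} => x y x0 y0.
  have [? ->] := pos_expR x0; have [? ->] := pos_expR y0; have [? ->] := pos_expR z0.
  by have [? ->] := pos_expR u0; rewrite -?(expRN,expRD,expRM); congr expR; ring.
- move=> x y x0 xy; rewrite /F ltr_pM2l// ltr_pdivrMr; last by lra.
  by rewrite mulrAC ltr_pdivlMr; [nra|lra].
- move=> z z0; rewrite /f; apply: cvgMr.
  apply: (@continuous_powR_comp (fun z => 1 + z)); first by lra.
  by apply: cvgD; [exact: cvg_cst|exact: cvg_id].
- move=> z z0; have /= : `]0, u[%classic (F z).
    by rewrite -imE; exists z => //=; rewrite in_itv/= andbT.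
  rewrite in_itv/= => /andP[Fz0 Fzu]; apply: cvgM; last first.
    by apply: (@continuous_powR_comp (fun z => v - z)); [lra|apply: continuousB => //; exact: cst_continuous].
  apply: cvgM; first exact: continuous_powR.
  by apply: (@continuous_powR_comp (fun z => u - z)); [lra|apply: continuousB => //; exact: cst_continuous].
- by move=> z z0; rewrite mulr_ge0 ?powR_ge0// ltW.
- by move=> z z0; rewrite !mulr_ge0 ?powR_ge0.
Qed.
End Beta.

(** * The Volterra kernel of fractional Brownian motion *)

Ltac mfun := repeat first
  [ exact: measurable_cst | exact: measurable_id | exact: measurable_fst | exact: measurable_snd
  | apply: measurable_funM | apply: measurable_funB | apply: measurable_funD
  | apply: measurable_powR_comp ].

(** * Reflections, triangles, and the two integrals that reduce to Beta integrals *)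

Section flip_tonelli.
Context {R : realType}.
Notation mu := (@lebesgue_measure R).
Implicit Types (a b c al r s t x y z k p q w u v : R).

(** A measure is determined by its values on the intervals []a, b]], whose preimages [[c - b, c -
    a[] have the same length. *)
Lemma lebesgue_measure_flip c (A : set R) : measurable A ->
  pushforward mu ((fun x => c - x) : _ -> measurableTypeR R) A = mu A.
Proof.
move=> mA.
have mphi : measurable_fun setT ((fun x => c - x) : measurableTypeR R -> measurableTypeR R) by exact: measurable_funB.
pose phi : {mfun measurableTypeR R >-> measurableTypeR R} := HB.pack ((fun x => c - x) : measurableTypeR R -> measurableTypeR R) (isMeasurableFun.Build _ _ _ _ _ mphi).
change (pushforward mu phi A = mu A).
apply/esym/lebesgue_measure_unique => //= _ [[a b]] _ <-.
rewrite /pushforward (_ : _ @^-1` _ = `[c - b, c - a[%classic); last first.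
  by apply/seteqP; split => x /=; rewrite ?in_itv/= => /andP[? ?]; apply/andP; split; lra.
apply: (etrans (lebesgue_measure_itv (`]a, b] : interval R))).
apply/esym/(etrans (lebesgue_measure_itv (`[(c - b)%R, (c - a)%R[ : interval R)))%E.
rewrite /= !lte_fin (_ : (c - b < c - a) = (a < b)); last by apply/idP/idP; lra.
by case: ifPn => // _; rewrite -!EFinB; congr EFin; ring.
Qed.

Lemma integral_flip c (D : set R) (f : R -> R) : measurable D ->
  measurable_fun setT f -> (forall x, 0 <= f x) ->
  (\int[mu]_(x in D) (f x)%:E =
   \int[mu]_(x in (fun x => (c - x)%R) @^-1` D) (f (c - x))%:E)%E.
Proof.
move=> mD mf f0.
have mphi : measurable_fun setT ((fun x => c - x) : measurableTypeR R -> measurableTypeR R).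
  exact: measurable_funB.
transitivity (\int[pushforward mu ((fun x => (c - x)%R) : measurableTypeR R -> measurableTypeR R)]_(x in D) (f x)%:E)%E.
  by apply: eq_measure_integral => /= A mA AS; exact/esym/lebesgue_measure_flip.
rewrite (ge0_integral_pushforward mphi)//=.
  by apply/measurable_EFinP; exact: measurable_funTS.
by move=> x _; rewrite lee_fin.
Qed.

Lemma integral_powR_itv p a b : -1 < p -> 0 <= a -> a < b ->
  (\int[mu]_(x in `]a, b[) (x `^ p)%:E =
   ((b `^ (p + 1) - a `^ (p + 1)) / (p + 1))%:E)%E.
Proof.
move=> p1 a0 ab; have p10 : 0 < p + 1 by lra.
rewrite integral_itv_bndo_bndc; last first.
  by apply/measurable_EFinP; apply: measurable_funTS; exact: measurable_powR.
have dF x : a < x <= b ->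
    is_derive x 1 (fun x => x `^ (p + 1) / (p + 1)) (x `^ p).
  move=> /andP[ax _]; have x0 : 0 < x by lra.
  apply: is_derive_eq; first by apply: is_deriveM; exact: is_derive1_powR.
  rewrite /GRing.scale/= mulr0 add0r addrK mulrA mulVf ?mul1r// gt_eqF//.
rewrite (ge0_FTC_oc ab dF)//.
- by rewrite mulrBl.
- by move=> x /andP[ax _]; apply: continuous_powR; lra.
- by move=> x _; exact: powR_ge0.
- apply: cvgM; last exact: cvg_cst.
  have [->|a0'] := eqVneq a 0; last first.
    by apply: cvg_at_right_filter; apply: continuous_powR; rewrite lt_neqAle eq_sym a0'.
  by rewrite powR0 ?gt_eqF//; exact: powR_cvg0.
Qed.

Lemma integral_powR_sub p s t : -1 < p -> 0 < s -> s <= t ->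
  (\int[mu]_(x in `]0%R, s[) ((t - x) `^ p)%:E =
   ((t `^ (p + 1) - (t - s) `^ (p + 1)) / (p + 1))%:E)%E.
Proof.
move=> p1 s0 st; rewrite -integral_powR_itv; [|exact: p1|lra|lra].
rewrite (@integral_flip t `]t - s, t[)//; last by move=> x; exact: powR_ge0.
  congr (integral _ _ _); apply/seteqP; split => x /=.
    by rewrite !in_itv/= => /andP[? ?]; apply/andP; split; lra.
  by rewrite !in_itv/= => /andP[? ?]; apply/andP; split; lra.
Qed.

Lemma tonelli_tri s (f : R -> R -> R) :
  measurable_fun setT (fun p : R * R => f p.1 p.2) -> (forall x y, 0 <= f x y) ->
  (\int[mu]_(r in `]0%R, s[) \int[mu]_(u in `]r, s[) (f r u)%:E =
   \int[mu]_(u in `]0%R, s[) \int[mu]_(r in `]0%R, u[) (f r u)%:E)%E.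
Proof.
move=> mf f0.
transitivity (\int[mu]_(r in `]0%R, s[) \int[mu]_(u in `]0%R, s[ `&` [set u | [set p : R * R | (p.1 < p.2)%R] (r, u)]) (f r u)%:E)%E.
  apply: eq_integral => r /set_mem/=; rewrite in_itv/= => /andP[r0 rs].
  congr (integral _ _ _); apply/seteqP; split => x /=; rewrite !in_itv/=.
    by move=> /andP[? ?]; split => //; apply/andP; split; lra.
  by case=> /andP[? ?] ?; apply/andP; split; lra.
rewrite tonelli_set; [|exact: measurable_itv|exact: measurable_itv|exact: measurable_lt_pair|exact: mf|exact: f0].
apply: eq_integral => r /set_mem/=; rewrite in_itv/= => /andP[r0 rs].
congr (integral _ _ _); apply/seteqP; split => x /=; rewrite !in_itv/=.
  by case=> /andP[? ?] ?; apply/andP; split; lra.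
by move=> /andP[? ?]; split => //; apply/andP; split; lra.
Qed.

Lemma tonelli_rect (A B : set R) (f : R -> R -> R) : measurable A -> measurable B ->
  measurable_fun setT (fun p : R * R => f p.1 p.2) -> (forall x y, 0 <= f x y) ->
  (\int[mu]_(r in A) \int[mu]_(u in B) (f r u)%:E =
   \int[mu]_(u in B) \int[mu]_(r in A) (f r u)%:E)%E.
Proof.
move=> mA mB mf f0; have := @tonelli_set R A B setT f mA mB measurableT mf f0.
have E (x : R) : [set y | [set: R * R] (x, y)] = setT by [].
have E' (x : R) : [set y | [set: R * R] (y, x)] = setT by [].
under eq_integral do rewrite E setIT.
by under [RHS]eq_integral do rewrite E' setIT.
Qed.

Lemma powRS x p : 0 < x -> x `^ (p + 1) = x `^ p * x.
Proof. by move=> x0; rewrite powRD ?powRr1 ?(ltW x0)// (gt_eqF x0) implybT. Qed.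

(* Normalized so that [cK H ^+ 2 * kap (H - 1/2) = 2 * H]. *)
Definition kap al : R := Gamma (1 - 2 * al) * Gamma (1 + al) / Gamma (1 - al).

Lemma kap_gt0 al : -1 < al -> al < 2^-1 -> 0 < kap al.
Proof. by move=> h1 h2; rewrite divr_gt0 ?mulr_gt0 ?Gamma_gt0//; lra. Qed.

(* The substitution [r = u z / (1 + z)] turns this into a Beta integral. *)
Lemma integral_W al u v : 0 < al -> al < 2^-1 -> 0 < u -> u < v ->
  (\int[mu]_(r in `]0%R, u[) (r `^ (- (2 * al)) * (u - r) `^ (al - 1) * (v - r) `^ (al - 1))%:E =
   (kap al / al * (u `^ (- al) * v `^ (- al) * (v - u) `^ (2 * al - 1)))%:E)%E.
Proof.
move=> al0 al1 u0 uv; rewrite integral_moebius//.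
transitivity ((u `^ (- (2 * al) + (al - 1) + 1))%:E * \int[mu]_(z in `]0%R, +oo[)
   (z `^ ((1 - 2 * al) - 1) * (v + (v - u) * z) `^ (- (al + (1 - 2 * al))))%:E)%E.
  congr (_ * _)%E; apply: eq_integral => z _; congr EFin.
  rewrite (_ : - (- (2 * al) + (al - 1) + (al - 1) + 2) = 0); last by ring.
  by rewrite powRr0 mulr1; congr (_ `^ _ * _ `^ _); ring.
rewrite beta_integral_affine//; [|lra|lra|lra].
rewrite -EFinM; congr EFin.
rewrite (_ : - (2 * al) + (al - 1) + 1 = - al); last by ring.
rewrite (_ : al + (1 - 2 * al) = 1 - al); last by ring.
rewrite (_ : - (1 - 2 * al) = 2 * al - 1); last by ring.
have g0 : Gamma (1 - al) != 0 by rewrite gt_eqF// Gamma_gt0//; lra.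
rewrite /kap [1 + al]addrC GammaS//; move: g0.
move: (Gamma (1 - al)) (Gamma al) (Gamma (1 - 2 * al)) => g1 g2 g3 g0; field.
by rewrite g0 gt_eqF.
Qed.

(** The substitution leaves a factor [1 / (1 + z)], which spoils the Beta form. As a function of [u]
    the integrand vanishes at [0], and its derivative at [v] is free of that factor because
    [(t + (t - v) z) + v z = t (1 + z)]. Writing it as the integral of this derivative over
    [0 < v < u] and exchanging leaves a Beta integral in [z]. *)
Lemma integral_G al u t : -1 < al -> al < 2^-1 -> 0 < u -> u < t ->
  (\int[mu]_(r in `]0%R, u[) (r `^ (- (2 * al)) * (u - r) `^ al * (t - r) `^ (al - 1))%:E =
   \int[mu]_(v in `]0%R, u[) (kap al * t `^ (- al) * (v `^ (- al) * (t - v) `^ (2 * al - 1)))%:E)%E.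
Proof.
move=> al0 al1 u0 ut; rewrite integral_moebius//.
have mf1 : measurable_fun setT (fun p : R * R => (1 - al) * t * (p.1 `^ (- (2 * al)) *
     (p.2 `^ (- al) * (t + (t - p.2) * p.1) `^ (al - 2)))) by mfun.
rewrite -integralZl_ge0; [|exact: measurable_itv|exact: powR_ge0|
  by apply: measurable_funTS; mfun|by move=> y _; rewrite !mulr_ge0 ?powR_ge0].
transitivity (\int[mu]_(z in `]0%R, +oo[) \int[mu]_(v in `]0%R, u[)
   ((1 - al) * t * (z `^ (- (2 * al)) * (v `^ (- al) * (t + (t - v) * z) `^ (al - 2))))%:E)%E.
  apply: eq_integral => z /set_mem/=; rewrite in_itv/= andbT => z0.
  have yv v : 0 < v <= u -> 0 < t + (t - v) * z.
    by move=> /andP[v0 vu]; rewrite addr_gt0 ?mulr_gt0//; lra.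
  rewrite integral_itv_bndo_bndc; last first.
    by apply/measurable_EFinP; apply: measurable_funTS; mfun.
  pose F v := z `^ (- (2 * al)) / (1 + z) * (v `^ (1 - al) * (t + (t - v) * z) `^ (al - 1)).
  have z1 : 0 < 1 + z by lra.
  have dF v : 0 < v <= u -> is_derive v 1 F
     ((1 - al) * t * (z `^ (- (2 * al)) * (v `^ (- al) * (t + (t - v) * z) `^ (al - 2)))).
    move=> vu; have y0 := yv v vu; have v0 : 0 < v by case/andP: vu.
    have h1 := is_derive1_powR (1 - al) v0.
    have h2 : is_derive v 1 (fun v => (t + (t - v) * z) `^ (al - 1))
      ((al - 1) * (t + (t - v) * z) `^ (al - 1 - 1) * (- z)).
      have h3 := is_derive1_powR (al - 1) y0.
      have h4 : is_derive v 1 (fun v => t + (t - v) * z) (- z).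
        by apply: is_derive_eq; rewrite /GRing.scale/=; ring.
      exact: (is_derive1_comp (g := fun v => t + (t - v) * z) h3 h4).
    rewrite /F; apply: is_derive_eq.
    rewrite /GRing.scale/=.
    rewrite (_ : 1 - al - 1 = - al); last by ring.
    rewrite (_ : al - 1 - 1 = al - 2); last by ring.
    rewrite {1}(_ : 1 - al = - al + 1); last by ring.
    rewrite (_ : al - 1 = al - 2 + 1) ?powRS//; last by ring.
    by field; rewrite gt_eqF.
  rewrite (ge0_FTC_oc u0 dF)//.
  - rewrite /F powR0; last by apply/eqP; lra.
    rewrite mul0r mulr0 subr0; congr EFin.
    rewrite (_ : - (- (2 * al) + al + (al - 1) + 2) = -1); last by ring.
    rewrite powR_inv1; last by lra.
    by rewrite (_ : - (2 * al) + al + 1 = 1 - al); ring.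
  - move=> v vu; have v0 : 0 < v by case/andP: vu.
    apply: cvgMr; apply: cvgMr; apply: cvgM; first exact: continuous_powR.
    apply: (@continuous_powR_comp _ (fun v => t + (t - v) * z)); first exact: yv.
    apply: (@is_derive_continuous _ _ (- z)).
    by apply: is_derive_eq; rewrite /GRing.scale/=; ring.
  - by move=> v _; rewrite !mulr_ge0 ?powR_ge0//; lra.
  - apply: cvgMr; apply: cvgM.
      by rewrite powR0; [apply: powR_cvg0; lra|apply/eqP; lra].
    apply: cvg_at_right_filter.
    apply: (@continuous_powR_comp _ (fun v => t + (t - v) * z)).
      by rewrite subr0; nra.
    apply: (@is_derive_continuous _ _ (- z)).
    by apply: is_derive_eq; rewrite /GRing.scale/=; ring.
rewrite tonelli_rect//; last by move=> x y; rewrite !mulr_ge0 ?powR_ge0//; lra.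
apply: eq_integral => v /set_mem/=; rewrite in_itv/= => /andP[v0 vu].
transitivity (((1 - al) * t * v `^ (- al))%:E * \int[mu]_(z in `]0%R, +oo[)
   (z `^ ((1 - 2 * al) - 1) * (t + (t - v) * z) `^ (- ((1 + al) + (1 - 2 * al))))%:E)%E.
  rewrite -integralZl_ge0//; first last.
  - by move=> y _; rewrite !mulr_ge0 ?powR_ge0.
  - by apply: measurable_funTS; mfun.
  - by rewrite !mulr_ge0 ?powR_ge0//; lra.
  apply: eq_integral => z _; congr EFin.
  rewrite (_ : 1 - 2 * al - 1 = - (2 * al)); last by ring.
  rewrite (_ : - (1 + al + (1 - 2 * al)) = al - 2); last by ring.
  by ring.
rewrite beta_integral_affine//; [|lra|lra|lra|lra].
rewrite -EFinM; congr EFin.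
rewrite (_ : - (1 - 2 * al) = 2 * al - 1); last by ring.
rewrite (_ : 1 + al + (1 - 2 * al) = (1 - al) + 1); last by ring.
rewrite (_ : - (1 + al) = - al - 1); last by ring.
have t0 : 0 < t by lra.
have -> : t `^ (- al) = t `^ (- al - 1) * t by rewrite -powRS// subrK.
rewrite GammaS; last by lra.
have g0 : Gamma (1 - al) != 0 by rewrite gt_eqF// Gamma_gt0//; lra.
have al1' : 1 - al != 0 by rewrite gt_eqF//; lra.
rewrite /kap; move: g0.
move: (Gamma (1 - al)) (Gamma (1 + al)) (Gamma (1 - 2 * al)) => g1 g2 g3 g0; field.
by rewrite g0 al1'.
Qed.

End flip_tonelli.

(** * Integrations by parts behind the positive forms of the kernel *)

Section parts.
Context {R : realType}.
Notation mu := (@lebesgue_measure R).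
Implicit Types (a b c al r s t x y z k p q w u v : R).

Lemma powR_cvgy0 p c : p < 0 -> (x - c) `^ p @[x --> +oo] --> (0 : R).
Proof.
move=> p0; have np0 : 0 < - p by lra.
apply/cvgrPdist_le => /= e e0; near=> x.
have x0 : 0 < x - c by rewrite subr_gt0; near: x; apply: nbhs_pinfty_gt; rewrite num_real.
rewrite sub0r normrN ger0_norm ?powR_ge0// -[p]opprK powRN.
rewrite -[leRHS]invrK lef_pV2 ?posrE ?invr_gt0 ?powR_gt0//.
have -> : e^-1 = (e^-1 `^ (- p)^-1) `^ (- p).
  by rewrite -powRrM mulVf ?powRr1 ?invr_ge0 ?ltW// gt_eqF.
apply: ge0_ler_powR; rewrite ?nnegrE ?powR_ge0//; [exact: ltW|exact: ltW|].
by rewrite lerBrDl; near: x; apply: nbhs_pinfty_ge; rewrite num_real.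
Unshelve. all: by end_near. Qed.

Lemma is_derive_powR_sub p c x : 0 < x - c ->
  is_derive x 1 (fun x => (x - c) `^ p) (p * (x - c) `^ (p - 1)).
Proof.
move=> xc; have h1 := is_derive1_powR p xc.
have h2 : is_derive x 1 (fun x => x - c) 1.
  by apply: is_derive_eq; rewrite subr0.
by rewrite -[_ * _]mulr1; exact: (is_derive1_comp (g := fun x => x - c) h1 h2).
Qed.

Lemma continuous_powR_sub p c x : 0 < x - c -> {for x, continuous (fun x => (x - c) `^ p)}.
Proof. by move=> xc; exact: is_derive_continuous (is_derive_powR_sub p xc). Qed.

Lemma is_derive_F al r x : 0 < x -> 0 < x - r ->
  is_derive x 1 (fun u => u `^ al * (u - r) `^ al)
    (al * ((x - r) `^ al * x `^ (al - 1) + (x - r) `^ (al - 1) * x `^ al)).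
Proof.
move=> x0 xr; have h1 := is_derive1_powR al x0; have h2 := is_derive_powR_sub al xr.
by apply: is_derive_eq; rewrite /GRing.scale/=; ring.
Qed.

Lemma continuous_f k al r x : 0 < x -> 0 < x - r -> {for x, continuous (fun x =>
    (k * ((x - r) `^ al * x `^ (al - 1) + (x - r) `^ (al - 1) * x `^ al)))}.
Proof.
move=> x0 xr; apply: cvgMr; apply: cvgD.
  by apply: cvgM; [exact: continuous_powR_sub|exact: continuous_powR].
by apply: cvgM; [exact: continuous_powR_sub|exact: continuous_powR].
Qed.

Lemma measurable_pp p q r (D : set R) : measurable_fun D (fun u => (u - r) `^ p * u `^ q).
Proof. by apply: measurable_funTS; mfun. Qed.

Lemma integral_ppD al r (D : set R) k : measurable D -> 0 <= k ->
  (\int[mu]_(u in D) (k * ((u - r) `^ al * u `^ (al - 1) + (u - r) `^ (al - 1) * u `^ al))%:E =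
  k%:E * (\int[mu]_(u in D) ((u - r) `^ al * u `^ (al - 1))%:E +
   \int[mu]_(u in D) ((u - r) `^ (al - 1) * u `^ al)%:E))%E.
Proof.
move=> mD k0; rewrite integralZl_ge0//.
- congr (_ * _)%E; rewrite -ge0_integralD//=.
  + by move=> u _; rewrite lee_fin mulr_ge0 ?powR_ge0.
  + by apply/measurable_EFinP; exact: measurable_pp.
  + by move=> u _; rewrite lee_fin mulr_ge0 ?powR_ge0.
  + by apply/measurable_EFinP; exact: measurable_pp.
- by apply: measurable_funD; exact: measurable_pp.
- by move=> u _; rewrite addr_ge0 ?mulr_ge0 ?powR_ge0.
Qed.

(** For [al > 0] the product [u^al (u - r)^al] vanishes at [u = r], so it is the integral of its
    positive derivative from there. This trades the difference in the kernel for a single positive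
    integral. *)
Lemma parts_pos al r t : 0 < al -> 0 < r -> r < t ->
  ((t `^ al * (t - r) `^ al)%:E =
  al%:E * (\int[mu]_(u in `]r, t[) ((u - r) `^ al * u `^ (al - 1))%:E +
   \int[mu]_(u in `]r, t[) ((u - r) `^ (al - 1) * u `^ al)%:E))%E.
Proof.
move=> al0 r0 rt; rewrite -integral_ppD//; last exact: ltW.
rewrite integral_itv_bndo_bndc; last first.
  apply/measurable_EFinP; apply: measurable_funM; first exact: measurable_cst.
  by apply: measurable_funD; exact: measurable_pp.
have dF x : r < x <= t -> is_derive x 1 (fun u => u `^ al * (u - r) `^ al)
    (al * ((x - r) `^ al * x `^ (al - 1) + (x - r) `^ (al - 1) * x `^ al)).
  by move=> /andP[rx _]; apply: is_derive_F; lra.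
rewrite (ge0_FTC_oc rt dF)//.
- by rewrite subrr powR0 ?gt_eqF// mulr0 subr0.
- by move=> x /andP[rx _]; apply: continuous_f; lra.
- by move=> x _; rewrite mulr_ge0 ?addr_ge0 ?mulr_ge0 ?powR_ge0// ltW.
- apply: cvgM.
    by apply: cvg_at_right_filter; exact: continuous_powR.
  rewrite subrr powR0 ?gt_eqF//.
  apply/cvg_at_rightP => h [hr hcv].
  have /cvg_at_rightP := @powR_cvg0 R al al0; apply; split.
    by move=> n; rewrite subr_gt0.
  by rewrite -(subrr r); apply: cvgB => //; exact: cvg_cst.
Qed.

(** For [al < 0] the product blows up at [r] but vanishes at infinity, so its decrease is integrated
    over the tail instead. *)
Lemma parts_neg al r t : al < 0 -> 0 < r -> r < t ->
  ((t `^ al * (t - r) `^ al)%:E =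
  (- al)%:E * (\int[mu]_(u in `]t, +oo[) ((u - r) `^ al * u `^ (al - 1))%:E +
   \int[mu]_(u in `]t, +oo[) ((u - r) `^ (al - 1) * u `^ al)%:E))%E.
Proof.
move=> al0 r0 rt; rewrite -integral_ppD//; last by lra.
rewrite integral_itv_obnd_cbnd; last first.
  apply/measurable_EFinP; apply: measurable_funM; first exact: measurable_cst.
  by apply: measurable_funD; exact: measurable_pp.
pose F u := - (u `^ al * (u - r) `^ al).
have dF x : t <= x -> is_derive x 1 F
    (- al * ((x - r) `^ al * x `^ (al - 1) + (x - r) `^ (al - 1) * x `^ al)).
  move=> tx; have h : is_derive x 1 (fun u => u `^ al * (u - r) `^ al)
    (al * ((x - r) `^ al * x `^ (al - 1) + (x - r) `^ (al - 1) * x `^ al)).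
    by apply: is_derive_F; lra.
  by rewrite /F; apply: is_derive_eq; rewrite mulNr.
rewrite (@ge0_continuous_FTC2y _ _ F t 0)//.
- by rewrite /F sub0e -EFinN opprK.
- by move=> x tx; rewrite mulr_ge0 ?addr_ge0 ?mulr_ge0 ?powR_ge0//; lra.
- apply: continuous_in_subspaceT => x /set_mem/=; rewrite in_itv/= andbT => tx.
  by apply: continuous_f; lra.
- rewrite -oppr0; apply: cvgN; rewrite -(mulr0 0); apply: cvgM; last exact: powR_cvgy0.
  have := @powR_cvgy0 al 0 al0; apply: cvg_trans; apply: near_eq_cvg.
  by apply: nearW => x; rewrite subr0.
- by move=> x tx; case: (dF x (ltW tx)).
- by apply: cvg_at_right_filter; exact: is_derive_continuous (dF t (lexx t)).
- by move=> x; rewrite in_itv/= andbT => tx; rewrite derive1E; case: (dF x (ltW tx)).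
Qed.

Lemma integral_tail p v t : p < 0 -> v < t ->
  (\int[mu]_(u in `]t, +oo[) ((u - v) `^ (p - 1))%:E = ((t - v) `^ p / (- p))%:E)%E.
Proof.
move=> p0 vt; rewrite integral_itv_obnd_cbnd; last first.
  by apply/measurable_EFinP; apply: measurable_funTS; mfun.
pose F u := p^-1 * (u - v) `^ p.
have dF x : t <= x -> is_derive x 1 F ((x - v) `^ (p - 1)).
  move=> tx; have h : is_derive x 1 (fun u => (u - v) `^ p) (p * (x - v) `^ (p - 1)).
    by apply: is_derive_powR_sub; lra.
  rewrite /F; apply: is_derive_eq; rewrite /GRing.scale/= mulrA mulVf ?mul1r ?lt_eqF//.
rewrite (@ge0_continuous_FTC2y _ _ F t 0)//.
- by rewrite /F sub0e -EFinN; congr EFin; field; rewrite lt_eqF.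
- by move=> x _; exact: powR_ge0.
- apply: continuous_in_subspaceT => x /set_mem/=; rewrite in_itv/= andbT => tx.
  by apply: continuous_powR_sub; lra.
- by rewrite -(mulr0 p^-1); apply: cvgMr; exact: powR_cvgy0.
- by move=> x tx; case: (dF x (ltW tx)).
- by apply: cvg_at_right_filter; exact: is_derive_continuous (dF t (lexx t)).
- by move=> x; rewrite in_itv/= andbT => tx; rewrite derive1E; case: (dF x (ltW tx)).
Qed.

(** With [u = r + r z] this is a Beta integral. Its value lets the integral over []r, t[] in the
    kernel be traded for one over []t, +oo[], the range of the integration by parts for negative
    exponents. *)
Lemma integral_full al r : -1 < al -> al < 0 -> 0 < r ->
  (\int[mu]_(u in `]r, +oo[) ((u - r) `^ al * u `^ (al - 1))%:E =
   (r `^ (2 * al) * (kap al / (2 * (- al))))%:E)%E.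
Proof.
move=> al1 al0 r0; pose F z := r + r * z.
have imE : F @` `]0, +oo[%classic = `]r, +oo[%classic.
  apply/seteqP; split => x /=; rewrite in_itv/= andbT.
    by case=> z; rewrite in_itv/= andbT => z0 <-; rewrite /F ltrDl mulr_gt0.
  move=> rx; exists ((x - r) / r); rewrite ?in_itv/= ?andbT.
    by rewrite divr_gt0//; lra.
  by rewrite /F; field; rewrite gt_eqF.
have dF z : 0 < z -> is_derive z 1 F (cst r z).
  by move=> z0; rewrite /F; apply: is_derive_eq; rewrite /GRing.scale/=; ring.
rewrite -imE (ge0_substitution_0y dF)//.
- transitivity (\int[mu]_(z in `]0%R, +oo[) (r `^ (2 * al) *
     (z `^ ((1 + al) - 1) * (1 + z) `^ (- (- (2 * al) + (1 + al)))))%:E)%E.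
    apply: eq_integral => z /set_mem/=; rewrite in_itv/= andbT => z0.
    rewrite (_ : F z - r = r * z); last by rewrite /F; ring.
    rewrite (_ : F z = r * (1 + z)); last by rewrite /F; ring.
    have z1 : 0 < 1 + z by lra.
    congr EFin; move: (1 + z) z1 => y y0.
    have [? ->] := pos_expR r0; have [? ->] := pos_expR y0; have [? ->] := pos_expR z0.
    by rewrite -?(expRN,expRD,expRM); congr expR; ring.
  rewrite integralZl_ge0//; first last.
  + by move=> z _; rewrite mulr_ge0 ?powR_ge0.
  + by apply: measurable_funTS; mfun.
  + exact: powR_ge0.
  rewrite beta_integral//; [|lra|lra]; rewrite -EFinM; congr EFin.
  rewrite (_ : - (2 * al) + (1 + al) = 1 - al); last by ring.
  rewrite /kap (_ : 1 - 2 * al = - (2 * al) + 1); last by ring.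
  rewrite GammaS; last by lra.
  have g0 : Gamma (1 - al) != 0 by rewrite gt_eqF// Gamma_gt0//; lra.
  have al0' : al != 0 by rewrite lt_eqF.
  move: g0; move: (Gamma (1 - al)) (Gamma (1 + al)) (Gamma (- (2 * al))) => g1 g2 g3 g0; field.
  by rewrite al0' g0.
- by move=> x y x0 xy; rewrite /F ltrD2l ltr_pM2l.
- by move=> z z0; exact: cvg_cst.
- move=> z z0; have rz : 0 < r * z by rewrite mulr_gt0.
  by apply: cvgM; [apply: continuous_powR_sub|apply: continuous_powR]; rewrite /F; lra.
- by move=> z z0; exact: ltW.
- by move=> z z0; rewrite mulr_ge0 ?powR_ge0.
Qed.

End parts.

(** * Positive forms of the kernel on each side of H = 1/2 *)

Section K_fbm.
Context {R : realType}.
Notation mu := (@lebesgue_measure R).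
Implicit Types (a b c al r s t x y z k p q w u v H : R).

Definition cK H : R := C1 H / Gamma (H + 2^-1).

Lemma cK_ge0 H : 0 < H -> 0 <= cK H.
Proof. by move=> H0; rewrite divr_ge0 ?sqrtr_ge0// ltW// Gamma_gt0//; lra. Qed.

Lemma cK_sqr H : 0 < H -> H < 1 -> cK H ^+ 2 * kap (H - 2^-1) = 2 * H.
Proof.
move=> H0 H1; rewrite /cK /C1 /kap exprMn sqr_sqrtr; last first.
  by rewrite divr_ge0 ?mulr_ge0// ltW// ?Gamma_gt0//; lra.
rewrite (_ : 1 - 2 * (H - 2^-1) = 2 - 2 * H); last by lra.
rewrite (_ : 1 + (H - 2^-1) = H + 2^-1); last by lra.
rewrite (_ : 1 - (H - 2^-1) = 3 / 2 - H); last by lra.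
have g1 : 0 < Gamma (H + 2^-1) by apply: Gamma_gt0; lra.
have g2 : 0 < Gamma (3 / 2 - H) by apply: Gamma_gt0; lra.
have g3 : 0 < Gamma (2 - 2 * H) by apply: Gamma_gt0; lra.
move: (Gamma (H + 2^-1)) (Gamma (3 / 2 - H)) (Gamma (2 - 2 * H)) g1 g2 g3 => x y z x0 y0 z0.
by field; rewrite !gt_eqF.
Qed.

Lemma K_fbmE H t r : 0 < r -> r < t ->
  K_fbm H t r = cK H * r `^ (- (H - 2^-1)) * (t `^ (H - 2^-1) * (t - r) `^ (H - 2^-1)
    - (H - 2^-1) * fine (\int[mu]_(u in `]r, t[) ((u - r) `^ (H - 2^-1) * u `^ (H - 2^-1 - 1))%:E)%E).
Proof.
move=> r0 rt; have t0 : 0 < t by lra.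
rewrite /K_fbm -/(cK H) /Rintegral (_ : 2^-1 - H = - (H - 2^-1)); last by ring.
rewrite (_ : H - 3 / 2 = H - 2^-1 - 1); last by field.
rewrite -integral_itv_obnd_cbnd; last by apply/measurable_EFinP; exact: measurable_pp.
rewrite -integral_itv_bndo_bndc; last by apply/measurable_EFinP; exact: measurable_pp.
rewrite powRM ?invr_ge0 ?ltW// -(powR_inv1 (ltW r0)) -powRrM mulN1r; ring.
Qed.

Lemma integral_pp_ge0 p q r (D : set R) :
  (0 <= \int[mu]_(u in D) ((u - r) `^ p * u `^ q)%:E)%E.
Proof. by apply: integral_ge0 => u _; rewrite lee_fin mulr_ge0 ?powR_ge0. Qed.

(** By [parts_pos] the boundary term is the sum of two integrals, one of which is exactly what the
    kernel subtracts. *)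
Lemma K_fbm_pos H t r : 2^-1 < H -> 0 < r -> r < t ->
  ((K_fbm H t r)%:E = (cK H * (H - 2^-1) * r `^ (- (H - 2^-1)))%:E *
    \int[mu]_(u in `]r, t[) ((u - r) `^ (H - 2^-1 - 1) * u `^ (H - 2^-1))%:E)%E.
Proof.
move=> H2 r0 rt; rewrite K_fbmE//; set al := H - 2^-1; have al0 : 0 < al by rewrite /al; lra.
have := @parts_pos _ al r t al0 r0 rt.
have := @integral_pp_ge0 al (al - 1) r `]r, t[.
have := @integral_pp_ge0 (al - 1) al r `]r, t[.
(* Neither integral is infinite: their sum times [al > 0] is a real number. *)
case: (\int[mu]_(u in `]r, t[) ((u - r) `^ (al - 1) * u `^ al)%:E)%E => [y||//].
  case: (\int[mu]_(u in `]r, t[) ((u - r) `^ al * u `^ (al - 1))%:E)%E => [x||//].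
    by move=> _ _; rewrite -EFinD -!EFinM => -[->]; congr EFin => /=; ring.
  by move=> _ _; rewrite addye// gt0_muley ?lte_fin.
move=> _; case: (\int[mu]_(u in `]r, t[) ((u - r) `^ al * u `^ (al - 1))%:E)%E => [x||//] _;
  by rewrite ?addey// gt0_muley ?lte_fin.
Qed.

Lemma integral_split_oy r t (f : R -> R) : r < t -> measurable_fun setT f ->
  (forall x, 0 <= f x) ->
  (\int[mu]_(u in `]r, +oo[) (f u)%:E = \int[mu]_(u in `]r, t[) (f u)%:E +
     \int[mu]_(u in `]t, +oo[) (f u)%:E)%E.
Proof.
move=> rt mf f0; rewrite [in RHS]integral_itv_bndo_bndc; last first.
  by apply/measurable_EFinP; exact: measurable_funTS.
rewrite -ge0_integral_setU//=.
- congr (integral _ _ _); apply/seteqP; split => y /=; rewrite !in_itv/= !andbT.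
    by move=> y0; case: (leP y t) => h; [left|right]; rewrite ?y0.
  by case=> [/andP[]//|]; apply: lt_trans.
- by apply/measurable_EFinP; exact: measurable_funTS.
- by move=> y _; rewrite lee_fin.
- apply/disj_setPS => y /= []; rewrite !in_itv/= andbT => /andP[_ y1] y1'; lra.
Qed.

(** Here [-(H - 1/2)] is positive, so both forms have only nonnegative terms: the definition itself,
    and its rewriting over the tail by [parts_neg] and [integral_full]. The covariance computation
    uses the first form for the smaller time and the second for the larger one. *)
Lemma K_fbm_neg H t r : 0 < H -> H < 2^-1 -> 0 < r -> r < t ->
  ((K_fbm H t r)%:E = (cK H * r `^ (- (H - 2^-1)))%:E *
     ((t `^ (H - 2^-1) * (t - r) `^ (H - 2^-1))%:E + (- (H - 2^-1))%:E *
    \int[mu]_(u in `]r, t[) ((u - r) `^ (H - 2^-1) * u `^ (H - 2^-1 - 1))%:E))%E /\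
  ((K_fbm H t r)%:E = (cK H)%:E *
     ((kap (H - 2^-1) / 2 * r `^ (H - 2^-1))%:E + (- (H - 2^-1) * r `^ (- (H - 2^-1)))%:E *
    \int[mu]_(u in `]t, +oo[) ((u - r) `^ (H - 2^-1 - 1) * u `^ (H - 2^-1))%:E))%E.
Proof.
move=> H0 H2 r0 rt; rewrite K_fbmE//; set al := H - 2^-1; have al0 : 0 < - al by rewrite /al; lra.
have := @parts_neg _ al r t _ r0 rt; rewrite -oppr_gt0 => /(_ al0).
have := @integral_full _ al r; move=> /(_ _ _ r0) h.
have /h : -1 < al by rewrite /al; lra.
rewrite -oppr_gt0 => /(_ al0) {h}.
rewrite (@integral_split_oy r t)//; [|by mfun|by move=> x; rewrite mulr_ge0 ?powR_ge0].
have := @integral_pp_ge0 al (al - 1) r `]r, t[.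
have := @integral_pp_ge0 al (al - 1) r `]t, +oo[.
have := @integral_pp_ge0 (al - 1) al r `]t, +oo[.
case: (\int[mu]_(u in `]r, t[) ((u - r) `^ al * u `^ (al - 1))%:E)%E => [x||//]; last first.
  by case: (\int[mu]_(u in `]t, +oo[) ((u - r) `^ al * u `^ (al - 1))%:E)%E => [y||//].
case: (\int[mu]_(u in `]t, +oo[) ((u - r) `^ al * u `^ (al - 1))%:E)%E => [y| |//].
2: by move=> _ _ _; rewrite addey.
case: (\int[mu]_(u in `]t, +oo[) ((u - r) `^ (al - 1) * u `^ al)%:E)%E => [z||//]; last first.
  by move=> _ _ _ _; rewrite addey// gt0_muley ?lte_fin.
move=> _ _ _; rewrite -!EFinD -!EFinM /= => -[h1] [->].
split; first by congr EFin; ring.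
congr EFin.
have -> : y = r `^ (2 * al) * (kap al / (2 * - al)) - x by lra.
have -> : r `^ (2 * al) = r `^ al * r `^ al by rewrite -powRD ?(gt_eqF r0) ?implybT// mulr2n mulrDl !mul1r.
have := powR_gt0 al r0; rewrite powRN; move: (r `^ al) => P P0.
by field; rewrite gt_eqF// lt_eqF//; lra.
Qed.

Lemma K_fbm_half t r : 0 < r -> r < t -> K_fbm 2^-1 t r = 1.
Proof.
move=> r0 rt; rewrite K_fbmE// subrr !powRr0 mul0r subr0 !mulr1 oppr0 powRr0 mulr1.
rewrite /cK /C1 (_ : 2^-1 + 2^-1 = 1); last by field.
rewrite (_ : 3 / 2 - 2^-1 = 1); last by field.
rewrite (_ : 2 - 2 * 2^-1 = 1); last by field.
by rewrite Gamma1 mulfV ?mulr1 ?divr1 ?sqrtr1.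
Qed.

Lemma K_fbm_ge0 H t r : 0 < H -> 0 < r -> r < t -> 0 <= K_fbm H t r.
Proof.
move=> H0 r0 rt; have c0 := cK_ge0 H0.
case: (ltrgtP H 2^-1) => [H2|H2|->]; last by rewrite K_fbm_half.
- rewrite -lee_fin; have [-> _] := K_fbm_neg H0 H2 r0 rt.
  apply: mule_ge0; first by rewrite lee_fin mulr_ge0 ?powR_ge0.
  apply: adde_ge0; first by rewrite lee_fin mulr_ge0 ?powR_ge0.
  by apply: mule_ge0; [rewrite lee_fin; lra|exact: integral_pp_ge0].
- rewrite -lee_fin K_fbm_pos// mule_ge0 ?integral_pp_ge0// lee_fin.
  by rewrite mulr_ge0 ?powR_ge0// mulr_ge0// subr_ge0 ltW.
Qed.

(** The variable is the lower limit of the inner integral. Restricting the integrand to the region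
    [r < u < t] of the plane makes that integral a Tonelli section, which is measurable in [r]. *)
Lemma measurable_K H t : measurable_fun `]0, t[ (K_fbm H t).
Proof.
pose g r := cK H * r `^ (- (H - 2^-1)) * (t `^ (H - 2^-1) * (t - r) `^ (H - 2^-1)
    - (H - 2^-1) * fine (\int[mu]_(u in `]r, t[) ((u - r) `^ (H - 2^-1) * u `^ (H - 2^-1 - 1))%:E)%E).
apply: (eq_measurable_fun g).
  by move=> r /set_mem/=; rewrite in_itv/= => /andP[r0 rt]; rewrite K_fbmE.
apply: measurable_funTS; rewrite /g; apply: measurable_funM; first by mfun.
apply: measurable_funB; first by mfun.
apply: measurable_funM; first by mfun.
apply: measurableT_comp; first exact: fine_measurable.
pose D := [set p : R * R | p.1 < p.2 /\ p.2 < t].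
have mD : measurable D.
  apply: measurableI; first exact: measurable_lt_pair.
  have mf : measurable_fun setT (fun p : R * R => p.2 < t) by apply: measurable_fun_ltr.
  by have := mf measurableT [set true] I; rewrite setTI.
pose F := (EFin \o (fun p : R * R => (p.2 - p.1) `^ (H - 2^-1) * p.2 `^ (H - 2^-1 - 1))) \_ D.
have mF : measurable_fun setT F.
  apply/(measurable_restrictT _ _).1 => //.
  by apply: measurable_funTS; apply/measurable_EFinP; mfun.
have F0 (P : R * R) : (0 <= F P)%E.
  by apply: erestrict_ge0 => q _; rewrite lee_fin mulr_ge0 ?powR_ge0.
have := @measurable_fun_fubini_tonelli_F _ _ _ _ _ mu F mF F0.
rewrite /fubini_F; congr (measurable_fun _ _); apply/funext => r.
rewrite [RHS]integral_mkcond; apply: eq_integral => u _.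
rewrite /F /patch; congr (if _ then _ else _).
apply/idP/idP => /set_mem H'; apply/mem_set; move: H'; rewrite /D/= in_itv/=.
  by case=> -> ->.
by move=> /andP[].
Qed.

End K_fbm.

Section inner_integrals.
Context {R : realType}.
Notation mu := (@lebesgue_measure R).
Implicit Types (a b c al r s t x y z k p q w u v H : R).

Lemma integral_powR_pos p a b : p + 1 != 0 -> 0 < a -> a < b ->
  (\int[mu]_(x in `]a, b[) (x `^ p)%:E =
   ((b `^ (p + 1) - a `^ (p + 1)) / (p + 1))%:E)%E.
Proof.
move=> p10 a0 ab.
rewrite integral_itv_bndo_bndc; last first.
  by apply/measurable_EFinP; apply: measurable_funTS; exact: measurable_powR.
have dF x : a < x <= b ->
    is_derive x 1 (fun x => x `^ (p + 1) / (p + 1)) (x `^ p).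
  move=> /andP[ax _]; have x0 : 0 < x by lra.
  apply: is_derive_eq; first by apply: is_deriveM; exact: is_derive1_powR.
  by rewrite /GRing.scale/= ?mulr0 ?add0r ?addr0 addrK; field.
rewrite (ge0_FTC_oc ab dF)//.
- by rewrite mulrBl.
- by move=> x /andP[ax _]; apply: continuous_powR; lra.
- by move=> x _; exact: powR_ge0.
- apply: cvgM; last exact: cvg_cst.
  by apply: cvg_at_right_filter; exact: continuous_powR.
Qed.

Lemma integral_powR_shift p a b : -1 < p -> a < b ->
  (\int[mu]_(x in `]a, b[) ((x - a) `^ p)%:E = ((b - a) `^ (p + 1) / (p + 1))%:E)%E.
Proof.
move=> p1 ab; rewrite (@integral_flip _ b)//; last 2 first.
- by mfun.
- by move=> x; exact: powR_ge0.
transitivity (\int[mu]_(x in `]0%R, (b - a)%R[) (((b - a) - x) `^ p)%:E)%E.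
  rewrite (_ : _ @^-1` _ = `]0, b - a[%classic).
    by apply: eq_integral => x _; rewrite addrAC.
  by apply/seteqP; split => x /=; rewrite !in_itv/= => /andP[? ?]; apply/andP; split; lra.
rewrite integral_powR_sub//; last by lra.
by rewrite subrr powR0 ?subr0//; apply/eqP; lra.
Qed.

Lemma measurable_inner_set (B : set R) (D : set (R * R)) (f : R -> R -> R) :
  measurable B -> measurable D ->
  measurable_fun setT (fun p : R * R => f p.1 p.2) -> (forall x y, 0 <= f x y) ->
  measurable_fun setT (fun x => \int[mu]_(y in B `&` [set y | D (x, y)]) (f x y)%:E)%E.
Proof.
move=> mB mD mf f0.
pose F := (EFin \o (fun p : R * R => f p.1 p.2)) \_ (setT `*` B `&` D).
have mF : measurable_fun setT F.
  apply/(measurable_restrictT _ _).1 => //.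
    by apply: measurableI => //; exact: measurableX.
  by apply: measurable_funTS; apply/measurable_EFinP.
have F0 (P : R * R) : (0 <= F P)%E by apply: erestrict_ge0 => q _; rewrite lee_fin.
have := @measurable_fun_fubini_tonelli_F _ _ _ _ _ mu F mF F0.
rewrite /fubini_F; congr (measurable_fun _ _); apply/funext => r.
rewrite [RHS]integral_mkcond; apply: eq_integral => u _.
rewrite /F /patch; congr (if _ then _ else _).
by apply/idP/idP => /set_mem H'; apply/mem_set; [case: H' => -[]|case: H'].
Qed.

Lemma measurable_inner_tri s (E : set R) (f : R -> R -> R) : measurable_fun setT (fun p : R * R => f p.1 p.2) ->
  (forall x y, 0 <= f x y) ->
  measurable_fun E (fun r => \int[mu]_(u in `]r, s[) (f r u)%:E)%E.
Proof.
move=> mf f0; apply: measurable_funTS.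
have := @measurable_inner_set `]-oo, s[%classic _ f (measurable_itv _) measurable_lt_pair mf f0.
congr (measurable_fun _ _); apply/funext => r; congr (integral _ _ _).
by apply/seteqP; split => x /=; rewrite !in_itv/=; [case=> -> ->|move=> /andP[]].
Qed.

Lemma measurable_inner_rect (B : set R) (E : set R) (f : R -> R -> R) : measurable B ->
  measurable_fun setT (fun p : R * R => f p.1 p.2) ->
  (forall x y, 0 <= f x y) ->
  measurable_fun E (fun r => \int[mu]_(u in B) (f r u)%:E)%E.
Proof.
move=> mB mf f0; apply: measurable_funTS.
have := @measurable_inner_set B setT f mB measurableT mf f0.
by congr (measurable_fun _ _); apply/funext => r; rewrite (_ : [set y | _] = setT)// setIT.
Qed.

(** Cutting to []0, t[] puts the kernels of all times in one space L2(R), and discards the default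
    values of inverse and power at [r <= 0] and [r >= t]. *)
Definition kf H t : R -> R := K_fbm H t \_ `]0, t[.

Lemma kfE H t r : 0 < r -> r < t -> kf H t r = K_fbm H t r.
Proof. by move=> r0 rt; rewrite /kf patchE mem_set//= in_itv/= r0 rt. Qed.

Lemma kf_ge0 H t r : 0 < H -> 0 <= kf H t r.
Proof.
move=> H0; rewrite /kf patchE; case: ifPn => // /set_mem/=; rewrite in_itv/= => /andP[r0 rt].
exact: K_fbm_ge0.
Qed.

Lemma measurable_kf H t : measurable_fun setT (kf H t).
Proof. by apply/(measurable_restrictT _ _).1 => //; exact: measurable_K. Qed.

(** The tail form of the kernel is inserted. Integrating over [r] before the tail variable gives
    [integral_G], whose right side is again an integral over []0, u[]; exchanging once more leaves
    an elementary tail of a power. *)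
Lemma cov_neg_N H t u : 0 < H -> H < 2^-1 -> 0 < u -> u <= t ->
  (\int[mu]_(r in `]0%R, u[) (kf H t r * (r `^ (- (H - 2^-1)) * (u - r) `^ (H - 2^-1)))%:E =
   \int[mu]_(v in `]0%R, u[) (cK H * (kap (H - 2^-1) / 2) * (v `^ (H - 2^-1) +
       v `^ (- (H - 2^-1)) * (t - v) `^ (2 * (H - 2^-1))))%:E)%E.
Proof.
move=> H0 H2 u0 ut.
have [cc ccE c0] : exists2 cc : R, cc = cK H & 0 <= cc by exists (cK H); rewrite ?cK_ge0.
pose al := H - 2^-1; have al0 : 0 < - al by rewrite /al; lra.
have al1 : - 2^-1 < al by rewrite /al; lra.
have k0' : 0 < kap al by apply: kap_gt0; lra.
have [ka kE k0] : exists2 ka : R, ka = kap al & 0 < ka.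
  by eexists; [reflexivity|exact: k0'].
clear k0'.
rewrite -/al -ccE -kE.
pose f1 r v := cc * (- al) * r `^ (- al) * r `^ (- al) * (u - r) `^ al * ((v - r) `^ (al - 1) * v `^ al).
have mf1 : measurable_fun setT (fun p : R * R => f1 p.1 p.2) by rewrite /f1; mfun.
have f10 x y : 0 <= f1 x y by rewrite /f1 !mulr_ge0 ?powR_ge0// ltW.
transitivity (\int[mu]_(r in `]0%R, u[) ((cc * (ka / 2) * (u - r) `^ al)%:E +
    \int[mu]_(v in `]t, +oo[) (f1 r v)%:E))%E.
  apply: eq_integral => r /set_mem/=; rewrite in_itv/= => /andP[r0 ru].
  rewrite EFinM kfE//; last by lra.
  have [_ ->] := @K_fbm_neg R H t r H0 H2 r0 (lt_le_trans ru ut); rewrite -/al -ccE -kE.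
  have -> : (\int[mu]_(v in `]t, +oo[) (f1 r v)%:E =
    (cc * (- al) * r `^ (- al) * r `^ (- al) * (u - r) `^ al)%:E *
     \int[mu]_(v in `]t, +oo[) ((v - r) `^ (al - 1) * v `^ al)%:E)%E.
    rewrite -integralZl_ge0//.
    - by rewrite !mulr_ge0 ?powR_ge0// ltW.
    - by apply: measurable_funTS; mfun.
    - by move=> v _; rewrite mulr_ge0 ?powR_ge0.
  have := @integral_pp_ge0 R (al - 1) al r `]t, +oo[.
  set X := (\int[mu]_(v in _) _)%E => X0.
  rewrite muleAC -EFinM ge0_muleDr//; last 2 first.
  - by rewrite lee_fin !mulr_ge0 ?powR_ge0// ltW.
  - by rewrite mule_ge0// lee_fin mulr_ge0 ?powR_ge0// ltW.
  rewrite muleA -!EFinM; congr (_ + _)%E; [congr EFin|congr (_%:E * _)%E; ring].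
  by rewrite powRN; have := powR_gt0 al r0 => h; field; rewrite gt_eqF.
rewrite ge0_integralD//=; first last.
- exact: measurable_inner_rect.
- by move=> r _; apply: integral_ge0 => v _; rewrite lee_fin.
- by apply/measurable_EFinP; apply: measurable_funTS; mfun.
- by move=> r _; rewrite lee_fin !mulr_ge0 ?powR_ge0// ltW// divr_gt0.
transitivity (\int[mu]_(v in `]0%R, u[) ((cc * (ka / 2) * v `^ al)%:E +
   (cc * (ka / 2) * (v `^ (- al) * (t - v) `^ (2 * al)))%:E))%E; last first.
  by apply: eq_integral => v _; rewrite -EFinD -mulrDr.
rewrite [in RHS]ge0_integralD//=; first last.
- by apply/measurable_EFinP; apply: measurable_funTS; mfun.
- by move=> r _; rewrite lee_fin !mulr_ge0 ?powR_ge0// ltW// divr_gt0.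
- by apply/measurable_EFinP; apply: measurable_funTS; mfun.
- by move=> r _; rewrite lee_fin !mulr_ge0 ?powR_ge0// ltW// divr_gt0.
(* Reflecting []0, u[] exchanges the two integrands; both sides are evaluated to the same power of
   [u]. *)
have E : (\int[mu]_(x in `]0%R, u[) (cc * (ka / 2) * (u - x) `^ al)%:E =
    \int[mu]_(x in `]0%R, u[) (cc * (ka / 2) * x `^ al)%:E)%E.
  have Z (g : R -> R) : measurable_fun setT g -> (forall x, 0 <= g x) ->
      (\int[mu]_(x in `]0%R, u[) (cc * (ka / 2) * g x)%:E =
       (cc * (ka / 2))%:E * \int[mu]_(x in `]0%R, u[) (g x)%:E)%E.
    move=> mg g0; apply: integralZl_ge0.
    - exact: measurable_itv.
    - by rewrite mulr_ge0// divr_ge0// ltW.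
    - exact: measurable_funTS.
    - by move=> x _; exact: g0.
  rewrite (Z (fun x => (u - x) `^ al)); [|by mfun|by move=> x; exact: powR_ge0].
  rewrite (Z (fun x => x `^ al)); [|by mfun|by move=> x; exact: powR_ge0].
  rewrite integral_powR_sub; [|lra|lra|lra].
  by rewrite integral_powR_itv ?subrr//; lra.
rewrite E; apply: f_equal => {E}.
rewrite (tonelli_rect (measurable_itv _) (measurable_itv _) mf1 f10).
pose f2 v w := cc * (- al) * ka * v `^ al * v `^ (- al) * (w `^ (- al) * (v - w) `^ (2 * al - 1)).
transitivity (\int[mu]_(v in `]t, +oo[) \int[mu]_(w in `]0%R, u[) (f2 v w)%:E)%E.
  apply: eq_integral => v /set_mem/=; rewrite in_itv/= andbT => tv.
  transitivity ((cc * (- al) * v `^ al)%:E * \int[mu]_(r in `]0%R, u[)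
      (r `^ (- (2 * al)) * (u - r) `^ al * (v - r) `^ (al - 1))%:E)%E.
    rewrite -integralZl_ge0; first last.
    - by move=> r _; rewrite !mulr_ge0 ?powR_ge0.
    - by apply: measurable_funTS; mfun.
    - by rewrite !mulr_ge0 ?powR_ge0// ltW.
    - exact: measurable_itv.
    apply: eq_integral => r /set_mem/=; rewrite in_itv/= => /andP[r0 ru]; congr EFin.
    have -> : r `^ (- (2 * al)) = r `^ (- al) * r `^ (- al).
      by rewrite -powRD ?(gt_eqF r0) ?implybT//; congr (_ `^ _); ring.
    by rewrite /f1; ring.
  rewrite integral_G; [|lra|lra|lra|lra].
  rewrite -kE.
  rewrite -integralZl_ge0; first last.
  - by move=> w _; rewrite !mulr_ge0 ?powR_ge0// ltW.
  - by apply: measurable_funTS; mfun.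
  - by rewrite !mulr_ge0 ?powR_ge0// ltW.
  - exact: measurable_itv.
  by apply: eq_integral => w _; congr EFin; rewrite /f2; ring.
have mf2 : measurable_fun setT (fun p : R * R => f2 p.1 p.2) by rewrite /f2; mfun.
rewrite tonelli_rect//; last by move=> x y; rewrite /f2 !mulr_ge0 ?powR_ge0// ltW.
apply: eq_integral => w /set_mem/=; rewrite in_itv/= => /andP[w0 wu].
transitivity ((cc * (- al) * ka * w `^ (- al))%:E *
  \int[mu]_(v in `]t, +oo[) ((v - w) `^ (2 * al - 1))%:E)%E.
  rewrite -integralZl_ge0//; first last.
  - by move=> v _; exact: powR_ge0.
  - by apply: measurable_funTS; mfun.
  - by rewrite !mulr_ge0 ?powR_ge0// ltW.
  apply: eq_integral => v /set_mem/=; rewrite in_itv/= andbT => tv; congr EFin.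
  have vp : 0 < v by lra.
  by rewrite /f2 powRN; have := powR_gt0 al vp => h; field; rewrite gt_eqF.
rewrite integral_tail//; [|lra|lra]; rewrite -EFinM; congr EFin.
by field; rewrite lt_eqF//; lra.
Qed.

Lemma fbm_cov_integral H s t : 0 < H -> 0 < s -> s <= t ->
  (\int[mu]_(v in `]0%R, s[) (H * (v `^ (2 * (H - 2^-1)) + (t - v) `^ (2 * (H - 2^-1))))%:E =
   (fbm_cov H s t)%:E)%E.
Proof.
move=> H0 s0 st; rewrite integralZl_ge0//; first last.
- by move=> v _; rewrite addr_ge0 ?powR_ge0.
- by apply: measurable_funTS; mfun.
- exact: ltW.
transitivity (H%:E * \int[mu]_(v in `]0%R, s[) ((v `^ (2 * (H - 2^-1)))%:E + ((t - v) `^ (2 * (H - 2^-1)))%:E))%E.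
  by congr (_ * _)%E; apply: eq_integral => v _; rewrite EFinD.
rewrite ge0_integralD//=; first last.
- by apply/measurable_EFinP; apply: measurable_funTS; mfun.
- by move=> v _; rewrite lee_fin powR_ge0.
- by apply/measurable_EFinP; apply: measurable_funTS; mfun.
- by move=> v _; rewrite lee_fin powR_ge0.
rewrite integral_powR_sub//; last by lra.
rewrite integral_powR_itv//; last by lra.
rewrite -EFinD -EFinM /fbm_cov ger0_norm; last by lra.
rewrite (_ : 2 * (H - 2^-1) + 1 = 2 * H); last by field.
by rewrite powR0 ?gt_eqF ?mulr_gt0//; congr EFin; field; rewrite gt_eqF.
Qed.

End inner_integrals.

(** * Covariance of the kernel *)

Section K_covariance.
Context {R : realType}.
Notation mu := (@lebesgue_measure R).
Implicit Types (a b c al r s t x y z k p q w u v H : R).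

(* Each kernel is itself an integral over a second variable; by Tonelli the
   integral over [r] comes first, and it is a Beta integral. Both for H > 1/2 and
   for H < 1/2 what remains is the integral of [H * (v ^ (2H-1) + (t - v) ^ (2H-1))]
   over [0 < v < s]. *)
Lemma K_cov H s t : 0 < H -> H < 1 -> 0 < s -> s <= t ->
  (\int[mu]_(r in `]0%R, s[) (kf H t r * kf H s r)%:E = (fbm_cov H s t)%:E)%E.
Proof.
move=> H0 H1 s0 st; rewrite -fbm_cov_integral//.
have [cc ccE c0] : exists2 cc : R, cc = cK H & 0 <= cc by exists (cK H); rewrite ?cK_ge0.
have k0' : 0 < kap (H - 2^-1) by apply: kap_gt0; lra.
have [ka kE k0] : exists2 ka : R, ka = kap (H - 2^-1) & 0 < ka.
  by eexists; [reflexivity|exact: k0'].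
clear k0'.
have HE : H = cc ^+ 2 * ka / 2 by rewrite ccE kE (cK_sqr H0 H1); field.
have mk : measurable_fun setT (fun p : R * R => kf H t p.1).
  by apply: measurableT_comp; [exact: measurable_kf|exact: measurable_fst].
have kt0 r : 0 <= kf H t r by exact: kf_ge0.
case: (ltrgtP H 2^-1) => [H2|H2|H2]; last first.
- have -> : 2 * (H - 2^-1) = 0 by rewrite H2 subrr mulr0.
  apply: eq_integral => v /set_mem/=; rewrite in_itv/= => /andP[v0 vs].
  by rewrite !kfE//; [rewrite H2 !K_fbm_half//; [rewrite !powRr0; congr EFin; field|lra]|lra].
- pose al := H - 2^-1; have al0 : 0 < al by rewrite /al; lra.
  rewrite -/al; have al1 : al < 2^-1 by rewrite /al; lra.
  pose f1 r u := kf H t r * (cc * al * r `^ (- al)) * ((u - r) `^ (al - 1) * u `^ al).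
  have f10 x y : 0 <= f1 x y by rewrite /f1 !mulr_ge0 ?powR_ge0// ltW.
  have mf1 : measurable_fun setT (fun p : R * R => f1 p.1 p.2).
    by rewrite /f1; apply: measurable_funM; [apply: measurable_funM => //; mfun|mfun].
  transitivity (\int[mu]_(r in `]0%R, s[) \int[mu]_(u in `]r, s[) (f1 r u)%:E)%E.
    apply: eq_integral => r /set_mem/=; rewrite in_itv/= => /andP[r0 rs].
    rewrite EFinM [in kf H s r]kfE// K_fbm_pos// -/al -ccE muleA -EFinM -integralZl_ge0//.
    - by rewrite !mulr_ge0 ?powR_ge0// ltW.
    - by apply: measurable_funTS; mfun.
    - by move=> u _; rewrite mulr_ge0 ?powR_ge0.
  rewrite (tonelli_tri _ mf1 f10); apply: eq_integral => u /set_mem/=; rewrite in_itv/= => /andP[u0 us].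
  have ut : u < t by lra.
  pose f2 r v := cc * al * (cc * al * u `^ al) * (r `^ (- (2 * al)) * (u - r) `^ (al - 1) * ((v - r) `^ (al - 1) * v `^ al)).
  have f20 x y : 0 <= f2 x y by rewrite /f2 !mulr_ge0 ?powR_ge0// ltW.
  have mf2 : measurable_fun setT (fun p : R * R => f2 p.1 p.2) by rewrite /f2; mfun.
  (* [integral_W] wants [r] to run up to the smaller of [u] and [v]. Splitting at [v = u] separates
     the two orders: a triangle below [u] and a rectangle above. *)
  transitivity (\int[mu]_(r in `]0%R, u[) (\int[mu]_(v in `]r, u[) (f2 r v)%:E + \int[mu]_(v in `]u, t[) (f2 r v)%:E))%E.
    apply: eq_integral => r /set_mem/=; rewrite in_itv/= => /andP[r0 ru].
    rewrite [in LHS]/f1 kfE//; last by lra.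
    transitivity ((cc * al * r `^ (- al) * ((u - r) `^ (al - 1) * u `^ al))%:E * (K_fbm H t r)%:E)%E.
      by rewrite -EFinM; congr EFin; ring.
    rewrite K_fbm_pos//; last by lra.
    rewrite -/al -ccE muleA -EFinM -integralZl_ge0//; first last.
    - by move=> v _; rewrite mulr_ge0 ?powR_ge0.
    - by apply: measurable_funTS; mfun.
    - by rewrite !mulr_ge0 ?powR_ge0// ltW.
    transitivity (\int[mu]_(v in `]r, t[) (f2 r v)%:E)%E.
      apply: eq_integral => v _; congr EFin; rewrite /f2.
      have -> : r `^ (- (2 * al)) = r `^ (- al) * r `^ (- al).
        by rewrite -powRD ?(gt_eqF r0) ?implybT//; congr (_ `^ _); ring.
      ring.
    rewrite [in RHS]integral_itv_bndo_bndc; last first.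
      by apply/measurable_EFinP; apply: measurable_funTS; rewrite /f2; mfun.
    rewrite -ge0_integral_setU//=.
    - congr (integral _ _ _); apply/seteqP; split => y /=; rewrite !in_itv/=.
        by move=> /andP[y0 yt]; case: (leP y u) => h; [left|right]; rewrite ?y0//.
      by case=> /andP[y0 yt]; apply/andP; split; lra.
    - by apply/measurable_EFinP; apply: measurable_funTS; rewrite /f2; mfun.
    - by move=> y _; rewrite lee_fin.
    - by apply/disj_setPS => y /= []; rewrite !in_itv/= => /andP[_ y1] /andP[y1' _]; lra.
  rewrite ge0_integralD//=; first last.
  - exact: measurable_inner_rect.
  - by move=> r _; apply: integral_ge0 => v _; rewrite lee_fin.
  - exact: measurable_inner_tri.
  - by move=> r _; apply: integral_ge0 => v _; rewrite lee_fin.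
  rewrite [X in (X + _)%E](tonelli_tri u mf2 f20).
  rewrite [X in (_ + X)%E](tonelli_rect (measurable_itv _) (measurable_itv _) mf2 f20).
  transitivity (\int[mu]_(v in `]0%R, u[) (cc ^+ 2 * al * ka * (u - v) `^ (2 * al - 1))%:E +
     \int[mu]_(v in `]u, t[) (cc ^+ 2 * al * ka * (v - u) `^ (2 * al - 1))%:E)%E.
    congr (_ + _)%E; apply: eq_integral => v /set_mem/=; rewrite in_itv/= => /andP[v0 vu].
      transitivity ((cc * al * (cc * al * u `^ al) * v `^ al)%:E * \int[mu]_(r in `]0%R, v[)
         (r `^ (- (2 * al)) * (v - r) `^ (al - 1) * (u - r) `^ (al - 1))%:E)%E.
        rewrite -integralZl_ge0//; first last.
        - by move=> r _; rewrite !mulr_ge0 ?powR_ge0.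
        - by apply: measurable_funTS; mfun.
        - by rewrite !mulr_ge0 ?powR_ge0// ltW.
        by apply: eq_integral => r _; congr EFin; rewrite /f2; ring.
      rewrite integral_W// -kE -EFinM; congr EFin.
      rewrite !powRN; have := powR_gt0 al v0; have := powR_gt0 al u0 => h1 h2.
      by field; rewrite !gt_eqF.
    have v0' : 0 < v by lra.
    transitivity ((cc * al * (cc * al * u `^ al) * v `^ al)%:E * \int[mu]_(r in `]0%R, u[)
         (r `^ (- (2 * al)) * (u - r) `^ (al - 1) * (v - r) `^ (al - 1))%:E)%E.
      rewrite -integralZl_ge0//; first last.
      - by move=> r _; rewrite !mulr_ge0 ?powR_ge0.
      - by apply: measurable_funTS; mfun.
      - by rewrite !mulr_ge0 ?powR_ge0// ltW.
      by apply: eq_integral => r _; congr EFin; rewrite /f2; ring.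
    rewrite integral_W// -kE -EFinM; congr EFin.
    rewrite !powRN; have := powR_gt0 al v0'; have := powR_gt0 al u0 => h1 h2.
    by field; rewrite !gt_eqF.
  have kk : 0 <= cc ^+ 2 * al * ka by rewrite !mulr_ge0 ?sqr_ge0// ltW.
  rewrite !integralZl_ge0//; first last.
  - by move=> v _; exact: powR_ge0.
  - by apply: measurable_funTS; mfun.
  - by move=> v _; exact: powR_ge0.
  - by apply: measurable_funTS; mfun.
  rewrite integral_powR_sub//; last by lra.
  rewrite integral_powR_shift//; last by lra.
  rewrite -!EFinM -EFinD; congr EFin; rewrite HE -/al subrr subrK powR0; last by apply/eqP; lra.
  by field; rewrite gt_eqF.
- pose al := H - 2^-1; have al0 : 0 < - al by rewrite /al; lra.
  rewrite -/al.
  pose f1 r u := kf H t r * (cc * (- al) * r `^ (- al)) * ((u - r) `^ al * u `^ (al - 1)).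
  have f10 x y : 0 <= f1 x y by rewrite /f1 !mulr_ge0 ?powR_ge0// ltW.
  have mf1 : measurable_fun setT (fun p : R * R => f1 p.1 p.2).
    by rewrite /f1; apply: measurable_funM; [apply: measurable_funM => //; mfun|mfun].
  pose w v := cc * (ka / 2) * (v `^ al + v `^ (- al) * (t - v) `^ (2 * al)).
  have w0 v : 0 <= w v by rewrite /w mulr_ge0 ?addr_ge0 ?mulr_ge0 ?powR_ge0// ltW// divr_gt0.
  have mw : measurable_fun setT w by rewrite /w; mfun.
  have N u : 0 < u -> u <= t -> (\int[mu]_(r in `]0%R, u[) (kf H t r * (r `^ (- al) * (u - r) `^ al))%:E =
     \int[mu]_(v in `]0%R, u[) (w v)%:E)%E by move=> u0 ut; rewrite /w ccE kE; exact: cov_neg_N.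
  transitivity (\int[mu]_(r in `]0%R, s[) ((cc * s `^ al * (kf H t r * (r `^ (- al) * (s - r) `^ al)))%:E +
      \int[mu]_(u in `]r, s[) (f1 r u)%:E))%E.
    apply: eq_integral => r /set_mem/=; rewrite in_itv/= => /andP[r0 rs].
    rewrite EFinM [in kf H s r]kfE//; have [-> _] := @K_fbm_neg R H s r H0 H2 r0 rs; rewrite -/al -ccE.
    have -> : (\int[mu]_(u in `]r, s[) (f1 r u)%:E = (kf H t r * (cc * (- al) * r `^ (- al)))%:E *
        \int[mu]_(u in `]r, s[) ((u - r) `^ al * u `^ (al - 1))%:E)%E.
      rewrite -integralZl_ge0//.
      - by rewrite !mulr_ge0 ?powR_ge0// ltW.
      - by apply: measurable_funTS; mfun.
      - by move=> v _; rewrite mulr_ge0 ?powR_ge0.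
    have := @integral_pp_ge0 R al (al - 1) r `]r, s[.
    set X := (\int[mu]_(v in _) _)%E => X0.
    rewrite muleA -EFinM ge0_muleDr//; last 2 first.
    + by rewrite lee_fin mulr_ge0 ?powR_ge0.
    + by rewrite mule_ge0// lee_fin ltW.
    by rewrite muleA -!EFinM; congr (_%:E + _%:E * _)%E; ring.
  have mkk u : measurable_fun setT (fun r => kf H t r * (r `^ (- al) * (u - r) `^ al)).
    by apply: measurable_funM; [exact: measurable_kf|mfun].
  rewrite ge0_integralD//=; first last.
  + exact: measurable_inner_tri.
  + by move=> r _; apply: integral_ge0 => v _; rewrite lee_fin.
  + apply/measurable_EFinP; apply: measurable_funTS; apply: measurable_funM; [exact: measurable_cst|exact: mkk].
  + by move=> r _; rewrite lee_fin !mulr_ge0 ?powR_ge0.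
  rewrite integralZl_ge0//; first last.
  + by move=> r _; rewrite !mulr_ge0 ?powR_ge0.
  + apply: measurable_funTS; exact: mkk.
  + by rewrite mulr_ge0 ?powR_ge0.
  rewrite N// (tonelli_tri _ mf1 f10).
  pose f2 v u := cc * w v * (- al) * u `^ (al - 1).
  have cw v : 0 <= cc * w v * (- al).
    by apply: mulr_ge0; [apply: mulr_ge0; [exact: c0|exact: w0]|exact: ltW].
  have f20 x y : 0 <= f2 x y by apply: mulr_ge0; [exact: cw|exact: powR_ge0].
  have mf2 : measurable_fun setT (fun p : R * R => f2 p.1 p.2).
    rewrite /f2; apply: measurable_funM; last by mfun.
    apply: measurable_funM; last by mfun.
    apply: measurable_funM; first by mfun.
    by apply: measurableT_comp; [exact: mw|exact: measurable_fst].
  transitivity ((cc * s `^ al)%:E * \int[mu]_(v in `]0%R, s[) (w v)%:E +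
     \int[mu]_(u in `]0%R, s[) \int[mu]_(v in `]0%R, u[) (f2 v u)%:E)%E.
    congr (_ + _)%E; apply: eq_integral => u /set_mem/=; rewrite in_itv/= => /andP[u0 us].
    transitivity ((cc * (- al) * u `^ (al - 1))%:E * \int[mu]_(r in `]0%R, u[) (kf H t r * (r `^ (- al) * (u - r) `^ al))%:E)%E.
      rewrite -integralZl_ge0//; first last.
      + by move=> r _; rewrite !mulr_ge0 ?powR_ge0.
      + by apply: measurable_funTS; exact: mkk.
      + by rewrite !mulr_ge0 ?powR_ge0// ltW.
      by apply: eq_integral => r _; congr EFin; rewrite /f1; ring.
    rewrite N//; last by lra.
    rewrite -integralZl_ge0//; first last.
    + exact: measurable_funTS.
    + by rewrite !mulr_ge0 ?powR_ge0// ltW.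
    by apply: eq_integral => r _; congr EFin; rewrite /f2; ring.
  rewrite -(tonelli_tri _ mf2 f20) -integralZl_ge0//; first last.
  + exact: measurable_funTS.
  + by rewrite mulr_ge0 ?powR_ge0.
  rewrite -ge0_integralD//=; first last.
  + exact: measurable_inner_tri.
  + by move=> r _; apply: integral_ge0 => v _; rewrite lee_fin.
  + by apply/measurable_EFinP; apply: measurable_funTS; apply: measurable_funM => //; mfun.
  + by move=> r _; rewrite lee_fin; apply: mulr_ge0; [apply: mulr_ge0; [exact: c0|exact: powR_ge0]|exact: w0].
  (* The boundary term disappears here: the total weight of [w v] is [s^al - al] times the integral
     of [u^(al-1)] over []v, s[], that is [v^al]. *)
  apply: eq_integral => v /set_mem/=; rewrite in_itv/= => /andP[v0 vs].
  rewrite integralZl_ge0//; first last.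
  + by move=> u _; exact: powR_ge0.
  + by apply: measurable_funTS; mfun.
  rewrite integral_powR_pos//; [|by apply/eqP; lra].
  rewrite subrK -!EFinM -EFinD; congr EFin; rewrite HE -/al /w.
  have -> : v `^ (2 * al) = v `^ al * v `^ al.
    by rewrite -powRD ?(gt_eqF v0) ?implybT//; congr (_ `^ _); ring.
  rewrite powRN; have := powR_gt0 al v0 => h.
  by field; rewrite (gt_eqF h) lt_eqF//; lra.
Qed.

End K_covariance.

(** * Minimization in L2 *)

Section L2.
Context {d : measure_display} {T : measurableType d} {R : realType}.
Variable m : {measure set T -> \bar R}.
Implicit Types (f g h : T -> R) (a b : R).

Notation L2 := (fun f : T -> R => f \in Lfun m 2%:E).

Definition ip f g : R := \int[m]_x (f x * g x).

Lemma L2_measurable f : L2 f -> measurable_fun setT f.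
Proof. by move=> /andP[+ _]; rewrite inE. Qed.

Lemma L2_ext f g : f =1 g -> L2 f -> L2 g.
Proof. by move=> /funext ->. Qed.

Lemma L2Z a f : L2 f -> L2 (fun x => a * f x).
Proof.
move=> L; have := @Lfun_scale _ _ _ m f a 2 (ler1n _ 2) L.
by apply: L2_ext => x /=; rewrite mulrC.
Qed.

Lemma L2D f g : L2 f -> L2 g -> L2 (fun x => f x + g x).
Proof. by move=> Lf Lg; have [_] := @Lfun_addr_closed _ _ _ m 2%:E (lee1n 2); apply. Qed.

Lemma L2B f g : L2 f -> L2 g -> L2 (fun x => f x - g x).
Proof.
move=> Lf Lg; have := L2D Lf (L2Z (-1) Lg).
by apply: L2_ext => x; rewrite mulN1r.
Qed.

Lemma L2_0 : L2 (fun=> 0).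
Proof. by have [+ _] := @Lfun_addr_closed _ _ _ m 2%:E (lee1n 2). Qed.

Lemma L2_sum (I : Type) (r : seq I) (f : I -> T -> R) : (forall i, L2 (f i)) ->
  L2 (fun x => \sum_(i <- r) f i x).
Proof.
move=> Lf; elim: r => [|i r IH].
  by apply: (L2_ext _ L2_0) => x; rewrite big_nil.
by apply: (L2_ext _ (L2D (Lf i) IH)) => x; rewrite big_cons.
Qed.

Lemma ip_integrable f g : L2 f -> L2 g -> m.-integrable setT (EFin \o (fun x => f x * g x)).
Proof. by move=> Lf Lg; apply/Lfun1_integrable; exact: Lfun2_mul_Lfun1. Qed.

Lemma L2_intro f : measurable_fun setT f -> (\int[m]_x ((f x) ^+ 2)%:E < +oo)%E -> L2 f.
Proof.
move=> mf fi; apply/andP; split; first by rewrite inE.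
rewrite inE/= /finite_norm unlock; apply: poweR_lty.
apply: le_lt_trans fi; apply: ge0_le_integral => //=.
- apply/measurable_EFinP; apply: (measurableT_comp (measurable_powR 2)).
  exact: measurableT_comp.
- by apply/measurable_EFinP; exact: measurable_funX.
- by move=> x _; rewrite lee_fin powR_mulrn// -normrX ger0_norm ?sqr_ge0.
Qed.

Lemma ipC f g : ip f g = ip g f.
Proof. by apply: eq_Rintegral => x _; rewrite mulrC. Qed.

Lemma ipDl f g h : L2 f -> L2 g -> L2 h -> ip (fun x => f x + g x) h = ip f h + ip g h.
Proof.
move=> Lf Lg Lh; rewrite /ip -RintegralD//; try exact: ip_integrable.
by apply: eq_Rintegral => x _; rewrite mulrDl.
Qed.

Lemma ipZl a f h : L2 f -> L2 h -> ip (fun x => a * f x) h = a * ip f h.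
Proof.
move=> Lf Lh; rewrite /ip -RintegralZl//; last exact: ip_integrable.
by apply: eq_Rintegral => x _; rewrite mulrA.
Qed.

Lemma ipBl f g h : L2 f -> L2 g -> L2 h -> ip (fun x => f x - g x) h = ip f h - ip g h.
Proof.
move=> Lf Lg Lh; rewrite /ip -RintegralB//; try exact: ip_integrable.
by apply: eq_Rintegral => x _; rewrite mulrBl.
Qed.

Lemma ip0l h : ip (fun=> 0) h = 0.
Proof. by rewrite /ip; under eq_Rintegral do rewrite mul0r; rewrite Rintegral_cst// mul0r. Qed.

Lemma ip_suml (I : Type) (r : seq I) (f : I -> T -> R) h : (forall i, L2 (f i)) -> L2 h ->
  ip (fun x => \sum_(i <- r) f i x) h = \sum_(i <- r) ip (f i) h.
Proof.
move=> Lf Lh; elim: r => [|i r IH].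
  by rewrite big_nil -[RHS](ip0l h); congr ip; apply/funext => x; rewrite big_nil.
rewrite big_cons -IH -ipDl//; last exact: L2_sum.
by congr ip; apply/funext => x; rewrite big_cons.
Qed.

Lemma ip_ge0 f : 0 <= ip f f.
Proof. by apply: Rintegral_ge0 => x _; rewrite -expr2 sqr_ge0. Qed.

Lemma ip_EFin f : L2 f -> (\int[m]_x ((f x) ^+ 2)%:E = (ip f f)%:E)%E.
Proof.
move=> Lf; rewrite /ip /Rintegral fineK//.
exact: integrable_fin_num (ip_integrable Lf Lf).
Qed.

Lemma ip_normD a f g : L2 f -> L2 g ->
  ip (fun x => f x + a * g x) (fun x => f x + a * g x) =
  ip f f + 2 * a * ip f g + a ^+ 2 * ip g g.
Proof.
move=> Lf Lg; have Lag := L2Z a Lg; have LD := L2D Lf Lag.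
have E h : L2 h -> ip h (fun x => f x + a * g x) = ip h f + a * ip h g.
  by move=> Lh; rewrite ipC ipDl// ipZl// (ipC f) (ipC g).
by rewrite ipDl// ipZl// !E// (ipC g f); ring.
Qed.

Lemma ip_CS f g : L2 f -> L2 g -> (ip f g) ^+ 2 <= ip f f * ip g g.
Proof.
move=> Lf Lg.
have H a : 0 <= ip f f + 2 * a * ip f g + a ^+ 2 * ip g g.
  by rewrite -ip_normD//; exact: ip_ge0.
have := ip_ge0 g; rewrite le_eqVlt => /predU1P[g0|g0].
  have [->|/eqP fg0] := eqVneq (ip f g) 0; first by rewrite -g0 mulr0 expr0n.
  (* When [ip g g = 0] the quadratic in [a] is affine, and this [a] gives it the value [-1]. *)
  have := H (- (ip f f + 1) / (2 * ip f g)); rewrite -g0 mulr0 addr0.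
  rewrite (_ : 2 * _ * _ = - (ip f f + 1)); last by field; apply/eqP.
  by lra.
have := H (- ip f g / ip g g).
rewrite (_ : _ + _ = ip f f - (ip f g) ^+ 2 / ip g g); last by field; rewrite gt_eqF.
by rewrite subr_ge0 ler_pdivrMr.
Qed.

Lemma L2_norm_ip f : L2 f -> fine ('N[m]_2%:E[EFin \o f])%E = Num.sqrt (ip f f).
Proof.
move=> Lf; rewrite unlock.
transitivity (fine ((\int[m]_x ((f x) ^+ 2)%:E) `^ 2^-1)%E).
  congr (fine (_ `^ _)%E); apply: eq_integral => x _ /=.
  by rewrite powR_mulrn// -normrX ger0_norm ?sqr_ge0.
by rewrite ip_EFin// poweR_EFin /= powR12_sqrt ?ip_ge0.
Qed.

Lemma geom_cauchy (u : R^nat) (s : R) : (forall n, `|u n.+1 - u n| <= s * 2^-1 ^+ n) ->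
  exists2 l, u @ \oo --> l & forall n, `|l - u n| <= 2 * s * 2^-1 ^+ n.
Proof.
move=> us; have H n k : `|u (n + k)%N - u n| <= 2 * s * 2^-1 ^+ n - 2 * s * 2^-1 ^+ (n + k).
  elim: k => [|k IH]; first by rewrite addn0 !subrr normr0.
  have := us (n + k)%N; rewrite addnS exprS => h.
  have := ler_normD (u (n + k).+1 - u (n + k)%N) (u (n + k)%N - u n).
  by rewrite addrA subrK; lra.
have s0 : 0 <= s by have := us 0%N; rewrite expr0 mulr1; apply: le_trans.
have e0 k : 0 <= 2 * s * 2^-1 ^+ k by rewrite !mulr_ge0// exprn_ge0.
have B n k : (n <= k)%N -> `|u k - u n| <= 2 * s * 2^-1 ^+ n.
  by move=> /subnKC <-; have := H n (k - n)%N; have := e0 (n + (k - n))%N; lra.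
have cv0 : 2 * s * 2^-1 ^+ n @[n --> \oo] --> (0 : R).
  rewrite -(mulr0 (2 * s)); apply: cvgMr; apply: cvg_expr.
  by rewrite ger0_norm ?invf_lt1// ltr1n.
have cvu : cvgn u.
  apply: cauchy_cvg; apply/cauchy_exP => e e0'.
  have [N _ HN] := cvgr_lt 0 cv0 e e0'.
  exists (u N); exists N => // k /= Nk; rewrite /ball/= distrC.
  by apply: le_lt_trans (B _ _ Nk) _; exact: (HN N (leqnn N)).
exists (limn u) => // n.
have /cvg_norm cvn : (u k - u n) @[k --> \oo] --> limn u - u n.
  by apply: cvgB => //; exact: cvg_cst.
apply: (closed_cvg _ (@closed_le R (2 * s * 2^-1 ^+ n)) _ _ cvn).
by exists n => // k /= nk; exact: B.
Qed.

(** The weights [4^n] leave [G] integrable, since [4^n * 4 * 8^-n = 4 * 2^-n] sums to [8], and where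
    [G] is finite they force increments of size at most [sqrt G * 2^-n]. The resulting bound
    [|psi - phi n|^2 <= 4 * 4^-n * G] gives convergence in L2 by integration alone. *)
Lemma L2_complete_geom (phi : nat -> T -> R) : (forall n, L2 (phi n)) ->
  (forall n, ip (fun x => phi n.+1 x - phi n x) (fun x => phi n.+1 x - phi n x) <= 4 * 8^-1 ^+ n) ->
  exists2 psi, L2 psi & ip (fun x => psi x - phi n x) (fun x => psi x - phi n x) @[n --> \oo] --> (0 : R).
Proof.
move=> Lphi dphi.
have Le n : L2 (fun x => phi n.+1 x - phi n x) by exact: L2B.
have me n := L2_measurable (Le n).
pose g n x := 4 ^+ n * (phi n.+1 x - phi n x) ^+ 2.
have g0 n x : 0 <= g n x by apply: mulr_ge0; [exact: exprn_ge0|exact: sqr_ge0].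
have mg n : measurable_fun setT (EFin \o g n).
  by apply/measurable_EFinP; apply: measurable_funM => //; exact: measurable_funX.
pose G x := (\sum_(n <oo) (g n x)%:E)%E.
have G0 x : (0 <= G x)%E by apply: nneseries_ge0 => n _ _; rewrite lee_fin.
have mG : measurable_fun setT G.
  have := @ge0_emeasurable_sum _ _ _ setT (fun n x => (g n x)%:E) xpredT.
  apply; first by move=> n x _ _; rewrite lee_fin.
  by move=> n _; exact: mg.
have iG : (\int[m]_x G x <= 8%:E)%E.
  rewrite integral_nneseries//; last by move=> n x _; rewrite lee_fin.
  apply: (@le_trans _ _ (\sum_(n <oo) (4 * 2^-1 ^+ n)%:E)%E).
    apply: lee_nneseries => n _; first by move=> _; apply: integral_ge0 => x _; rewrite lee_fin.
    have -> : (\int[m]_x (g n x)%:E = (4 ^+ n)%:E * \int[m]_x ((phi n.+1 x - phi n x) ^+ 2)%:E)%E.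
      under eq_integral do rewrite /= EFinM.
      rewrite ge0_integralZl//=.
      + by apply/measurable_EFinP; exact: measurable_funX.
      + by move=> x _; rewrite lee_fin sqr_ge0.
    rewrite (ip_EFin (Le n)) -EFinM lee_fin.
    have -> : 4 * 2^-1 ^+ n = 4 ^+ n * (4 * 8^-1 ^+ n) :> R.
      have E8 : 4 * 8^-1 = 2^-1 :> R by field.
      by rewrite mulrCA -exprMn E8.
    by rewrite ler_wpM2l ?exprn_ge0.
  rewrite (_ : 8%:E = \sum_(n <oo) (4 * 2^-1 ^+ n)%:E)%E//.
  have := @cvg_geometric_eseries_half R 8 0; rewrite expr0 divr1 => /cvg_lim <-//.
  congr (limn _); apply/funext => n; apply: eq_bigr => k _; congr EFin.
  by rewrite addn1 natrX exprS exprVn; field; rewrite expf_neq0.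
pose s x := Num.sqrt (fine (G x)).
pose E := [set x | (G x < +oo)%E].
have mE : measurable E.
  by rewrite -[E]setTI; exact: emeasurable_fun_infty_o.
(* Killing the sequence off [E] makes it converge at every point, so the limit is measurable. No
   null set argument follows, because the final bound is trivial where [G] is infinite. *)
pose u n x := phi n x * \1_E x.
have us x n : `|u n.+1 x - u n x| <= s x * 2^-1 ^+ n.
  rewrite /u -mulrBl indicE; case: (boolP (x \in E)) => xE; last first.
    by rewrite mulr0 normr0 mulr_ge0 ?sqrtr_ge0// exprn_ge0.
  rewrite mulr1; have Gx : (G x < +oo)%E by move/set_mem : xE.
  have GE : (G x = (fine (G x))%:E)%E by rewrite fineK// ge0_fin_numE.
  have : g n x <= fine (G x).
    rewrite -lee_fin -GE; apply: le_trans (nneseries_lim_ge n.+1 _); last by move=> k _ _; rewrite lee_fin.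
    rewrite big_nat_recr//= leeDr// sume_ge0// => k _; by rewrite lee_fin.
  move=> gG; rewrite -sqrtr_sqr.
  have -> : s x * 2^-1 ^+ n = Num.sqrt (fine (G x) * 4^-1 ^+ n).
    rewrite sqrtrM ?fine_ge0//; congr (_ * _).
    rewrite (_ : 4^-1 ^+ n = (2^-1 ^+ n) ^+ 2 :> R) ?sqrtr_sqr ?ger0_norm ?exprn_ge0//.
    by rewrite -exprM mulnC exprM; congr (_ ^+ _); field.
  rewrite ler_wsqrtr// exprVn ler_pdivlMr ?exprn_gt0//.
  by rewrite mulrC.
have /choice[psi Hpsi] x : exists l, (fun n => u n x) @ \oo --> l /\
    forall n, `|l - u n x| <= 2 * s x * 2^-1 ^+ n.
  by have [l l1 l2] := geom_cauchy (us x); exists l.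
have mpsi : measurable_fun setT psi.
  apply: (@measurable_fun_cvg _ _ _ _ u).
  - move=> n; apply: measurable_funM; first exact: L2_measurable.
    exact: measurable_indic.
  - by move=> x _; case: (Hpsi x).
have bnd n x : (((psi x - phi n x) ^+ 2)%:E <= (4 * 4^-1 ^+ n)%:E * G x)%E.
  have [Gx|] := ltP (G x) +oo%E; last first.
    rewrite leye_eq => /eqP ->; rewrite gt0_muley ?leey// lte_fin mulr_gt0// exprn_gt0//.
  have GE : (G x = (fine (G x))%:E)%E by rewrite fineK// ge0_fin_numE.
  rewrite GE -EFinM lee_fin.
  have [_ /(_ n)] := Hpsi x; rewrite /u indicE mem_set// mulr1 => h.
  have -> : 4 * 4^-1 ^+ n * fine (G x) = (2 * s x * 2^-1 ^+ n) ^+ 2.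
    have E4 : 2^-1 ^+ 2 = 4^-1 :> R by field.
    by rewrite !exprMn sqr_sqrtr ?fine_ge0// -exprM mulnC exprM E4; ring.
  rewrite -[X in X <= _]ger0_norm ?sqr_ge0// normrX lerXn2r// nnegrE.
  by rewrite !mulr_ge0 ?sqrtr_ge0 ?exprn_ge0.
have mpp n : measurable_fun setT (fun x => psi x - phi n x).
  by apply: measurable_funB => //; exact: L2_measurable.
have ib n : (\int[m]_x ((psi x - phi n x) ^+ 2)%:E <= (32 * 4^-1 ^+ n)%:E)%E.
  apply: (@le_trans _ _ (\int[m]_x ((4 * 4^-1 ^+ n)%:E * G x)))%E.
    apply: ge0_le_integral => //=.
    - by move=> x _; rewrite lee_fin sqr_ge0.
    - by apply/measurable_EFinP; exact: measurable_funX.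
    - exact/measurable_funeM.
  rewrite ge0_integralZl//.
  rewrite (_ : 32 * 4^-1 ^+ n = (4 * 4^-1 ^+ n) * 8); last by ring.
  by rewrite [leRHS]EFinM; apply: lee_wpmul2l => //; rewrite lee_fin mulr_ge0// exprn_ge0.
have Lpp n : L2 (fun x => psi x - phi n x).
  by apply: L2_intro => //; apply: le_lt_trans (ib n) _; rewrite ltry.
exists psi.
  by apply: (L2_ext _ (L2D (Lpp 0%N) (Lphi 0%N))) => x /=; rewrite subrK.
apply: (@squeeze_cvgr _ _ _ _ (fun=> 0) (fun n => 32 * 4^-1 ^+ n)).
- by apply: nearW => n; rewrite ip_ge0/= -lee_fin -ip_EFin// ib.
- exact: cvg_cst.
- rewrite -(mulr0 32); apply: cvgMr; apply: cvg_expr.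
  by rewrite ger0_norm ?invf_lt1// ltr1n.
Qed.

(* A minimizing sequence is Cauchy by the parallelogram identity. *)
Theorem L2_min (I : Type) (k : I -> T -> R) (c : I -> R) : (forall i, L2 (k i)) ->
  (exists2 f, L2 f & forall i, c i <= ip (k i) f) ->
  exists phi, [/\ L2 phi, (forall i, c i <= ip (k i) phi),
    (forall f, L2 f -> (forall i, c i <= ip (k i) f) -> ip phi phi <= ip f f) &
    (forall f, L2 f -> (forall i, c i <= ip (k i) f) -> ip f f <= ip phi phi ->
       forall h, L2 h -> ip h f = ip h phi)].
Proof.
move=> Lk [f0 Lf0 f0c].
pose C f := L2 f /\ forall i, c i <= ip (k i) f.
pose V := [set ip f f | f in C].
have V0 : V !=set0 by exists (ip f0 f0), f0.
have Vlb : has_lbound V by exists 0 => _ [f _ <-]; exact: ip_ge0.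
pose mm := inf V.
have mle f : C f -> mm <= ip f f by move=> Cf; apply: ge_inf => //; exists f.
have mid f g : C f -> C g ->
    ip (fun x => f x - g x) (fun x => f x - g x) <= 2 * (ip f f - mm) + 2 * (ip g g - mm).
  move=> [Lf fc] [Lg gc].
  have Lh : L2 (fun x => 2^-1 * (f x + g x)) by exact/L2Z/L2D.
  have Ch : C (fun x => 2^-1 * (f x + g x)).
    split => // i; rewrite ipC ipZl ?ipDl//; last exact: L2D.
    by have := fc i; have := gc i; rewrite (ipC f) (ipC g); lra.
  have := mle _ Ch; rewrite ipZl ?(L2D Lf Lg)// ipC ipZl ?(L2D Lf Lg)//.
  have := ip_normD 1 Lf Lg; have := ip_normD (-1) Lf Lg.
  rewrite (_ : (fun x => f x + -1 * g x) = (fun x => f x - g x)); last first.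
    by apply/funext => x; rewrite mulN1r.
  rewrite (_ : (fun x => f x + 1 * g x) = (fun x => f x + g x)); last first.
    by apply/funext => x; rewrite mul1r.
  by move=> -> ->; lra.
(* By [mid], this precision makes the squared increments at most [(9/4) 8^-n], within the [4 * 8^-n]
   that completeness asks for. *)
have /choice[phi Hphi] n : exists f, C f /\ ip f f < mm + 8^-1 ^+ n.
  have e0 : 0 < 8^-1 ^+ n :> R by rewrite exprn_gt0.
  have [_ [f Cf <-] h] := inf_adherent e0 (conj V0 Vlb).
  by exists f.
have Lphi n : L2 (phi n) by case: (Hphi n) => -[].
have [|psi Lpsi psicv] := L2_complete_geom Lphi.
  move=> n; have [C1 h1] := Hphi n.+1; have [C2 h2] := Hphi n.
  have := mid _ _ C1 C2.
  have e0 : 0 < 8^-1 ^+ n :> R by rewrite exprn_gt0.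
  by move: h1; rewrite exprS; lra.
have ipcv h : L2 h -> ip h (phi n) @[n --> \oo] --> ip h psi.
  move=> Lh; apply/cvgrPdist_le => /= e e0.
  have e1 : 0 < e ^+ 2 / (ip h h + 1) by rewrite divr_gt0 ?exprn_gt0// ltr_wpDl ?ip_ge0.
  near=> n.
  have hn : ip (fun x => psi x - phi n x) (fun x => psi x - phi n x) < e ^+ 2 / (ip h h + 1).
    by near: n; exact: (cvgr_lt 0 psicv _ e1).
  have Lpp : L2 (fun x => psi x - phi n x) by exact: L2B.
  have -> : ip h psi - ip h (phi n) = ip h (fun x => psi x - phi n x).
    by rewrite [RHS]ipC ipBl// (ipC psi) (ipC (phi n)).
  rewrite -(@ler_pXn2r _ 2)// ?nnegrE ?normr_ge0 ?ltW// -normrX ger0_norm ?sqr_ge0//.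
  apply: le_lt_trans (ip_CS Lh Lpp) _.
  have h1 : 0 < ip h h + 1 by rewrite ltr_wpDl ?ip_ge0.
  move: hn; rewrite ltr_pdivlMr// => hn.
  have := ip_ge0 (fun x => psi x - phi n x); have := ip_ge0 h; nra.
have Cpsi : C psi.
  split => // i; apply: (closed_cvg _ (@closed_ge R (c i)) _ _ (ipcv _ (Lk i))).
  by apply: nearW => n /=; have [[_ H] _] := Hphi n; exact: H.
have psim : ip psi psi <= mm.
  (* Lower semicontinuity of the norm: [2 <psi, phi n> <= |psi|^2 + |phi n|^2], and the left side
     converges by [ipcv]. *)
  suff : 2 * ip psi psi - 0 <= ip psi psi + mm by lra.
  have cv : 2 * ip psi (phi n) - 8^-1 ^+ n @[n --> \oo] --> 2 * ip psi psi - 0.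
    apply: cvgB; first by apply: cvgMr; exact: ipcv.
    by apply: cvg_expr; rewrite ger0_norm ?invf_lt1// ltr1n.
  apply: (closed_cvg _ (@closed_le R (ip psi psi + mm)) _ _ cv).
  apply: nearW => n /=; have [_ h] := Hphi n.
  have := ip_ge0 (fun x => psi x + -1 * phi n x); rewrite ip_normD//; lra.
exists psi; split => //.
- by case: Cpsi.
- by move=> f Lf fc; apply: le_trans psim (mle _ _).
(* Uniqueness is that of the inner products with every [h], since representatives agree only almost
   everywhere: [mid] puts [f] at distance [0] from [psi], and Cauchy-Schwarz does the rest. *)
move=> f Lf fc fpsi h Lh.
have Cf : C f by [].
have D0 : ip (fun x => f x - psi x) (fun x => f x - psi x) <= 0.
  have := mid _ _ Cf Cpsi; have := mle _ Cf; have := mle _ Cpsi; lra.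
have Lfp : L2 (fun x => f x - psi x) by exact: L2B.
have := ip_CS Lh Lfp.
have -> : ip (fun x => f x - psi x) (fun x => f x - psi x) = 0.
  by apply/eqP; rewrite eq_le D0 ip_ge0.
rewrite mulr0 => h0; have /eqP : ip h (fun x => f x - psi x) ^+ 2 = 0.
  by apply/eqP; rewrite eq_le h0 sqr_ge0.
rewrite sqrf_eq0 => /eqP; rewrite ipC ipBl// (ipC f) (ipC psi) => /eqP.
by rewrite subr_eq0 => /eqP.
Unshelve. all: by end_near. Qed.

End L2.

(** * Laws are determined by characteristic functions *)

Section cos_indicator.
Context {R : realType}.
Implicit Types (p q w x y : R).

Lemma bernoulli_le y k : 0 <= y <= 1 -> 1 - k%:R * y <= (1 - y) ^+ k.
Proof.
move=> /andP[y0 y1]; elim: k => [|k IH]; first by rewrite mul0r subr0.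
rewrite exprS -natr1; have ky : 0 <= k%:R * y by rewrite mulr_ge0.
have : (1 - y) * (1 - k%:R * y) <= (1 - y) * (1 - y) ^+ k by rewrite ler_wpM2l//; lra.
by apply: le_trans; nra.
Qed.

(** Behind it is [1 - p^m = (1 - p)(1 + p + ... + p^(m-1))], where each of the [m] summands is at
    least [p^m]. *)
Lemma natr_expr_le p m : 0 <= p <= 1 -> m%:R * p ^+ m * (1 - p) <= 1 - p ^+ m.
Proof.
move=> /andP[p0 p1]; elim: m => [|m IH]; first by rewrite !mul0r subrr.
rewrite exprS -natr1; have pm0 : 0 <= p ^+ m by rewrite exprn_ge0.
have pm1 : p ^+ m <= 1 by rewrite exprn_ile1.
have h1 : p * (m%:R * p ^+ m * (1 - p)) <= p * (1 - p ^+ m) by rewrite ler_wpM2l.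
have h2 : 0 <= (1 - p) * (1 - p * p ^+ m).
  by rewrite mulr_ge0//; nra.
nra.
Qed.

Lemma cvg_natr_expr q : 0 <= q < 1 -> m%:R * q ^+ m @[m --> \oo] --> (0 : R).
Proof.
(* Half of the decay pays for the factor [m]: [m q^m = (m p^m) p^m], and [m p^m] is at most
   [1 / (1 - p)]. *)
move=> /andP[q0 q1]; pose p := Num.sqrt q.
have p0 : 0 <= p by exact: sqrtr_ge0.
have pp : p * p = q by rewrite -expr2 sqr_sqrtr.
have p1 : p < 1 by nra.
apply: (@squeeze_cvgr _ _ _ _ (fun=> 0) (fun m => (1 - p)^-1 * p ^+ m)).
- apply: nearW => m; rewrite mulr_ge0 ?exprn_ge0//=.
  rewrite -pp exprMn mulrA ler_wpM2r ?exprn_ge0//.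
  rewrite -[X in _ <= X]mul1r ler_pdivlMr; last by lra.
  have := @natr_expr_le p m; rewrite p0 ltW// => /(_ isT).
  by have := exprn_ge0 m p0; lra.
- exact: cvg_cst.
- by rewrite -(mulr0 (1 - p)^-1); apply: cvgMr; apply: cvg_expr; rewrite ger0_norm.
Qed.

(* As [m] grows, [m * 2 ^ m * w ^+ m] tends to [0] if [w < 1/2] and to infinity
   otherwise, so [steep w m] tends to the indicator of [1/2 <= w]. *)
Definition steep w m : R := 1 - (1 - w ^+ m) ^+ (m * 2 ^ m).

Lemma steep_bound w m : 0 <= w <= 1 -> 0 <= steep w m <= 1.
Proof.
move=> /andP[w0 w1]; rewrite /steep.
have h1 : w ^+ m <= 1 by rewrite exprn_ile1.
have h2 : 0 <= w ^+ m by rewrite exprn_ge0.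
have h3 : (1 - w ^+ m) ^+ (m * 2 ^ m) <= 1 by rewrite exprn_ile1//; lra.
have h4 : 0 <= (1 - w ^+ m) ^+ (m * 2 ^ m) by rewrite exprn_ge0//; lra.
by apply/andP; split; lra.
Qed.

(** For [w >= 1/2], [1 - x <= exp(-x)] bounds the subtracted power by
    [exp(-2^-m)^(m 2^m) = exp(-m)]. For [w < 1/2], Bernoulli's inequality bounds [steep w m] by
    [m (2 w)^m]. *)
Lemma cvg_steep w : 0 <= w <= 1 -> steep w m @[m --> \oo] --> ((2^-1 <= w)%R%:R : R).
Proof.
move=> /andP[w0 w1]; have [w2|w2] := leP 2^-1 w.
- rewrite -[X in _ --> X]subr0; apply: cvgB; first exact: cvg_cst.
  apply: (@squeeze_cvgr _ _ _ _ (fun=> 0) (fun m => expR (-1) ^+ m)).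
  + apply: nearW => m; rewrite exprn_ge0/= ?subr_ge0 ?exprn_ile1//.
    apply: (@le_trans _ _ (expR (- 2^-1 ^+ m) ^+ (m * 2 ^ m))).
      apply: lerXn2r; rewrite ?nnegrE ?expR_ge0 ?subr_ge0 ?exprn_ile1//.
      apply: le_trans (expR_ge1Dx _); rewrite lerD2l lerN2.
      by apply: lerXn2r; rewrite ?nnegrE ?invr_ge0.
    rewrite -!expRM_natl ler_expR natrM natrX exprVn.
    by rewrite mulrN -mulrA divff ?expf_neq0// mulr1 mulrN1.
  + exact: cvg_cst.
  + by apply: cvg_expr; rewrite ger0_norm ?expR_ge0// -[X in _ < X]expR0 ltr_expR oppr_lt0.
- apply: (@squeeze_cvgr _ _ _ _ (fun=> 0) (fun m => m%:R * (2 * w) ^+ m)).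
  + apply: nearW => m; have /(@steep_bound w m)/andP[-> _]/= : 0 <= w <= 1 by rewrite w0.
    rewrite /steep lerBlDr -lerBlDl exprMn mulrA.
    have := @bernoulli_le (w ^+ m) (m * 2 ^ m); rewrite natrM natrX; apply.
    by rewrite exprn_ge0// exprn_ile1.
  + exact: cvg_cst.
  + by apply: cvg_natr_expr; apply/andP; split; lra.
Qed.

Lemma cos_ge0P x : - (3 * (pi : R) / 2) < x < 3 * (pi : R) / 2 ->
  (0 <= cos x) = (- ((pi : R) / 2) <= x <= (pi : R) / 2).
Proof.
move=> /andP[x1 x2]; have p0 := pi_gt0 R.
case: (leP (- ((pi : R) / 2)) x) => /= h1; last first.
  apply/negbTE; rewrite -ltNge.
  have : 0 < cos (x + pi) by apply: cos_gt0_pihalf; apply/andP; split; lra.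
  by rewrite cosDpi; lra.
case: (leP x ((pi : R) / 2)) => /= h2.
  move: h1; rewrite le_eqVlt => /predU1P[<-|h1]; first by rewrite cosN cos_pihalf lexx.
  move: h2; rewrite le_eqVlt => /predU1P[->|h2]; first by rewrite cos_pihalf lexx.
  by rewrite ltW// cos_gt0_pihalf// h1.
apply/negbTE; rewrite -ltNge.
have : 0 < cos (x - pi) by apply: cos_gt0_pihalf; apply/andP; split; lra.
have := cosDpi (x - pi); rewrite subrK; lra.
Qed.

(** With [M = N + 1] this cosine has period [4 M] and is nonnegative on [[c - 2 M, c]], so its sign
    agrees with the half line [u <= c] on the window [|u - c| < M], and the windows exhaust the
    line. *)
Lemma cos_window c u : exists N0, forall N, (N0 <= N)%N ->
  (0 <= cos ((pi : R) / (2 * N.+1%:R) * (u - (c - N.+1%:R)))) = (u <= c).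
Proof.
exists (Num.bound (`|u - c|)) => N hN; have p0 := pi_gt0 R.
have n0 : 0 < N.+1%:R :> R by rewrite ltr0n.
have uc : `|u - c| < N.+1%:R.
  apply: (@lt_le_trans _ _ (Num.bound `|u - c|)%:R); first exact: archi_boundP.
  by rewrite ler_nat ltnW.
move: uc; rewrite ltr_norml => /andP[u1 u2].
set M := N.+1%:R in n0 u1 u2 *.
have E : (pi : R) / (2 * M) * (u - (c - M)) = (pi : R) / 2 * ((u - c) / M + 1) by field; rewrite gt_eqF.
have a1 : -1 < (u - c) / M by rewrite ltr_pdivlMr// mulN1r.
have a2 : (u - c) / M < 1 by rewrite ltr_pdivrMr// mul1r.
rewrite E.
have -> : (u <= c) = ((u - c) / M <= 0) by rewrite ler_pdivrMr// mul0r subr_le0.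
move: ((u - c) / M) a1 a2 => y a1 a2.
have h1 : 0 < (pi : R) * (y + 1) by rewrite mulr_gt0//; lra.
have h2 : 0 < (pi : R) * (1 - y) by rewrite mulr_gt0//; lra.
rewrite cos_ge0P; last by apply/andP; split; lra.
apply/andP/idP => [[_ h]|h].
  by rewrite -(@pmulr_rle0 _ (pi : R))//; lra.
have : (pi : R) * y <= 0 by rewrite pmulr_rle0.
by split; lra.
Qed.

End cos_indicator.

(** * From characteristic functions to cylinder probabilities *)

Section cramer_wold.
Context {R : realType} {d1 d2 : measure_display}.
Context {T1 : measurableType d1} {T2 : measurableType d2}.
Context {P1 : probability T1 R} {P2 : probability T2 R}.
Context {n : nat} {U : 'I_n -> T1 -> R} {V : 'I_n -> T2 -> R}.

Definition lin d (T : measurableType d) (X : 'I_n -> T -> R) (a : 'I_n -> R) (w : T) : R :=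
  \sum_(i < n) a i * X i w.

(* [F] and [G] play the role of one and the same bounded function of [U] and
   of [V]. *)
Definition matched (F : T1 -> R) (G : T2 -> R) : Prop :=
  [/\ measurable_fun setT F, measurable_fun setT G,
      exists C, (forall w, `|F w| <= C) /\ (forall w, `|G w| <= C)
    & forall a phi, (\int[P1]_w (F w * cos (lin U a w + phi)) =
                     \int[P2]_w (G w * cos (lin V a w + phi)))].

(* Multipliers are closed under sums, products and bounded limits; cosines are
   multipliers, and half-line indicators are limits of polynomials in them. *)
Definition multiplier (h : R -> R) : Prop := forall i F G, matched F G ->
  matched (fun w => F w * h (U i w)) (fun w => G w * h (V i w)).

Lemma bounded_integrable d (T : measurableType d) (P : probability T R) (F : T -> R) C :
  measurable_fun setT F -> (forall w, `|F w| <= C) -> P.-integrable setT (EFin \o F).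
Proof.
move=> mF FC; apply: measurable_bounded_integrable => //.
  by apply: (@le_lt_trans _ _ 1%E); [exact: probability_le1|exact: ltry].
by exists C; split; [exact: num_real|move=> x Cx w _; exact: le_trans (FC w) (ltW Cx)].
Qed.

Lemma measurable_lin d (T : measurableType d) (X : 'I_n -> T -> R) a :
  (forall i, measurable_fun setT (X i)) -> measurable_fun setT (lin X a).
Proof.
move=> mX; apply: measurable_sum => i.
by apply: measurable_funM => //; exact: measurable_cst.
Qed.

Lemma measurable_cosM d (T : measurableType d) (F g : T -> R) :
  measurable_fun setT F -> measurable_fun setT g -> measurable_fun setT (fun w => F w * cos (g w)).
Proof.
move=> mF mg; apply: measurable_funM => //; apply: measurableT_comp => //.
by apply: continuous_measurable_fun; exact: continuous_cos.
Qed.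

Lemma cosM_bound (x y C : R) : `|x| <= C -> `|x * cos y| <= C.
Proof.
move=> xC; rewrite normrM; apply: le_trans xC.
by rewrite ler_piMr// cos_max.
Qed.

Section closure.
Context (mU : forall i, measurable_fun setT (U i)) (mV : forall i, measurable_fun setT (V i)).

Let intU (F : T1 -> R) (C : R) a phi : measurable_fun setT F -> (forall w, `|F w| <= C) ->
  P1.-integrable setT (EFin \o (fun w => F w * cos (lin U a w + phi))).
Proof.
move=> mF FC; apply: (@bounded_integrable _ _ _ _ C); last by move=> w; exact: cosM_bound.
by apply: measurable_cosM => //; apply: measurable_funD; [exact: measurable_lin|exact: measurable_cst].
Qed.

Let intV (F : T2 -> R) (C : R) a phi : measurable_fun setT F -> (forall w, `|F w| <= C) ->
  P2.-integrable setT (EFin \o (fun w => F w * cos (lin V a w + phi))).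
Proof.
move=> mF FC; apply: (@bounded_integrable _ _ _ _ C); last by move=> w; exact: cosM_bound.
by apply: measurable_cosM => //; apply: measurable_funD; [exact: measurable_lin|exact: measurable_cst].
Qed.

Lemma matchedD F G F' G' : matched F G -> matched F' G' ->
  matched (fun w => F w + F' w) (fun w => G w + G' w).
Proof.
move=> [mF mG [C [FC GC]] E] [mF' mG' [C' [FC' GC']] E']; split.
- exact: measurable_funD.
- exact: measurable_funD.
- by exists (C + C'); split=> w; apply: le_trans (ler_normD _ _) _; exact: lerD.
move=> a phi.
under eq_Rintegral do rewrite mulrDl.
under [RHS]eq_Rintegral do rewrite mulrDl.
rewrite RintegralD//; [|exact: intU FC|exact: intU FC'].
by rewrite RintegralD ?E ?E'//; [exact: intV GC|exact: intV GC'].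
Qed.

Lemma matchedZ k F G : matched F G -> matched (fun w => k * F w) (fun w => k * G w).
Proof.
move=> [mF mG [C [FC GC]] E]; split.
- by apply: measurable_funM => //; exact: measurable_cst.
- by apply: measurable_funM => //; exact: measurable_cst.
- by exists (`|k| * C); split=> w; rewrite normrM ler_wpM2l.
move=> a phi.
under eq_Rintegral do rewrite -mulrA.
under [RHS]eq_Rintegral do rewrite -mulrA.
by rewrite RintegralZl ?RintegralZl ?E//; [exact: intV GC|exact: intU FC].
Qed.

Lemma matched_ext F G F' G' : F =1 F' -> G =1 G' -> matched F G -> matched F' G'.
Proof. by move=> /funext -> /funext ->. Qed.

Lemma matched_lim (F : nat -> T1 -> R) (G : nat -> T2 -> R) (F' : T1 -> R) (G' : T2 -> R) (C : R) :
  (forall k, matched (F k) (G k)) ->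
  (forall k w, `|F k w| <= C) -> (forall k w, `|G k w| <= C) ->
  (forall w, F k w @[k --> \oo] --> F' w) -> (forall w, G k w @[k --> \oo] --> G' w) ->
  matched F' G'.
Proof.
move=> M FC GC cvF cvG.
have mF k : measurable_fun setT (F k) by case: (M k).
have mG k : measurable_fun setT (G k) by case: (M k).
have FC' w : `|F' w| <= C.
  have /cvg_norm h := cvF w.
  by apply: (closed_cvg _ (@closed_le R C) _ _ h); apply: nearW => k; exact: FC.
have GC' w : `|G' w| <= C.
  have /cvg_norm h := cvG w.
  by apply: (closed_cvg _ (@closed_le R C) _ _ h); apply: nearW => k; exact: GC.
have mF' : measurable_fun setT F' by apply: (@measurable_fun_cvg _ _ _ _ F) => // w _; exact: cvF.
have mG' : measurable_fun setT G' by apply: (@measurable_fun_cvg _ _ _ _ G) => // w _; exact: cvG.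
split => //; first by exists C.
move=> a phi.
have cv d (T : measurableType d) (P : probability T R) (X : 'I_n -> T -> R) (F0 : nat -> T -> R) (F1 : T -> R) :
    (forall i, measurable_fun setT (X i)) -> (forall k, measurable_fun setT (F0 k)) ->
    measurable_fun setT F1 ->
    (forall k w, `|F0 k w| <= C) -> (forall w, F0 k w @[k --> \oo] --> F1 w) ->
    (\int[P]_w (F0 k w * cos (lin X a w + phi)) @[k --> \oo] --> \int[P]_w (F1 w * cos (lin X a w + phi))).
  move=> mX mF0 mF1 F0C cvF0.
  have mg : measurable_fun setT (fun w => lin X a w + phi).
    by apply: measurable_funD; [exact: measurable_lin|exact: measurable_cst].
  apply: fine_cvg; rewrite fineK; last first.
    apply: integrable_fin_num => //.
    apply: (@bounded_integrable _ _ _ _ C); first exact: measurable_cosM.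
    move=> w; apply: cosM_bound; have /cvg_norm h := cvF0 w.
    by apply: (closed_cvg _ (@closed_le R C) _ _ h); apply: nearW => k; exact: F0C.
  have [] := @dominated_convergence _ _ _ P setT measurableT
    (fun k w => (F0 k w * cos (lin X a w + phi))%:E) (fun w => (F1 w * cos (lin X a w + phi))%:E)
    (cst C%:E) => //.
  - by move=> k; apply/measurable_EFinP; exact: measurable_cosM.
  - by apply/measurable_EFinP; exact: measurable_cosM.
  - apply: aeW => w _; apply: cvg_EFin; first exact: nearW.
    by apply: cvgM; [exact: cvF0|exact: cvg_cst].
  - exact: finite_measure_integrable_cst.
  - by apply: aeW => w k _ /=; rewrite lee_fin; exact: cosM_bound.
have c1 := cv _ _ P1 U F F' mU mF mF' FC cvF.
have c2 := cv _ _ P2 V G G' mV mG mG' GC cvG.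
apply: (cvg_unique _ c1) => //; apply: cvg_trans c2; apply: near_eq_cvg.
by apply: nearW => k /=; case: (M k) => _ _ _ ->.
Qed.

Lemma multiplier_ext h h' : h =1 h' -> multiplier h -> multiplier h'.
Proof. by move=> /funext ->. Qed.

Lemma multiplier_cst k : multiplier (fun=> k).
Proof. by move=> i F G M; apply: (matched_ext _ _ (matchedZ k M)) => w; rewrite mulrC. Qed.

Lemma multiplierD h h' : multiplier h -> multiplier h' -> multiplier (fun u => h u + h' u).
Proof.
move=> Mh Mh' i F G M.
by apply: (matched_ext _ _ (matchedD (Mh i _ _ M) (Mh' i _ _ M))) => w; rewrite mulrDr.
Qed.

Lemma multiplierM h h' : multiplier h -> multiplier h' -> multiplier (fun u => h u * h' u).
Proof.
move=> Mh Mh' i F G M.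
by apply: (matched_ext _ _ (Mh' i _ _ (Mh i _ _ M))) => w; rewrite mulrA.
Qed.

Lemma multiplierX h k : multiplier h -> multiplier (fun u => h u ^+ k).
Proof.
move=> Mh; elim: k => [|k IH].
  by apply: (multiplier_ext _ (multiplier_cst 1)) => u; rewrite expr0.
by apply: (multiplier_ext _ (multiplierM Mh IH)) => u; rewrite exprS.
Qed.

Lemma multiplier_lim (h : nat -> R -> R) h' C : (forall k, multiplier (h k)) ->
  (forall k u, `|h k u| <= C) -> (forall u, h k u @[k --> \oo] --> h' u) -> multiplier h'.
Proof.
move=> Mh hC cvh i F G M; have [_ _ [C' [FC GC]] _] := M.
apply: (@matched_lim (fun k w => F w * h k (U i w)) (fun k w => G w * h k (V i w)) _ _ (C' * C)).
- by move=> k; exact: Mh.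
- by move=> k w; rewrite normrM ler_pM.
- by move=> k w; rewrite normrM ler_pM.
- by move=> w; apply: cvgMr; exact: cvh.
- by move=> w; apply: cvgMr; exact: cvh.
Qed.

Lemma lin_shift d (T : measurableType d) (X : 'I_n -> T -> R) a i t w :
  lin X (fun j => a j + (j == i)%:R * t) w = lin X a w + t * X i w.
Proof.
rewrite /lin; under eq_bigr do rewrite mulrDl.
rewrite big_split/=; congr (_ + _); rewrite (bigD1 i)//= eqxx mul1r big1 ?addr0//.
by move=> j /negbTE ->; rewrite !mul0r.
Qed.

(** The product of two cosines is half the sum of the cosines of [A + B] and [A - B], whose
    arguments are again linear combinations plus a phase. This is why [matched] quantifies over all
    [a] and [phi]. *)
Lemma multiplier_cos t b : multiplier (fun u => cos (t * u + b)).
Proof.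
move=> i F G [mF mG [C [FC GC]] E].
have mc d (T : measurableType d) (X : 'I_n -> T -> R) (F0 : T -> R) : (forall i, measurable_fun setT (X i)) ->
  measurable_fun setT F0 -> measurable_fun setT (fun w => F0 w * cos (t * X i w + b)).
  move=> mX mF0; apply: measurable_cosM => //; apply: measurable_funD => //.
  by apply: measurable_funM.
split.
- exact: mc.
- exact: mc.
- by exists C; split=> w; exact: cosM_bound.
move=> a phi.
have S d (T : measurableType d) (P : probability T R) (X : 'I_n -> T -> R) (F0 : T -> R) :
    (forall i, measurable_fun setT (X i)) -> measurable_fun setT F0 -> (forall w, `|F0 w| <= C) ->
    \int[P]_w (F0 w * cos (t * X i w + b) * cos (lin X a w + phi)) =
    2^-1 * (\int[P]_w (F0 w * cos (lin X (fun j => a j + (j == i)%:R * t) w + (phi + b))) +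
            \int[P]_w (F0 w * cos (lin X (fun j => a j + (j == i)%:R * (- t)) w + (phi - b)))).
  move=> mX mF0 F0C.
  have II a' phi' : P.-integrable setT (EFin \o (fun w => F0 w * cos (lin X a' w + phi'))).
    apply: (@bounded_integrable _ _ _ _ C); last by move=> w; exact: cosM_bound.
    by apply: measurable_cosM => //; apply: measurable_funD; [exact: measurable_lin|exact: measurable_cst].
  rewrite -RintegralD// -RintegralZl//.
    apply: eq_Rintegral => w _; rewrite !lin_shift.
    rewrite (_ : _ + t * X i w + (phi + b) = (lin X a w + phi) + (t * X i w + b)); last by ring.
    rewrite (_ : _ + - t * X i w + (phi - b) = (lin X a w + phi) - (t * X i w + b)); last by ring.
    by move: (lin X a w + phi) (t * X i w + b) => A B; rewrite cosB cosD; field.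
  have := integrableD measurableT (II (fun j => a j + (j == i)%:R * t) (phi + b))
                                 (II (fun j => a j + (j == i)%:R * (- t)) (phi - b)).
  by apply: eq_integrable => //.
by rewrite S// S// !E.
Qed.

Lemma multiplier_le c : multiplier (fun u => (u <= c)%R%:R).
Proof.
have Mge t b : multiplier (fun u => (0 <= cos (t * u + b))%R%:R).
  (* This moves the sign change of the cosine to the threshold [1/2] of [steep], with values in
     [[0, 1]]. *)
  pose w u := 2^-1 * (1 + cos (t * u + b)) : R.
  have w01 u : 0 <= w u <= 1.
    by have := cos_geN1 (t * u + b); have := cos_le1 (t * u + b); rewrite /w => h1 h2; apply/andP; split; lra.
  have Mw : multiplier w.
    apply: multiplierM; first exact: multiplier_cst.
    by apply: multiplierD; [exact: multiplier_cst|exact: multiplier_cos].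
  apply: (@multiplier_lim (fun m u => steep (w u) m) _ 1).
  - move=> m; have N h : multiplier h -> multiplier (fun u => 1 - h u).
      move=> Mh; have := multiplierD (multiplier_cst 1) (multiplierM (multiplier_cst (-1)) Mh).
      by apply: multiplier_ext => u; rewrite mulN1r.
    by apply/N/multiplierX/N/multiplierX.
  - by move=> m u; have /andP[h1 h2] := steep_bound m (w01 u); rewrite ger0_norm.
  - move=> u; have := cvg_steep (w01 u).
    by rewrite (_ : (2^-1 <= w u) = (0 <= cos (t * u + b)))//; rewrite /w; apply/idP/idP; lra.
pose t N := (pi : R) / (2 * N.+1%:R).
apply: (@multiplier_lim (fun N u => (0 <= cos (t N * (u - (c - N.+1%:R))))%R%:R) _ 1).
- move=> N; apply: (multiplier_ext _ (Mge (t N) (- (t N * (c - N.+1%:R))))) => u.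
  by rewrite -mulrBr.
- by move=> N u; case: (0 <= cos _); rewrite ?normr1 ?normr0.
- move=> u; have [N0 HN] := cos_window c u.
  apply: cvg_near_cst; exists N0 => // N /= N0N.
  by rewrite /t HN.
Qed.

(** The hypothesis says that the constant [1] is matched with itself. Multiplying by one half-line
    indicator per coordinate keeps this true, and the combination [0] with phase [0] reads off the
    probabilities, as [cos 0 = 1]. *)
Theorem cramer_wold (c : 'I_n -> R) :
  (forall a phi, \int[P1]_w cos (lin U a w + phi) = \int[P2]_w cos (lin V a w + phi)) ->
  P1 [set w | forall i, U i w <= c i] = P2 [set w | forall i, V i w <= c i].
Proof.
move=> E.
have M0 : matched (fun=> 1) (fun=> 1).
  split; [exact: measurable_cst|exact: measurable_cst|by exists 1; split=> w; rewrite normr1|].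
  move=> a phi; have := E a phi.
  by under eq_Rintegral do rewrite -[cos _]mul1r; under [RHS]eq_Rintegral do rewrite -[cos _]mul1r.
have M (s : seq 'I_n) : matched (fun w => (all (fun i => U i w <= c i) s)%:R) (fun w => (all (fun i => V i w <= c i) s)%:R).
  elim: s => [|i s IH] //=.
  by apply: (matched_ext _ _ (@multiplier_le (c i) i _ _ IH)) => w; rewrite mulrC -natrM mulnb.
have [mF mG _ /(_ (fun=> 0) 0)] := M (enum 'I_n).
have L d (T : measurableType d) (P : probability T R) (X : 'I_n -> T -> R) :
    measurable_fun setT (fun w => (all (fun i => X i w <= c i) (enum 'I_n))%:R : R) ->
    (\int[P]_w ((all (fun i => X i w <= c i) (enum 'I_n))%:R * cos (lin X (fun=> 0) w + 0)))%:E =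
    P [set w | forall i, X i w <= c i].
  move=> mX; set A := [set w | _].
  have AE w : (all (fun i => X i w <= c i) (enum 'I_n))%:R = \1_A w :> R.
    rewrite indicE; congr (_%:R); congr nat_of_bool; apply/allP/idP => [h|/set_mem h].
      by apply/mem_set => i; apply: h; rewrite mem_enum.
    by move=> i _; exact: h.
  have mA : measurable A.
    have := mX measurableT [set 1] (measurable_set1 _); rewrite setTI.
    congr measurable; apply/seteqP; split => w /=; rewrite AE indicE.
      by case: (boolP (w \in A)) => [/set_mem//|_ /eqP]; rewrite eq_sym oner_eq0.
    by move=> /mem_set ->.
  transitivity ((\int[P]_w \1_A w)%:E).
    congr EFin; apply: eq_Rintegral => w _; rewrite AE.
    by rewrite /lin big1 ?addr0 ?cos0 ?mulr1// => i _; rewrite mul0r.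
  rewrite /Rintegral integral_indic// setIT fineK//.
  by rewrite fin_num_measure.
by move=> h; rewrite -(L _ _ P1 U)// -(L _ _ P2 V)// h.
Qed.

End closure.
End cramer_wold.

(** * Gaussian laws *)

Section normal_facts.
Context {R : realType}.
Notation mu := (@lebesgue_measure R).
Implicit Types (m s x th : R) (F f g : R -> R).

Lemma cvg_const_harmonic (C : R) : C / n.+1%:R @[n --> \oo] --> (0 : R).
Proof. by rewrite -(mulr0 C); apply: cvgMr; exact: cvg_harmonic. Qed.

(** Integration by parts for Gaussian integrals, stated for the total derivative: the fundamental
    theorem on symmetric intervals around [m], with boundary terms of order [1/n], and dominated
    convergence by [|f|]. *)
Lemma integral_deriv0 m C F f : (forall x, is_derive x 1 F (f x)) -> continuous f ->
  mu.-integrable setT (EFin \o f) ->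
  (forall n : nat, `|F (m + n.+1%:R)| <= C / n.+1%:R /\ `|F (m - n.+1%:R)| <= C / n.+1%:R) ->
  \int[mu]_x f x = 0.
Proof.
move=> dF cf intf FC.
pose I (n : nat) := `[m - n.+1%:R, m + n.+1%:R]%classic.
have E n : (\int[mu]_(x in I n) (f x)%:E = (F (m + n.+1%:R) - F (m - n.+1%:R))%:E)%E.
  have n0 : 0 < n.+1%:R :> R by rewrite ltr0n.
  have ab : m - n.+1%:R < m + n.+1%:R by lra.
  rewrite (continuous_FTC2 ab (F := F))//.
  - by apply: continuous_subspaceT; exact: cf.
  - split.
    + by move=> x _; case: (dF x).
    + by apply: cvg_at_right_filter; exact: is_derive_continuous (dF _).
    + by apply: cvg_at_left_filter; exact: is_derive_continuous (dF _).
  - by move=> x _; rewrite derive1E; case: (dF x).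
have mf : measurable_fun setT f by exact: continuous_measurable_fun.
have cv : (\int[mu]_x ((f \_ (I n)) x)%:E)%E @[n --> \oo] --> (\int[mu]_x (f x)%:E)%E.
  have [] := @dominated_convergence _ _ _ mu setT measurableT
    (fun n x => ((f \_ (I n)) x)%:E) (fun x => (f x)%:E) (fun x => (`|f x|)%:E) => //.
  - move=> n; apply/measurable_EFinP; apply/(measurable_restrictT f); last exact: measurable_funTS.
    exact: measurable_itv.
  - exact/measurable_EFinP.
  - apply: aeW => x _; apply: cvg_near_cst.
    exists (Num.bound `|x - m|) => // n /= hn.
    rewrite patchE mem_set//= /I /= in_itv/=.
    have : `|x - m| < n.+1%:R.
      apply: (@lt_le_trans _ _ (Num.bound `|x - m|)%:R); first exact: archi_boundP.
      by rewrite ler_nat ltnW.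
    by rewrite ltr_norml => /andP[? ?]; apply/andP; split; lra.
  - exact: integrable_abse intf.
  - apply: aeW => x n _; rewrite patchE /=; case: ifPn => _; first by [].
    by rewrite normr0 lee_fin.
have cv0 : (F (m + n.+1%:R) - F (m - n.+1%:R)) @[n --> \oo] --> (0 : R).
  rewrite -[X in _ --> X]subr0; apply: cvgB.
  - apply/norm_cvg0P; apply: (@squeeze_cvgr _ _ _ _ (fun=> 0) (fun n => C / n.+1%:R)).
    + by apply: nearW => n /=; rewrite normr_ge0; case: (FC n).
    + exact: cvg_cst.
    + exact: cvg_const_harmonic.
  - apply/norm_cvg0P; apply: (@squeeze_cvgr _ _ _ _ (fun=> 0) (fun n => C / n.+1%:R)).
    + by apply: nearW => n /=; rewrite normr_ge0; case: (FC n).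
    + exact: cvg_cst.
    + exact: cvg_const_harmonic.
have cvE : (\int[mu]_(x in setT) ((f \_ (I n)) x)%:E)%E @[n --> \oo] --> 0%E.
  rewrite (_ : (fun n => _) = (fun n => (F (m + n.+1%:R) - F (m - n.+1%:R))%:E)).
    by apply: cvg_EFin; [exact: nearW|exact: cv0].
  apply/funext => n; rewrite -E [RHS]integral_mkcond.
  by apply: eq_integral => x _; rewrite restrict_EFin.
by rewrite /Rintegral (cvg_unique _ cv cvE).
Qed.

Section density.
Context {m s : R} {s0 : s != 0}.
Let p := normal_pdf m s.
Let q := normal_pdf m (2 * s).
Let s2 : 0 < s ^+ 2. Proof. by rewrite exprn_even_gt0. Qed.
Let ss0 : 2 * s != 0. Proof. by rewrite mulf_neq0. Qed.
Let K := normal_peak s * (1 + 8 * s ^+ 2) / normal_peak (2 * s).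

Let K0 : 0 <= K.
Proof.
apply: mulr_ge0; last by rewrite invr_ge0 normal_peak_ge0.
by apply: mulr_ge0; [exact: normal_peak_ge0|rewrite addr_ge0// mulr_ge0// sqr_ge0].
Qed.

(** With [z = (x - m)^2 / (8 s^2)] the two exponentials are [exp(-4 z)] and [exp(-z)], and both
    [exp(-3 z)] and [z exp(-3 z)] are at most [1]. Doubling the deviation thus absorbs any quadratic
    factor. *)
Lemma normal_dom x : (1 + (x - m) ^+ 2) * p x <= K * q x.
Proof.
rewrite /p /q !normal_pdfE// /K mulrA divfK ?gt_eqF ?normal_peak_gt0//.
rewrite mulrCA -mulrA ler_wpM2l ?normal_peak_ge0// /normal_fun.
set z := (x - m) ^+ 2 / (8 * s ^+ 2).
have z0 : 0 <= z by rewrite divr_ge0 ?sqr_ge0// mulr_ge0// sqr_ge0.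
have -> : - (x - m) ^+ 2 / (s ^+ 2 *+ 2) = - z + (- z + (- z + - z)).
  by rewrite /z -mulr_natl; field; rewrite s0.
have -> : - (x - m) ^+ 2 / ((2 * s) ^+ 2 *+ 2) = - z.
  by rewrite /z -mulr_natl; field; rewrite s0.
have -> : (x - m) ^+ 2 = 8 * s ^+ 2 * z by rewrite /z; field; rewrite s0.
rewrite !expRD.
have e1 : expR (- z) <= 1 by rewrite expR_le1; lra.
have e0 : 0 < expR (- z) := expR_gt0 _.
have ze : z * expR (- z) <= 1.
  rewrite -ler_pdivlMr// mul1r -expRN opprK.
  by apply: le_trans (expR_ge1Dx z); lra.
have e3 : expR (- z) * (expR (- z) * expR (- z)) <= 1 by nra.
have e2 : expR (- z) * expR (- z) <= 1 by nra.
have h1 : z * expR (- z) * (expR (- z) * expR (- z)) <= 1.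
  by have h := mulr_ge0 z0 (ltW e0); nra.
rewrite [leLHS](_ : _ = (expR (- z) * (expR (- z) * expR (- z)) +
  8 * s ^+ 2 * (z * expR (- z) * (expR (- z) * expR (- z)))) * expR (- z)); last by ring.
rewrite ler_wpM2r ?(ltW e0)//; apply: lerD => //.
by rewrite ler_piMr// mulr_ge0// sqr_ge0.
Qed.

Lemma normal_integrable g (C : R) : measurable_fun setT g ->
  (forall x, `|g x| <= C * (1 + (x - m) ^+ 2)) ->
  mu.-integrable setT (EFin \o (fun x => g x * p x)).
Proof.
move=> mg gC; apply: (@le_integrable _ _ _ mu setT measurableT _ (EFin \o (fun x => C * K * q x))).
- apply/measurable_EFinP; apply: measurable_funM => //; exact: measurable_normal_pdf.
- move=> x _ /=; rewrite lee_fin.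
  have p0 : 0 <= p x := normal_pdf_ge0 _ _ _.
  have q0 : 0 <= q x := normal_pdf_ge0 _ _ _.
  have C0 : 0 <= C.
    have := le_trans (normr_ge0 _) (gC x); rewrite pmulr_lge0//.
    by rewrite ltr_pwDl// sqr_ge0.
  rewrite [leRHS]ger0_norm; last first.
    by apply: mulr_ge0; [exact: mulr_ge0|exact: q0].
  rewrite normrM (ger0_norm p0) -mulrA; apply: (@le_trans _ _ (C * ((1 + (x - m) ^+ 2) * p x))).
    by rewrite mulrA ler_wpM2r.
  by rewrite ler_wpM2l// normal_dom.
- have := integrableZl measurableT (C * K) (@integrable_normal_pdf R m (2 * s)).
  by apply: eq_integrable => // x _ /=; rewrite EFinM.
Qed.

Lemma normal_decay g (C : R) : (forall x, `|g x| <= C * (1 + (x - m) ^+ 2)) ->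
  exists C', forall n : nat, `|(g (m + n.+1%:R)) * p (m + n.+1%:R)| <= C' / n.+1%:R /\
    `|g (m - n.+1%:R) * p (m - n.+1%:R)| <= C' / n.+1%:R.
Proof.
move=> gC; exists (C * K * normal_peak (2 * s) * (8 * s ^+ 2)) => n.
have C0 : 0 <= C.
  have := le_trans (normr_ge0 _) (gC m); rewrite pmulr_lge0//.
  by rewrite ltr_pwDl// sqr_ge0.
have H x : (x - m) ^+ 2 = n.+1%:R ^+ 2 -> `|g x * p x| <= C * K * normal_peak (2 * s) * (8 * s ^+ 2) / n.+1%:R.
  move=> xm; have p0 : 0 <= p x := normal_pdf_ge0 _ _ _.
  rewrite normrM (ger0_norm p0); apply: (@le_trans _ _ (C * ((1 + (x - m) ^+ 2) * p x))).
    by rewrite mulrA ler_wpM2r.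
  apply: (@le_trans _ _ (C * (K * q x))); first by rewrite ler_wpM2l// normal_dom.
  rewrite /q normal_pdfE// -!(mulrA C) ler_wpM2l// -!(mulrA K) ler_wpM2l//.
  rewrite -!(mulrA (normal_peak _)) ler_wpM2l ?normal_peak_ge0//.
  rewrite /normal_fun xm.
  have n0 : 0 < n.+1%:R :> R by rewrite ltr0n.
  have n1 : 1 <= n.+1%:R :> R by rewrite ler1n.
  have -> : - n.+1%:R ^+ 2 / ((2 * s) ^+ 2 *+ 2) = - (n.+1%:R ^+ 2 / (8 * s ^+ 2)).
    by rewrite -mulr_natl; field; rewrite s0.
  have e0 : 0 < 8 * s ^+ 2 / n.+1%:R by rewrite divr_gt0// mulr_gt0.
  rewrite expRN -[leRHS]invrK lef_pV2 ?posrE ?expR_gt0 ?invr_gt0//.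
  apply: le_trans (expR_ge1Dx _).
  apply: (@le_trans _ _ (n.+1%:R ^+ 2 / (8 * s ^+ 2))); last by rewrite lerDr.
  rewrite invf_div; apply: ler_wpM2r; first by rewrite invr_ge0 mulr_ge0// sqr_ge0.
  by rewrite expr2 ler_peMl// (ltW n0).
by split; apply: H; [rewrite addrAC subrr add0r|rewrite addrAC subrr sub0r sqrrN].
Qed.

Lemma is_derive_normal x : is_derive x 1 p (- ((x - m) / s ^+ 2) * p x).
Proof.
rewrite /p normal_pdfE// /normal_fun.
apply: is_derive_eq; rewrite /GRing.scale/= -mulr_natl.
by field; rewrite s0.
Qed.

Lemma continuous_normal : continuous p. Proof. exact: continuous_normal_pdf. Qed.

Lemma sqr_dom1 x : `|x - m| <= 1 * (1 + (x - m) ^+ 2).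
Proof.
rewrite mul1r -[(x - m) ^+ 2]real_normK ?num_real//; set y := `|x - m|; nra.
Qed.

Lemma continuous_subm : continuous (fun x => x - m).
Proof. by move=> x; apply: cvgB; [exact: cvg_id|exact: cvg_cst]. Qed.

Lemma normal_mean : \int[mu]_x ((x - m) * p x) = 0.
Proof.
pose F x := - s ^+ 2 * p x.
have [C HC] : exists C, forall n : nat, `|F (m + n.+1%:R)| <= C / n.+1%:R /\ `|F (m - n.+1%:R)| <= C / n.+1%:R.
  apply: (@normal_decay (fun=> - s ^+ 2) (s ^+ 2)) => x.
  by rewrite normrN ger0_norm ?sqr_ge0// ler_peMr ?sqr_ge0// lerDl; exact: sqr_ge0.
apply: (@integral_deriv0 m C F _ _ _ _ HC).
- move=> x; have h := is_derive_normal x; rewrite /F; apply: is_derive_eq.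
  by rewrite /GRing.scale/=; field; rewrite s0.
- by move=> x; apply: cvgM; [exact: continuous_subm|exact: continuous_normal].
- by apply: (@normal_integrable (fun x => x - m) 1 _ sqr_dom1); exact: measurable_funB.
Qed.

Lemma normal_var : \int[mu]_x ((x - m) ^+ 2 * p x) = s ^+ 2.
Proof.
have i1 : mu.-integrable setT (EFin \o (fun x => (x - m) ^+ 2 * p x)).
  apply: (@normal_integrable (fun x => (x - m) ^+ 2) 1).
    by apply: measurable_funX; exact: measurable_funB.
  by move=> x; rewrite mul1r ger0_norm ?sqr_ge0// lerDr.
have i2 : mu.-integrable setT (EFin \o (fun x => s ^+ 2 * p x)).
  apply: (@normal_integrable (fun x => s ^+ 2) (s ^+ 2)); first exact: measurable_cst.
  by move=> x; rewrite ger0_norm ?sqr_ge0// ler_peMr ?sqr_ge0// lerDl sqr_ge0.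
(* Its derivative is [((x - m)^2 - s^2) p x]. *)
pose F x := - s ^+ 2 * (x - m) * p x.
have [C HC] : exists C, forall n : nat, `|F (m + n.+1%:R)| <= C / n.+1%:R /\ `|F (m - n.+1%:R)| <= C / n.+1%:R.
  apply: (@normal_decay (fun x => - s ^+ 2 * (x - m)) (s ^+ 2)) => x.
  rewrite normrM normrN (ger0_norm (sqr_ge0 s)); apply: ler_wpM2l; first exact: sqr_ge0.
  by have := sqr_dom1 x; rewrite mul1r.
have : \int[mu]_x ((x - m) ^+ 2 * p x - s ^+ 2 * p x) = 0.
  apply: (@integral_deriv0 m C F _ _ _ _ HC).
  - move=> x; have h := is_derive_normal x; rewrite /F; apply: is_derive_eq.
    by rewrite /GRing.scale/=; field; rewrite s0.
  - move=> x; apply: cvgB.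
      apply: cvgM; last exact: continuous_normal.
      rewrite (_ : (fun x => (x - m) ^+ 2) = (fun x => (x - m) * (x - m))).
        by apply: cvgM; exact: continuous_subm.
      by apply/funext => y; rewrite expr2.
    by apply: cvgMr; exact: continuous_normal.
  - by have := integrableB measurableT i1 i2; apply: eq_integrable.
rewrite RintegralB// => /eqP; rewrite subr_eq0 => /eqP ->.
have -> : \int[mu]_x (s ^+ 2 * p x) = s ^+ 2 * \int[mu]_x p x.
  by rewrite RintegralZl//; exact: integrable_normal_pdf.
by rewrite /Rintegral integral_normal_pdf mulr1.
Qed.

End density.
End normal_facts.

(** * Characteristic function of a normal law *)

Section normal_char.
Context {R : realType}.
Notation mu := (@lebesgue_measure R).

(** As a function [I] of the frequency, the integral satisfies [I' = - s^2 t I]: differentiate under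
    the integral, then integrate by parts. Hence [I(t) exp(s^2 t^2 / 2)] is constant, equal to its
    value at [t = 0]. *)
Lemma normal_char (m s phi th : R) : s != 0 ->
  \int[mu]_x (cos (th * (x - m) + phi) * normal_pdf m s x) = cos phi * expR (- (s ^+ 2 * th ^+ 2 / 2)).
Proof.
move=> s0; pose p := normal_pdf m s; pose ang (t x : R) := t * (x - m) + phi.
pose f (t x : R) := cos (ang t x) * p x.
have cang t : continuous (ang t).
  by move=> x; apply: cvgD; [apply: cvgMr; exact: continuous_subm|exact: cvg_cst].
have ccos t : continuous (fun x => cos (ang t x)).
  by move=> x; apply: (continuous_comp (cang t x)); exact: continuous_cos.
have csin t : continuous (fun x => sin (ang t x)).
  by move=> x; apply: (continuous_comp (cang t x)); exact: continuous_sin.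
have intf t : mu.-integrable setT (EFin \o f t).
  apply: (@normal_integrable _ m s s0 (fun x => cos (ang t x)) 1).
    exact: continuous_measurable_fun.
  by move=> x; rewrite mul1r; apply: le_trans (cos_max _) _; rewrite lerDl sqr_ge0.
have bsin t x : `|- (x - m) * sin (ang t x)| <= 1 * (1 + (x - m) ^+ 2).
  by rewrite normrM normrN; apply: le_trans (sqr_dom1 _); rewrite ler_piMr// sin_max.
have intg t : mu.-integrable setT (EFin \o (fun x => - (x - m) * sin (ang t x) * p x)).
  apply: (@normal_integrable _ m s s0 (fun x => - (x - m) * sin (ang t x)) 1) => //.
  apply: continuous_measurable_fun => x; apply: cvgM; last exact: csin.
  by apply: cvgN; exact: continuous_subm.
have df (t x : R) : is_derive t 1 (f ^~ x) (- (x - m) * sin (ang t x) * p x).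
  rewrite /f /ang; apply: is_derive_eq; rewrite /GRing.scale/=; ring.
have dh (t : R) : is_derive t 1 (fun t => \int[mu]_x f t x) (- (s ^+ 2 * t) * \int[mu]_x f t x).
  have d1E (u x : R) : partial1of2 f u x = - (x - m) * sin (ang u x) * p x.
    by rewrite partial1of2E; case: (df u x).
  pose G x := `|x - m| * p x.
  have IN : (`]t - 1, t + 1[%classic : set R) t by rewrite /= in_itv/=; lra.
  have a1 (u : R) : `]t - 1, t + 1[%classic u -> mu.-integrable setT (EFin \o f u) by [].
  have a2 (u x : R) : `]t - 1, t + 1[%classic u -> setT x -> derivable (f ^~ x) u 1.
    by move=> _ _; case: (df u x).
  have a3 x : 0 <= G x by apply: mulr_ge0 => //; exact: normal_pdf_ge0.
  have a4 : mu.-integrable setT (EFin \o G).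
    apply: (@normal_integrable _ m s s0 (fun x => `|x - m|) 1).
      by apply: measurableT_comp => //; exact: measurable_funB.
    by move=> x; rewrite normr_id; exact: sqr_dom1.
  have a5 (u x : R) : `]t - 1, t + 1[%classic u -> setT x -> `|partial1of2 f u x| <= G x.
    move=> _ _; rewrite d1E normrM (ger0_norm (normal_pdf_ge0 _ _ _)) ler_wpM2r ?normal_pdf_ge0//.
    by rewrite normrM normrN ler_piMr// sin_max.
  apply: DeriveDef; first exact: (derivable_under_integral measurableT IN a1 a2 a3 a4 a5).
  rewrite -derive1E (differentiation_under_integral measurableT IN a1 a2 a3 a4 a5).
  transitivity (\int[mu]_x (- (x - m) * sin (ang t x) * p x)).
    by apply: eq_Rintegral => x _; exact: d1E.
  have bs x : `|s ^+ 2 * sin (ang t x)| <= s ^+ 2 * (1 + (x - m) ^+ 2).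
    rewrite normrM (ger0_norm (sqr_ge0 s)) ler_wpM2l ?sqr_ge0//.
    by apply: le_trans (sin_max _) _; rewrite lerDl sqr_ge0.
  (* The derivative of [F] is the integrand of [I'] plus [s^2 t] times that of [I], so its zero
     integral is the differential equation. *)
  pose F (x : R) := s ^+ 2 * sin (ang t x) * p x.
  have [C HC] : exists C, forall n : nat, `|F (m + n.+1%:R)| <= C / n.+1%:R /\ `|F (m - n.+1%:R)| <= C / n.+1%:R.
    exact: (@normal_decay _ m s s0 (fun x => s ^+ 2 * sin (ang t x)) (s ^+ 2) bs).
  have i1 : mu.-integrable setT (EFin \o (fun x => s ^+ 2 * t * f t x)).
    have := integrableZl measurableT (s ^+ 2 * t) (intf t).
    by apply: eq_integrable => // x _ /=; rewrite EFinM.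
  have : \int[mu]_x (- (x - m) * sin (ang t x) * p x + s ^+ 2 * t * f t x) = 0.
    apply: (@integral_deriv0 _ m C F _ _ _ _ HC).
    - move=> x; have dp := @is_derive_normal _ m s s0 x.
      rewrite /F /ang /p; apply: is_derive_eq; rewrite /GRing.scale/= /f /ang /p; field.
      by rewrite s0.
    - move=> x; apply: cvgD.
        apply: cvgM; last exact: continuous_normal.
        by apply: cvgM; [apply: cvgN; exact: continuous_subm|exact: csin].
      by apply: cvgMr; apply: cvgM; [exact: ccos|exact: continuous_normal].
    - by have := integrableD measurableT (intg t) i1; apply: eq_integrable.
  rewrite RintegralD// => /eqP; rewrite addr_eq0 => /eqP ->.
  by rewrite RintegralZl// mulNr.
pose k t := (\int[mu]_x f t x) * expR (s ^+ 2 * t ^+ 2 / 2).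
have dk (t : R) : is_derive t 1 k 0.
  have := dh t => dht; rewrite /k; apply: is_derive_eq.
  by rewrite /GRing.scale/=; field.
have := is_derive_0_is_cst th 0 dk.
rewrite /k expr0n/= !mulr0 !mul0r expR0 mulr1 => E.
have -> : \int[mu]_x (cos (th * (x - m) + phi) * normal_pdf m s x) = \int[mu]_x f th x by [].
have -> : \int[mu]_x f th x = (\int[mu]_x f 0 x) * expR (- (s ^+ 2 * th ^+ 2 / 2)).
  by rewrite -E -mulrA -expRD subrr expR0 mulr1.
congr (_ * _); rewrite /f /ang.
transitivity (\int[mu]_x (cos phi * p x)).
  by apply: eq_Rintegral => x _; rewrite mul0r add0r.
rewrite RintegralZl//; last exact: integrable_normal_pdf.
by rewrite /Rintegral integral_normal_pdf mulr1.
Qed.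

Lemma integral_normal_prob (m s : R) (f : R -> R) : measurable_fun setT f ->
  (normal_prob m s).-integrable setT (EFin \o f) ->
  \int[normal_prob m s]_x f x = \int[mu]_x (f x * normal_pdf m s x).
Proof.
move=> mf intf; rewrite /Rintegral; congr fine.
transitivity (\int[mu]_x (EFin (f x) * EFin (normal_pdf m s x)))%E; last exact: eq_integral.
have dom := normal_prob_dominates m s.
rewrite -(Radon_Nikodym_change_of_variables dom)//.
have mp : measurable_fun setT (EFin \o normal_pdf m s).
  by apply/measurable_EFinP; exact: measurable_normal_pdf.
apply: ae_eq_integral => //.
- by apply: emeasurable_funM => //; first exact/measurable_EFinP.
- by apply: emeasurable_funM => //; exact/measurable_EFinP.
- apply: ae_eqe_mul2l.
  rewrite Radon_NikodymE//=.
  case: cid => /= h [h1 h2 h3].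
  apply: integral_ae_eq => //=.
  by move=> E E01 mE; rewrite -h3.
Qed.
End normal_char.

Section gaussian_char.
Context {R : realType} {d : measure_display} {T : measurableType d} {P : probability T R}.
Notation mu := (@lebesgue_measure R).
Notation L2 := (fun f : T -> R => f \in Lfun P 2%:E).

Lemma L2_prob_cst (a : R) : L2 (fun=> a).
Proof.
apply: L2_intro; first exact: measurable_cst.
by rewrite integral_cst// [X in (_ * X)%E](probability_setT P) mule1 ltry.
Qed.

Lemma L2_prob_integrable (G : T -> R) : L2 G -> P.-integrable setT (EFin \o G).
Proof.
move=> LG; have := ip_integrable LG (L2_prob_cst 1).
by apply: eq_integrable => // w _ /=; rewrite mulr1.
Qed.

Lemma Rintegral_law d' (Y : measurableType d') (G : T -> Y) (nu : probability Y R) (h : Y -> R) :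
  measurable_fun setT G -> (forall A, measurable A -> P (G @^-1` A) = nu A) -> measurable_fun setT h ->
  P.-integrable setT (EFin \o (fun w => h (G w))) ->
  nu.-integrable setT (EFin \o h) /\ \int[P]_w h (G w) = \int[nu]_x h x.
Proof.
move=> mG E mh ih.
have mh' : measurable_fun setT (EFin \o h) by exact/measurable_EFinP.
have ih' : P.-integrable (G @^-1` setT) ((EFin \o h) \o G) by rewrite preimage_setT.
split.
  have := integrable_pushforward mG mh' ih' measurableT.
  move=> /integrableP[_]; rewrite (@eq_measure_integral _ _ _ _ nu)//; last by move=> A mA _; exact: E.
  by move=> ?; apply/integrableP.
have := integral_pushforward mG mh' ih' measurableT.
rewrite (@eq_measure_integral _ _ _ _ nu)//; last by move=> A mA _; exact: E.
by rewrite preimage_setT /Rintegral => ->.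
Qed.

(** [gaussian_law] only asserts that parameters exist. Testing the law on [x - m] and [(x - m)^2]
    identifies them: the mean is [0] and [s^2] is the second moment. A point mass obeys the same
    formula with second moment [0]. *)
Lemma gaussian_char (G : {RV P >-> R}) (phi : R) : gaussian_law (distribution P G) ->
  L2 G -> \int[P]_w G w = 0 ->
  \int[P]_w cos (G w + phi) = cos phi * expR (- (ip P G G / 2)).
Proof.
move=> gl LG G0.
have iG := L2_prob_integrable LG.
have mG : measurable_fun setT G by exact: measurable_funP.
have mid : measurable_fun setT (fun x : R => x) by exact: measurable_id.
have iB (m : R) : P.-integrable setT (EFin \o (fun w => G w - m)).
  by apply: L2_prob_integrable; apply: L2B => //; exact: L2_prob_cst.
have iB2 (m : R) : P.-integrable setT (EFin \o (fun w => (G w - m) ^+ 2)).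
  have LB : L2 (fun w => G w - m) by apply: L2B => //; exact: L2_prob_cst.
  by have := ip_integrable LB LB; apply: eq_integrable.
have mB (m : R) : measurable_fun setT (fun x : R => x - m) by exact: measurable_funB.
have mB2 (m : R) : measurable_fun setT (fun x : R => (x - m) ^+ 2) by exact: measurable_funX.
have mc : measurable_fun setT (fun x : R => cos (x + phi)).
  apply: (@measurableT_comp _ _ _ _ _ _ (@cos R)); last exact: measurable_funD.
  by apply: continuous_measurable_fun; exact: continuous_cos.
have ic : P.-integrable setT (EFin \o (fun w => cos (G w + phi))).
  apply: (@bounded_integrable _ _ _ _ _ 1); last by move=> w; exact: cos_max.
  exact: (measurableT_comp mc).
have EB (m : R) : \int[P]_w (G w - m) = - m.
  rewrite RintegralB//; last exact: (L2_prob_integrable (L2_prob_cst m)).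
  by rewrite G0 sub0r Rintegral_cst// [X in fine X](probability_setT P) mulr1.
case: gl => [[m [s [s0 E]]]|[m E]].
- have [i1 e1] := @Rintegral_law _ (measurableTypeR R) G (normal_prob m s) _ mG E (mB m) (iB m).
  have m0 : m = 0.
    by move: e1; rewrite EB integral_normal_prob// normal_mean// => /eqP; rewrite oppr_eq0 => /eqP.
  have [i2 e2] := @Rintegral_law _ (measurableTypeR R) G (normal_prob m s) _ mG E (mB2 m) (iB2 m).
  have v : ip P G G = s ^+ 2.
    rewrite -(@normal_var _ m s s0) -integral_normal_prob// -e2.
    by apply: eq_Rintegral => w _; rewrite m0 subr0.
  have [i3 ->] := @Rintegral_law _ (measurableTypeR R) G (normal_prob m s) _ mG E mc ic.
  rewrite integral_normal_prob//.
  have := @normal_char _ m s phi 1 s0; rewrite expr1n mulr1 v => <-.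
  by apply: eq_Rintegral => x _; rewrite m0 subr0 mul1r.
- have D (h : R -> R) : measurable_fun setT h -> \int[@dirac _ R m R]_x h x = h m.
    move=> mh; rewrite /Rintegral integral_dirac//; last exact/measurable_EFinP.
    by rewrite diracT mul1e.
  have [_ e1] := @Rintegral_law _ R G (@dirac _ R m R) _ mG E (mB m) (iB m).
  have m0 : m = 0 by move: e1; rewrite EB D// subrr => /eqP; rewrite oppr_eq0 => /eqP.
  have [_ e2] := @Rintegral_law _ R G (@dirac _ R m R) _ mG E (mB2 m) (iB2 m).
  have v : ip P G G = 0.
    transitivity (\int[P]_w (G w - m) ^+ 2).
      by apply: eq_Rintegral => w _; rewrite m0 subr0.
    by rewrite e2 D// subrr expr0n.
  have [_ ->] := @Rintegral_law _ R G (@dirac _ R m R) _ mG E mc ic.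
  by rewrite D// m0 add0r v mul0r oppr0 expR0 mulr1.
Qed.

End gaussian_char.

Section normal_shift.
Context {R : realType}.
Notation mu := (@lebesgue_measure R).

(* [pdf_{s^2}(z) = pdf_0(z) exp (z - s^2/2)], [exp z >= exp M (1 + z - M)] and
   [|z| <= (z^2/s + s)/2]. *)
Lemma normal_prob_shift (s M : R) (A : set (measurableTypeR R)) : 0 < s -> measurable A ->
  expR (M - s ^+ 2 / 2) * ((1 - M) * fine (normal_prob 0 s A) - s) <=
  fine (normal_prob (s ^+ 2) s A).
Proof.
move=> s_gt0 mA; have s0 : s != 0 by rewrite gt_eqF.
have s2 : 0 < s ^+ 2 by rewrite exprn_gt0.
pose p := normal_pdf 0 s; pose k (x : R) := x ^+ 2 / s / 2 + s / 2.
have k0 x : 0 <= k x by rewrite addr_ge0// ?divr_ge0 ?sqr_ge0// ltW.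
have p0 x : 0 <= p x := normal_pdf_ge0 _ _ _.
have ip0 m : mu.-integrable A (fun x => (normal_pdf m s x)%:E).
  by apply: integrableS (integrable_normal_pdf m s).
have ik : mu.-integrable setT (EFin \o (fun x => k x * p x)).
  apply: (@normal_integrable _ 0 s s0 k (s^-1 / 2 + s / 2)).
    apply: measurable_funD; last exact: measurable_cst.
    apply: measurable_funM; last exact: measurable_cst.
    apply: measurable_funM; last exact: measurable_cst.
    by apply: measurable_funX; exact: measurable_id.
  move=> x; rewrite ger0_norm// /k subr0.
  have i0 : 0 < s^-1 by rewrite invr_gt0.
  have := sqr_ge0 x; nra.
have ikA : mu.-integrable A (EFin \o (fun x => k x * p x)) by exact: integrableS ik.
have i2 : mu.-integrable setT (EFin \o (fun x => (x - 0) ^+ 2 * p x)).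
  apply: (@normal_integrable _ 0 s s0 (fun x => (x - 0) ^+ 2) 1).
    by apply: measurable_funX; exact: measurable_funB.
  by move=> x; rewrite mul1r ger0_norm ?sqr_ge0// lerDr.
(* Over the whole line the mean of [k] under N(0, s^2) is [(s^2 / s + s) / 2 = s]. *)
have kA : \int[mu]_(x in A) (k x * p x) <= s.
  apply: (@le_trans _ _ (\int[mu]_x (k x * p x))).
    apply: fine_le; [exact: integrable_fin_num ikA|exact: integrable_fin_num ik|].
    apply: ge0_subset_integral => //.
      by case/integrableP : ik.
    by move=> x _; rewrite lee_fin mulr_ge0.
  have i3 : mu.-integrable setT (EFin \o (fun x => s^-1 / 2 * ((x - 0) ^+ 2 * p x))).
    by have := integrableZl measurableT (s^-1 / 2) i2; apply: eq_integrable.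
  have i4 : mu.-integrable setT (EFin \o (fun x => s / 2 * p x)).
    by have := integrableZl measurableT (s / 2) (integrable_normal_pdf 0 s); apply: eq_integrable.
  have -> : \int[mu]_x (k x * p x) = \int[mu]_x (s^-1 / 2 * ((x - 0) ^+ 2 * p x) + s / 2 * p x).
    by apply: eq_Rintegral => x _; rewrite /k subr0; ring.
  have e1 : \int[mu]_x (s^-1 / 2 * ((x - 0) ^+ 2 * p x)) = s^-1 / 2 * \int[mu]_x ((x - 0) ^+ 2 * p x).
    by apply: RintegralZl; [exact: measurableT|exact: i2].
  have e2 : \int[mu]_x (s / 2 * p x) = s / 2 * \int[mu]_x p x.
    by apply: RintegralZl; [exact: measurableT|exact: integrable_normal_pdf].
  rewrite RintegralD// e1 e2.
  rewrite normal_var// /Rintegral integral_normal_pdf mulr1.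
  rewrite le_eqVlt; apply/orP; left; apply/eqP; field; rewrite s0; exact.
suff : expR (M - s ^+ 2 / 2) * ((1 - M) * (\int[mu]_(x in A) p x) - s) <=
  \int[mu]_(x in A) normal_pdf (s ^+ 2) s x by [].
set e := expR _; have e0 : 0 < e := expR_gt0 _.
have ip1 : mu.-integrable A (EFin \o (fun x => (1 - M) * p x)).
  by have := integrableZl mA (1 - M) (ip0 0); apply: eq_integrable.
have ip2 : mu.-integrable A (EFin \o (fun x => (1 - M) * p x - k x * p x)).
  by have := integrableB mA ip1 ikA; apply: eq_integrable.
have ip3 : mu.-integrable A (EFin \o (fun x => e * ((1 - M) * p x - k x * p x))).
  by have := integrableZl mA e ip2; apply: eq_integrable.
apply: (@le_trans _ _ (\int[mu]_(x in A) (e * ((1 - M) * p x - k x * p x)))).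
  rewrite RintegralZl// ler_wpM2l ?(ltW e0)// RintegralB// RintegralZl//; last exact: ip0.
  by rewrite lerB.
apply: le_Rintegral => //; first exact: ip0.
move=> x _; rewrite -mulrBl.
have -> : normal_pdf (s ^+ 2) s x = p x * expR (x - s ^+ 2 / 2).
  rewrite /p !normal_pdfE// /normal_fun -mulrA -expRD; congr (_ * expR _).
  by rewrite -mulr_natl; field; rewrite s0.
have -> : expR (x - s ^+ 2 / 2) = e * expR (x - M).
  by rewrite /e -expRD; congr expR; ring.
rewrite [leRHS]mulrCA ler_wpM2l ?(ltW e0)// mulrC ler_wpM2l//.
apply: le_trans (expR_ge1Dx _).
suff : - x <= k x by lra.
rewrite /k -subr_ge0 (_ : _ - - x = (x + s) ^+ 2 / s / 2); last by field.
by rewrite !divr_ge0 ?sqr_ge0// ltW.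
Qed.
End normal_shift.

(** * Change of mean of a Gaussian vector *)

Section gaussian_shift.
Context {R : realType} {d : measure_display} {T : measurableType d} {P : probability T R}.
Context {n : nat} {X : 'I_n -> {RV P >-> R}}.
Notation L2 := (fun f : T -> R => f \in Lfun P 2%:E).
Notation mR := (measurableTypeR R).
Context (LX : forall i, L2 (X i)) (X0 : forall i, \int[P]_w X i w = 0).
Context (gX : forall a : 'I_n -> R,
  gaussian_law (distribution P (\sum_(i < n) a i *: (X i : {mfun T >-> R})))).
Let mX i : measurable_fun setT (X i). Proof. exact: measurable_funP. Qed.
Let LL a : L2 (lin X a).
Proof. by apply: L2_sum => i; exact/L2Z/LX. Qed.

Lemma lin_mean a : \int[P]_w lin X a w = 0.
Proof.
have := ip_suml (index_enum 'I_n) (fun i => L2Z (a i) (LX i)) (L2_prob_cst (P := P) 1).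
rewrite /ip => E; transitivity (\int[P]_w ((\sum_(i < n) a i * X i w) * 1)).
  by apply: eq_Rintegral => w _; rewrite mulr1.
rewrite E big1// => i _; under eq_Rintegral do rewrite mulr1.
rewrite RintegralZl ?X0 ?mulr0//; exact: L2_prob_integrable (LX i).
Qed.

Lemma lin_char a phi : \int[P]_w cos (lin X a w + phi) =
  cos phi * expR (- (ip P (lin X a) (lin X a) / 2)).
Proof.
set G : {RV P >-> R} := \sum_(i < n) a i *: (X i : {mfun T >-> R}).
have GE w : G w = lin X a w.
  rewrite /G /lin; elim/big_ind2 : _ => // [x1 x2 y1 y2 <- <-//].
have GE' : (G : T -> R) = lin X a by apply/funext.
have := @gaussian_char _ _ _ _ G phi (gX a).
by rewrite GE'; apply; [exact: LL|exact: lin_mean].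
Qed.

Context (b : 'I_n -> R).
Let Z := lin X b.
Let g i := ip P (X i) Z.
Let v := ip P Z Z.
Let LZ : L2 Z := LL b.

Let aG a : \sum_(i < n) a i * g i = ip P (lin X a) Z.
Proof.
rewrite /lin ip_suml//; last by move=> i; exact/L2Z/LX.
by apply: eq_bigr => i _; rewrite ipZl//; exact: LX.
Qed.

(* [Y i] is uncorrelated with [Z], hence independent of it. *)
Let Y i w := X i w - g i / v * Z w.
(** [X] rebuilt from [Y] and a normal variable independent of it by construction. Under [PP 0] its
    cylinder probabilities are those of [X], under [PP v] those of [X + g]; only the law of the
    second coordinate differs. *)
Let V i (z : T * mR) := Y i z.1 + g i / v * z.2.
Let PP m := (P \x (normal_prob m (Num.sqrt v) : probability mR R))%E.

Let mZ : measurable_fun setT Z. Proof. exact: measurable_lin. Qed.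
Let mY i : measurable_fun setT (Y i).
Proof. by apply: measurable_funB => //; apply: measurable_funM. Qed.
Let mV i : measurable_fun setT (V i).
Proof.
apply: measurable_funD; first exact: (measurableT_comp (mY i)).
by apply: measurable_funM => //; exact: measurable_snd.
Qed.

Let lin_Y a w : lin Y a w = lin X (fun i => a i - (\sum_(j < n) a j * g j) / v * b i) w.
Proof.
transitivity (lin X a w - (\sum_(j < n) a j * g j) / v * Z w).
  rewrite 2!mulr_suml /lin -sumrB; apply: eq_bigr => i _; rewrite /Y; ring.
set S := \sum_(j < n) _; rewrite /Z /lin mulr_sumr -sumrB.
by apply: eq_bigr => i _; ring.
Qed.

(** Integrating out the normal coordinate yields a factor [exp(- v th^2 / 2)], while removing the
    component along [Z] lowers the variance of [lin X a] by [th^2 v]. The two effects cancel,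
    leaving only the phase shift [th * m]. *)
Let char_V a phi m : 0 < v -> \int[PP m]_z cos (lin V a z + phi) =
  cos (phi + (\sum_(i < n) a i * g i) / v * m) * expR (- (ip P (lin X a) (lin X a) / 2)).
Proof.
move=> v0; set s := Num.sqrt v; set th := (\sum_(i < n) a i * g i) / v.
have s0 : s != 0 by rewrite gt_eqF// sqrtr_gt0.
set a' := fun i => a i - th * b i.
have VE z : lin V a z = lin X a' z.1 + th * z.2.
  rewrite /a' /th -lin_Y /lin /V mulr_suml mulr_suml -big_split/=.
  by apply: eq_bigr => i _; ring.
have mlin (a0 : 'I_n -> R) : measurable_fun setT (lin X a0) by exact: measurable_lin.
have mcos : measurable_fun setT (@cos R) by apply: continuous_measurable_fun; exact: continuous_cos.
have mf : measurable_fun setT (fun z : T * mR => cos (lin V a z + phi)).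
  apply: measurableT_comp => //; apply: measurable_funD => //; exact: measurable_lin.
have intf : (PP m).-integrable setT (EFin \o (fun z => cos (lin V a z + phi))).
  by apply: (@bounded_integrable _ _ _ _ _ 1) => // z; exact: cos_max.
have inner w : (\int[normal_prob m s]_z (cos (lin V a (w, z) + phi))%:E =
    (cos (lin X a' w + (phi + th * m)) * expR (- (s ^+ 2 * th ^+ 2 / 2)))%:E)%E.
  pose h (z : mR) := cos (th * z + (lin X a' w + phi)).
  have mh : measurable_fun setT h.
    by apply: measurableT_comp => //; apply: measurable_funD => //; apply: measurable_funM.
  have ih : (normal_prob m s).-integrable setT (EFin \o h).
    by apply: (@bounded_integrable _ _ _ _ _ 1) => // z; exact: cos_max.
  transitivity (\int[normal_prob m s]_z h z)%:E.
    rewrite /Rintegral fineK; last exact: integrable_fin_num.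
    by apply: eq_integral => z _; rewrite VE/= /h; congr (cos _)%:E; ring.
  congr EFin; rewrite integral_normal_prob//.
  rewrite (_ : lin X a' w + (phi + th * m) = lin X a' w + phi + th * m); last by ring.
  rewrite -(@normal_char _ m)//; apply: eq_Rintegral => z _; congr (cos _ * _); ring.
rewrite /Rintegral -integral12_prod_meas1// /fubini_F.
under eq_integral do rewrite inner.
rewrite -/(Rintegral _ _ _).
transitivity (\int[P]_w (cos (lin X a' w + (phi + th * m)) * expR (- (s ^+ 2 * th ^+ 2 / 2)))) => //.
rewrite RintegralZr//; last first.
  apply: (@bounded_integrable _ _ _ _ _ 1); last by move=> w; exact: cos_max.
  by apply: measurableT_comp => //; apply: measurable_funD.
rewrite lin_char -[LHS]mulrA -expRD; congr (_ * expR _).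
have E : ip P (lin X a') (lin X a') = ip P (lin X a) (lin X a) - th ^+ 2 * v.
  have -> : lin X a' = (fun w => lin X a w + (- th) * Z w).
    apply/funext => w; rewrite /Z /lin mulr_sumr -big_split/=.
    by apply: eq_bigr => i _; rewrite /a'; ring.
  rewrite (ip_normD _ (LL a) LZ).
  rewrite -aG (_ : \sum_(i < n) a i * g i = th * v); last by rewrite /th divfK// gt_eqF.
  by rewrite -/v; ring.
by rewrite E /s sqr_sqrtr ?(ltW v0)//; ring.
Qed.

Theorem gaussian_shift (c : 'I_n -> R) (p : R) : 0 < p ->
  P [set w | forall i, X i w <= c i] = p%:E ->
  ((p * expR (- (v / 2 + Num.sqrt v / p)))%:E <= P [set w | forall i, (X i w + g i <= c i)%R])%E.
Proof.
(* If [v = 0], Cauchy-Schwarz makes every [g i] vanish, so there is no shift. *)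
move=> p0 Pp; have := ip_ge0 P Z; rewrite -/v le_eqVlt => /predU1P[v0|v0].
  have g0 i : g i = 0.
    have := ip_CS (LX i) LZ; rewrite -/v -v0 mulr0 => h.
    by apply/eqP; rewrite -sqrf_eq0 eq_le sqr_ge0 h.
  rewrite -v0 sqrtr0 !mul0r addr0 oppr0 expR0 mulr1 -Pp.
  rewrite (_ : [set w | forall i, X i w + g i <= c i] = [set w | forall i, X i w <= c i])//.
  by apply/seteqP; split => w /= h i; have := h i; rewrite g0 addr0.
set s := Num.sqrt v; have s0 : 0 < s by rewrite sqrtr_gt0.
have ss : s ^+ 2 = v by rewrite sqr_sqrtr// ltW.
pose E := [set z | forall i, V i z <= c i].
(* [m = 0] gives back [X] and [m = v] gives [X + g]. *)
have L m : PP m E = P [set w | forall i, X i w + g i / v * m <= c i].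
  symmetry; apply: (@cramer_wold _ _ _ _ _ _ _ _ (fun i w => X i w + g i / v * m)) => //.
    by move=> i; apply: measurable_funD.
  move=> a phi; rewrite char_V//.
  rewrite -lin_char; apply: eq_Rintegral => w _; congr (cos _).
  have -> : lin (fun i w => X i w + g i / v * m) a w = lin X a w + (\sum_(i < n) a i * g i) / v * m.
    by rewrite /lin 2!mulr_suml -big_split/=; apply: eq_bigr => i _; ring.
  by ring.
have mE : measurable E.
  rewrite (_ : E = \bigcap_(i in setT) (V i @^-1` `]-oo, c i])); last first.
    by apply/seteqP; split => z /= h; [move=> i _ /=; rewrite in_itv/=; exact: h|
      move=> i; have := h i I; rewrite /= in_itv].
  apply: fin_bigcap_measurable => // i _.
  by rewrite -[X in measurable X]setTI; exact: mV.
pose F m w := fine (normal_prob m s (xsection E w)).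
have mF m : measurable_fun setT (F m).
  apply: measurableT_comp => //.
  exact: (@measurable_fun_xsection _ _ _ _ _ (normal_prob m s : probability mR R)).
have F1 m w : `|F m w| <= 1.
  rewrite /F ger0_norm ?fine_ge0// -lee_fin fineK.
    by apply: probability_le1; exact: measurable_xsection.
  by rewrite fin_num_measure//; exact: measurable_xsection.
have iF m : P.-integrable setT (EFin \o F m) by exact: bounded_integrable (F1 m).
have PF m : PP m E = (\int[P]_w F m w)%:E.
  rewrite /Rintegral fineK; last exact: integrable_fin_num (iF m).
  apply: eq_integral => w _; rewrite /F /= fineK//.
  by rewrite fin_num_measure//; exact: measurable_xsection.
have := L 0; rewrite PF; under eq_set do under eq_forall do rewrite mulr0 addr0.
rewrite Pp => -[p1].
have := L v; rewrite PF; under eq_set do under eq_forall do rewrite divfK ?gt_eqF//.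
move=> <-; rewrite lee_fin.
(* This tangent point maximizes [exp M * ((1 - M) p - s)]; with it the second factor is exactly
   [p]. *)
pose M := - s / p.
have -> : p * expR (- (v / 2 + s / p)) = \int[P]_w (expR (M - v / 2) * ((1 - M) * F 0 w - s)).
  have i1 : P.-integrable setT (EFin \o (fun w => (1 - M) * F 0 w)).
    by have := integrableZl measurableT (1 - M) (iF 0); apply: eq_integrable.
  have i2 : P.-integrable setT (EFin \o (fun w => (1 - M) * F 0 w - s)).
    have := integrableB measurableT i1 (L2_prob_integrable (L2_prob_cst s)).
    by apply: eq_integrable.
  rewrite RintegralZl// RintegralB//; last exact: (L2_prob_integrable (L2_prob_cst s)).
  rewrite RintegralZl// p1 Rintegral_cst// [X in fine X](probability_setT P) mulr1.
  rewrite mulrC; congr (expR _ * _); first by rewrite /M; ring.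
  by rewrite /M; field; rewrite gt_eqF.
apply: le_Rintegral => //.
  have i1 : P.-integrable setT (EFin \o (fun w => (1 - M) * F 0 w)).
    by have := integrableZl measurableT (1 - M) (iF 0); apply: eq_integrable.
  have i2 : P.-integrable setT (EFin \o (fun w => (1 - M) * F 0 w - s)).
    have := integrableB measurableT i1 (L2_prob_integrable (L2_prob_cst s)).
    by apply: eq_integrable.
  by have := integrableZl measurableT (expR (M - v / 2)) i2; apply: eq_integrable.
move=> w _; rewrite -ss; apply: normal_prob_shift => //.
exact: measurable_xsection.
Qed.

End gaussian_shift.

(** * A Cameron-Martin inequality *)

Section gram.
Context {R : realType} {d : measure_display} {T : measurableType d}.
Context {m : {measure set T -> \bar R}} {n : nat}.
Notation L2 := (fun f : T -> R => f \in Lfun m 2%:E).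

Lemma ip_lin (k : 'I_n -> T -> R) a h : (forall i, L2 (k i)) -> L2 h ->
  ip m (lin k a) h = \sum_(i < n) a i * ip m (k i) h.
Proof.
move=> Lk Lh; rewrite /lin ip_suml//; last by move=> i; exact: L2Z.
by apply: eq_bigr => i _; rewrite ipZl.
Qed.

(* [lin k b] is the orthogonal projection of [phi] on the span of the [k i]. *)
Lemma gram_span (k : 'I_n -> T -> R) (phi : T -> R) : (forall i, L2 (k i)) -> L2 phi ->
  exists b : 'I_n -> R, (forall j, ip m (k j) phi = \sum_(i < n) b i * ip m (k i) (k j)) /\
    \sum_(i < n) b i * (\sum_(j < n) b j * ip m (k j) (k i)) <= ip m phi phi.
Proof.
move=> Lk Lphi.
pose S := \matrix_(i < n, j < n) ip m (k i) (k j).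
pose g := \row_(j < n) ip m (k j) phi.
have LL a : L2 (lin k a) by apply: L2_sum => i; exact/L2Z/Lk.
have /submxP[D gD] : (g <= S)%MS.
  (* Membership in the row space is tested on the cokernel. A column [a] of the cokernel gives a
     combination [lin k a] of norm [0], hence orthogonal to [phi]; this covers a singular Gram
     matrix. *)
  rewrite submxE; apply/eqP/matrixP => i j; rewrite [LHS]mxE [RHS]mxE.
  set N := cokermx S; pose a l := N l j.
  have Sa l : ip m (k l) (lin k a) = 0.
    have /matrixP/(_ l j) := mulmx_coker S; rewrite [LHS]mxE [RHS]mxE => <-.
    by rewrite ipC ip_lin//; apply: eq_bigr => i' _; rewrite [S _ _]mxE mulrC ipC.
  have aa : ip m (lin k a) (lin k a) = 0.
    by rewrite [LHS]ip_lin// big1// => l _; rewrite Sa mulr0.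
  have := ip_CS (LL a) Lphi; rewrite aa mul0r => h.
  have /eqP : ip m (lin k a) phi ^+ 2 = 0 by apply/eqP; rewrite eq_le h sqr_ge0.
  rewrite sqrf_eq0 => /eqP h0; transitivity (ip m (lin k a) phi); last exact: h0.
  rewrite [RHS]ip_lin//.
  by apply: eq_bigr => l _; rewrite [g _ _]mxE mulrC.
pose b i := D ord0 i.
have gb j : ip m (k j) phi = \sum_(i < n) b i * ip m (k i) (k j).
  have /matrixP/(_ ord0 j) := gD; rewrite !mxE => ->.
  by apply: eq_bigr => i _; rewrite !mxE.
exists b; split => //.
have KK : ip m (lin k b) (lin k b) = ip m (lin k b) phi.
  rewrite [LHS]ip_lin// [RHS]ip_lin//; apply: eq_bigr => i _; congr (_ * _).
  by rewrite gb ipC ip_lin.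
have -> : \sum_(i < n) b i * (\sum_(j < n) b j * ip m (k j) (k i)) = ip m (lin k b) (lin k b).
  by rewrite [RHS]ip_lin//; apply: eq_bigr => i _; rewrite ipC ip_lin.
(* As [lin k b] has the same inner product with itself and with [phi], Cauchy-Schwarz can be divided
   by that number when it is positive. *)
have := ip_ge0 m (lin k b); rewrite le_eqVlt => /predU1P[<-|K0]; first exact: ip_ge0.
have := ip_CS (LL b) Lphi; rewrite -KK expr2.
by rewrite ler_pM2l.
Qed.

End gram.

Section finite_cameron_martin.
Context {R : realType} {d d' : measure_display} {T : measurableType d} {P : probability T R}.
Context {S : measurableType d'} {m : {measure set S -> \bar R}}.
Context {n : nat} {X : 'I_n -> {RV P >-> R}} {k : 'I_n -> S -> R}.

(** The coefficients projecting [phi] on the span of [k] are reused on [X]. Equal Gram matrices give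
    the resulting variable covariance [<k i, phi>] with [X i] and the variance of the projection, at
    most [|phi|^2]; the bound decreases with the variance. *)
Lemma finite_cameron_martin (phi : S -> R) (c : 'I_n -> R) (p : R) :
  (forall i, (X i : T -> R) \in Lfun P 2%:E) -> (forall i, \int[P]_w X i w = 0) ->
  (forall a : 'I_n -> R, gaussian_law (distribution P (\sum_(i < n) a i *: (X i : {mfun T >-> R})))) ->
  (forall i, k i \in Lfun m 2%:E) -> phi \in Lfun m 2%:E ->
  (forall i j, ip P (X i) (X j) = ip m (k i) (k j)) ->
  0 < p -> P [set w | forall i, X i w <= c i] = p%:E ->
  ((p * expR (- (ip m phi phi / 2 + Num.sqrt (ip m phi phi) / p)))%:E <=
    P [set w | forall i, (X i w + ip m (k i) phi <= c i)%R])%E.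
Proof.
move=> LX X0 gX Lk Lphi E p0 Pp.
have [b [gb bphi]] := gram_span Lk Lphi.
have LL : lin X b \in Lfun P 2%:E by apply: L2_sum => i; exact/L2Z/LX.
have g i : ip P (X i) (lin X b) = ip m (k i) phi.
  by rewrite gb ipC ip_lin//; apply: eq_bigr => j _; rewrite E.
have v : ip P (lin X b) (lin X b) <= ip m phi phi.
  apply: le_trans bphi; rewrite [leLHS]ip_lin// le_eqVlt; apply/orP; left; apply/eqP.
  apply: eq_bigr => i _; congr (_ * _); rewrite ipC ip_lin//.
  by apply: eq_bigr => j _; rewrite E.
have := gaussian_shift LX X0 gX b p0 Pp.
under eq_set do under eq_forall do rewrite g.
apply: le_trans; rewrite lee_fin ler_wpM2l ?(ltW p0)// ler_expR lerN2 lerD//.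
  by rewrite ler_wpM2r.
by rewrite ler_wpM2r ?invr_ge0 ?(ltW p0)// ler_wsqrtr.
Qed.
End finite_cameron_martin.

(** * The kernels as vectors of L2 *)

Section kernel.
Context {R : realType}.
Notation mu := (@lebesgue_measure R).
Context {H : R} (H0 : 0 < H) (H1 : H < 1).

Lemma fbm_covC s t : fbm_cov H s t = fbm_cov H t s.
Proof. by rewrite /fbm_cov distrC (addrC (t `^ _)). Qed.

Lemma kf0 r : kf H 0 r = 0.
Proof. by rewrite /kf set_itv_ge ?bnd_simp// patchE in_set0. Qed.

Lemma kf_prod s t : 0 <= s -> s <= t ->
  (\int[mu]_r (kf H s r * kf H t r)%:E = (fbm_cov H s t)%:E)%E.
Proof.
move=> s0 st; have [s0'|s_gt0] := leP s 0.
  have -> : s = 0 by apply/eqP; rewrite eq_le s0' s0.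
  under eq_integral do rewrite kf0 mul0r.
  rewrite integral0 /fbm_cov subr0 powR0 ?mulf_neq0 ?gt_eqF// addr0.
  by rewrite ger0_norm ?(le_trans s0)// subrr mulr0.
rewrite -(K_cov H0 H1 s_gt0 st) [RHS]integral_mkcond; apply: eq_integral => r _.
rewrite patchE; case: ifPn => [_|]; first by rewrite mulrC.
by move=> /negbTE rs; rewrite {1}/kf patchE rs mul0r.
Qed.

Lemma L2_kf t : 0 <= t -> kf H t \in Lfun mu 2%:E.
Proof.
move=> t0; apply: L2_intro; first exact: measurable_kf.
under eq_integral do rewrite expr2.
by rewrite kf_prod// ltry.
Qed.

Lemma ip_kf s t : 0 <= s -> 0 <= t -> ip mu (kf H s) (kf H t) = fbm_cov H s t.
Proof.
move=> s0 t0; have [st|/ltW ts] := leP s t.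
  by rewrite /ip /Rintegral kf_prod.
by rewrite ipC fbm_covC /ip /Rintegral kf_prod.
Qed.

Lemma ip_kf_restrict (t : R) (phi : R -> R) : 0 <= t -> measurable_fun setT (phi \_ Rplus) ->
  \int[mu]_(s in `[0, t]) (K_fbm H t s * phi s) = ip mu (kf H t) (phi \_ Rplus).
Proof.
move=> t0 mphi.
have E r : ((fun s => K_fbm H t s * phi s) \_ `]0, t[) r = kf H t r * (phi \_ Rplus) r.
  rewrite /kf !patchE; case: ifPn => [/set_mem/=|_]; last by rewrite mul0r.
  rewrite in_itv/= => /andP[r0 rt]; rewrite mem_set//= /Rplus/= in_itv/= andbT; exact: ltW.
have m0 : measurable_fun `]0, t[ (fun s => K_fbm H t s * phi s).
  apply/(measurable_restrictT _ _) => //; rewrite (_ : _ \_ _ = fun r => kf H t r * (phi \_ Rplus) r).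
    by apply: measurable_funM => //; exact: measurable_kf.
  by apply/funext => r; exact: E.
rewrite /ip /Rintegral; congr fine.
rewrite integral_itv_bndoo; last exact/measurable_EFinP.
rewrite [LHS]integral_mkcond; apply: eq_integral => r _.
by rewrite -E restrict_EFin.
Qed.

Lemma L2plus_ip phi : L2plus phi -> L2plus_norm phi = Num.sqrt (ip mu (phi \_ Rplus) (phi \_ Rplus)).
Proof. exact: L2_norm_ip. Qed.

End kernel.

(** * Reduction to countably many times *)

Section separability.
Context {R : realType}.

(* No regularity of [h] is needed, since subsets of R^m are separable. *)
Lemma countable_dense_graph (m : nat) (h : 'I_m -> R -> R) (A : set R) (a0 : R) : A a0 ->
  exists t : nat -> R, (forall n, A (t n)) /\
    forall s, A s -> forall e, 0 < e -> exists n, forall i, `|h i (t n) - h i s| < e.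
Proof.
move=> Aa0; pose C := ({ffun 'I_m -> rat} * nat)%type.
pose near (q : C) x := forall i, `|h i x - ratr (q.1 i)| < q.2.+1%:R^-1.
(* For each box with rational centre and half-width [1/(k+1)], one point of [A] whose image lies in
   the box is selected, if there is any. *)
have /choice[pt Hpt] (q : C) : exists x, A x /\ ((exists y, A y /\ near q y) -> near q x).
  have [[y [Ay qy]]|N] := pselect (exists y, A y /\ near q y); first by exists y.
  by exists a0; split => // /N.
exists (fun n => if unpickle n is Some q then pt q else a0); split.
  by move=> n; case: unpickle => // q; case: (Hpt q).
move=> s As e e0.
have [k _ Hk] : \forall k \near \oo, k.+1%:R^-1 < e / 2.
  exact: near_infty_natSinv_lt (PosNum (divr_gt0 e0 (ltr0n _ 2))).
have kk := Hk k (leqnn k).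
have /choice[q Hq] i : exists q : rat, `|h i s - ratr q| < k.+1%:R^-1.
  have k0 : 0 < k.+1%:R^-1 :> R by rewrite invr_gt0 ltr0n.
  move: k0; set r := _^-1 => k0.
  have /rat_in_itvoo[q] : h i s - r < h i s + r by lra.
  rewrite in_itv/= => /andP[q1 q2]; exists q; rewrite ltr_norml; apply/andP; split; lra.
pose Q : C := ([ffun i => q i], k).
have sQ : near Q s by move=> i; rewrite ffunE; exact: Hq.
exists (pickle Q) => i; rewrite pickleK.
have [_ /(_ (ex_intro _ s (conj As sQ)))/(_ i)] := Hpt Q.
have := sQ i; rewrite /= !ffunE /=.
set x := h i s; set y := h i _; set z := ratr _; set r := _^-1 => h1 h2.
have := ler_distD z y x; rewrite (distrC z x); move: kk; rewrite -/r; lra.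
Qed.

Lemma forall_dense (b u g : R -> R) (t : nat -> R) : {within Rplus, continuous b} ->
  (forall n, Rplus (t n)) ->
  (forall s, Rplus s -> forall e, 0 < e -> exists n,
     [/\ `|t n - s| < e, `|u (t n) - u s| < e & `|g (t n) - g s| < e]) ->
  (forall n, b (t n) + g (t n) <= u (t n)) -> forall s, Rplus s -> b s + g s <= u s.
Proof.
move=> cb tp dense le s sp; rewrite leNgt; apply/negP => lt.
(* A quarter of the violation: moving to a nearby [t n] loses less than [e] in each of [b], [g] and
   [u], so a violation remains there. *)
pose e := (b s + g s - u s) / 4; have e0 : 0 < e by rewrite /e; lra.
have [eta eta0 H] : exists2 eta, 0 < eta & forall x, Rplus x -> `|x - s| < eta -> `|b x - b s| < e.
  have : \forall x \near within Rplus (nbhs s), `|b s - b x| < e.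
    have := cb s => /(_ _ (nbhsx_ballx (b s) _ e0)).
    by rewrite /nbhs /= /nbhs/= ; rewrite nbhs_subspace_in.
  rewrite near_withinE => /nbhs_ballP[eta /= eta0 h]; exists eta => // x xp xs.
  by rewrite distrC; apply: h => //; rewrite /ball/= distrC.
have m0 : 0 < Num.min e eta by rewrite lt_min e0.
have [n [h1 h2 h3]] := dense s sp _ m0.
move: h1 h2 h3; rewrite !lt_min => /andP[_ h1] /andP[h2 _] /andP[h3 _].
have := H _ (tp n) h1; have := le n; move: h2 h3; rewrite !ltr_norml /e.
by move=> /andP[? ?] /andP[? ?] ? /andP[? ?]; lra.
Qed.
End separability.

(** * Shifting the barrier for fractional Brownian motion *)

Section fbm_facts.
Context {R : realType} {d : measure_display} {T : measurableType d} {P : probability T R}.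
Notation mu := (@lebesgue_measure R).
Context {H : R} {B : R -> {RV P >-> R}} (B_fbm : fbm H B).

Let fbm_int t : Rplus t -> (\int[P]_w (B t w)%:E = 0)%E.
Proof. by case: B_fbm => _ + _ _ tp => /(_ t tp); rewrite unlock. Qed.

Let fbm_cov_int s t : Rplus s -> Rplus t -> (\int[P]_w (B s w * B t w)%:E = (fbm_cov H s t)%:E)%E.
Proof.
move=> sp tp; case: B_fbm => _ m + _ => /(_ s t sp tp) <-.
rewrite unlock (m s sp) (m t tp) unlock; apply: eq_integral => w _.
by rewrite !fctE/= !subr0.
Qed.

Lemma fbm_mean t : Rplus t -> \int[P]_w B t w = 0.
Proof. by move=> tp; rewrite /Rintegral fbm_int. Qed.

Lemma fbm_L2 t : Rplus t -> (B t : T -> R) \in Lfun P 2%:E.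
Proof.
move=> tp; apply: L2_intro; first exact: measurable_funP.
by under eq_integral do rewrite expr2; rewrite fbm_cov_int// ltry.
Qed.

Lemma fbm_ip s t : Rplus s -> Rplus t -> ip P (B s) (B t) = fbm_cov H s t.
Proof. by move=> sp tp; rewrite /ip /Rintegral fbm_cov_int. Qed.

Context (H0 : 0 < H) (H1 : H < 1).

(** The finite bound is uniform in the number of times, since it involves only the norm of the whole
    [psi] and the probability [p] of the whole event. It therefore passes to the decreasing
    intersection. *)
Theorem prob_below_shift (u f psi : R -> R) (p : R) : psi \in Lfun mu 2%:E ->
  (forall t, Rplus t -> f t <= ip mu (kf H t) psi) ->
  0 < p -> (p%:E <= prob_below B u (fun=> 0%R))%E ->
  ((p * expR (- (ip mu psi psi / 2 + Num.sqrt (ip mu psi psi) / p)))%:E <= prob_below B u f)%E.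
Proof.
move=> Lpsi fpsi p0 pP; set v := ip mu psi psi.
have [gB _ _ cB] := B_fbm.
have Rp0 : Rplus (0 : R) by rewrite /Rplus/= in_itv/= lexx.
(* The identity is one of the three coordinates so that the selected times also approach [s], which
   the continuity of the paths requires. *)
have [t [tp dense]] := countable_dense_graph (fun i : 'I_3 => nth id [:: id; u; f] i) Rp0.
pose fin g n := [set w | forall i : 'I_n, B (t i) w + g (t i) <= u (t i)].
have mfin g n : measurable (fin g n).
  rewrite (_ : fin g n = \bigcap_(i in [set: 'I_n]) ((fun w => B (t i) w + g (t i)) @^-1` `]-oo, u (t i)])).
    apply: fin_bigcap_measurable => // i _.
    rewrite -[X in measurable X]setTI; apply: measurable_funD => //; exact: measurable_funP.
  by apply/seteqP; split => w /= h; [move=> i _ /=; rewrite in_itv/=; exact: h|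
    move=> i; have := h i I; rewrite /= in_itv].
have fdE g : (forall s, Rplus s -> forall e, 0 < e -> exists n,
     [/\ `|t n - s| < e, `|u (t n) - u s| < e & `|g (t n) - g s| < e]) ->
    [set w | forall s, Rplus s -> B s w + g s <= u s] = \bigcap_n fin g n.
  move=> dg; apply/seteqP; split => w /= h.
    by move=> n _ i; apply: h.
  apply: (@forall_dense _ (fun s => B s w) u g t) => // n.
  (* The event [fin g n] involves the indices below [n], so index [n] is the last one of
     [fin g n.+1]. *)
  exact: (h n.+1 I ord_max).
have mcap g : measurable (\bigcap_n fin g n) by exact: bigcap_measurable.
have d0 : [set w | forall s, Rplus s -> B s w + 0 <= u s] = \bigcap_n fin (fun=> 0) n.
  apply: fdE => s sp e e0; have [n h] := dense s sp e e0; exists n; split.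
  - exact: (h (@Ordinal 3 0 isT)).
  - exact: (h (@Ordinal 3 1 isT)).
  - by rewrite subrr normr0.
have df : [set w | forall s, Rplus s -> B s w + f s <= u s] = \bigcap_n fin f n.
  apply: fdE => s sp e e0; have [n h] := dense s sp e e0; exists n; split.
  - exact: (h (@Ordinal 3 0 isT)).
  - exact: (h (@Ordinal 3 1 isT)).
  - exact: (h (@Ordinal 3 2 isT)).
have bound n : ((p * expR (- (v / 2 + Num.sqrt v / p)))%:E <= P (fin f n))%E.
  have p_le : (p%:E <= P (fin (fun=> 0%R) n))%E.
    apply: le_trans pP _; rewrite /prob_below d0; apply: le_measure; rewrite ?inE//.
    by move=> w; apply.
  (* The finite event contains the full one, so [q >= p], and the bound increases with the
     probability put in it. *)
  pose q := fine (P (fin (fun=> 0) n)).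
  have qE : P (fin (fun=> 0) n) = q%:E by rewrite /q fineK// fin_num_measure.
  have pq : p <= q by rewrite -lee_fin -qE.
  have q0 : 0 < q by exact: lt_le_trans pq.
  have Pq : P [set w | forall i : 'I_n, B (t i) w <= u (t i)] = q%:E.
    rewrite -qE; congr (P _); apply/seteqP; split => w /= h i; have := h i.
      by rewrite addr0.
    by rewrite addr0.
  have tp' (i : nat) : 0 <= t i by have := tp i; rewrite /Rplus/= in_itv/= andbT.
  have := @finite_cameron_martin R _ _ T P _ mu n (fun i => B (t i)) (fun i => kf H (t i)) psi
    (fun i => u (t i)) q.
  move=> /(_ (fun i => fbm_L2 (tp i)) (fun i => fbm_mean (tp i))).
  move=> /(_ (fun a => gB n (fun i => t i) a (fun i => tp i)) (fun i => L2_kf H0 H1 (tp' i)) Lpsi).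
  move=> /(_ _ q0 Pq) h.
  have {}h := h (fun i j => etrans (fbm_ip (tp i) (tp j)) (esym (ip_kf H0 H1 (tp' i) (tp' j)))).
  apply: le_trans (le_trans h _).
    rewrite lee_fin; apply: (ler_pM (ltW p0) (expR_ge0 _) pq).
    rewrite ler_expR lerN2 lerD2l ler_wpM2l ?sqrtr_ge0//.
    by rewrite lef_pV2.
  apply: le_measure; rewrite ?inE//.
    exact: (mfin (fun s => ip mu (kf H s) psi)).
  move=> w /= hw i; apply: le_trans (hw i).
  by rewrite lerD2l; exact: fpsi.
have cv : P (fin f n) @[n --> \oo] --> P (\bigcap_n fin f n).
  apply: (@nonincreasing_cvg_mu _ _ _ P (fin f)) => //.
  - by apply: (@le_lt_trans _ _ 1%E); [exact: probability_le1|exact: ltry].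
  - apply/nonincreasing_seqP => n; apply/subsetPset => w h i.
    exact: (h (widen_ord (leqnSn n) i)).
rewrite /prob_below df.
apply: (closed_cvg _ (@closed_ereal_le_ereal R _) _ _ cv).
exact: nearW.
Qed.
End fbm_facts.

(** * The element of least norm *)

Section rkhs_minimizer.
Context {R : realType}.
Notation mu := (@lebesgue_measure R).

Lemma L2_restrict (A : set (measurableTypeR R)) (f : R -> R) : measurable A -> f \in Lfun mu 2%:E ->
  f \_ A \in Lfun mu 2%:E /\ ip mu (f \_ A) (f \_ A) <= ip mu f f.
Proof.
move=> mA Lf; have mf := L2_measurable Lf.
have mfA : measurable_fun setT (f \_ A).
  by apply/(measurable_restrictT _ mA); exact: measurable_funTS.
have le : (\int[mu]_x (((f \_ A) x) ^+ 2)%:E <= \int[mu]_x ((f x) ^+ 2)%:E)%E.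
  apply: ge0_le_integral => //=.
  - by move=> x _; rewrite lee_fin sqr_ge0.
  - by apply/measurable_EFinP; exact: measurable_funX.
  - by apply/measurable_EFinP; exact: measurable_funX.
  - by move=> x _; rewrite lee_fin patchE; case: ifP => // _; rewrite expr0n/= sqr_ge0.
have LA : f \_ A \in Lfun mu 2%:E.
  by apply: L2_intro => //; apply: le_lt_trans le _; rewrite (ip_EFin Lf) ltry.
by split => //; rewrite -lee_fin -(ip_EFin LA) -(ip_EFin Lf).
Qed.

Lemma ip_kf_patch (H t : R) (phi : R -> R) : ip mu (kf H t) (phi \_ Rplus) = ip mu (kf H t) phi.
Proof.
apply: eq_Rintegral => r _; rewrite /kf !patchE.
case: ifPn => [/set_mem/=|_]; last by rewrite !mul0r.
by rewrite in_itv/= => /andP[r0 rt]; rewrite mem_set//= /Rplus/= in_itv/= andbT ltW.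
Qed.

Lemma K_repr_ip (H : R) (f phi : R -> R) t : K_repr H f phi -> Rplus t ->
  f t = ip mu (kf H t) (phi \_ Rplus).
Proof.
move=> [Lphi E] tp; rewrite E// ip_kf_restrict//; last exact: L2_measurable Lphi.
by move: tp; rewrite /Rplus/= in_itv/= andbT.
Qed.

Lemma cvg_invry : c^-1 @[c --> +oo] --> (0 : R).
Proof. by apply/gtr0_cvgV0; [exact: nbhs_pinfty_gt|exact: cvg_id]. Qed.

(** [g >= f] is a family of constraints [<kf H t, phi> >= f t] indexed by the nonnegative times, to
    which [L2_min] applies. Its uniqueness clause, tested on [kf H t], gives equality of the
    functions at every [t >= 0]. *)
Lemma rkhs_min (H : R) (f : R -> R) : 0 < H -> H < 1 -> in_rkhs H f ->
  exists fhat phi, [/\ K_repr H fhat phi, ge_plus fhat f, min_rkhs_norm H f = L2plus_norm phi &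
    forall (h : R -> R) (r : R), rkhs_norm H h r -> ge_plus h f -> min_rkhs_norm H f = r ->
      forall t, Rplus t -> h t = fhat t].
Proof.
move=> H0 H1 [phi0 K0].
pose I := {t : R | 0 <= t}.
have Rp (i : I) : Rplus (sval i) by rewrite /Rplus/= in_itv/= (svalP i).
have feas g phi : K_repr H g phi -> ge_plus g f ->
    forall i : I, f (sval i) <= ip mu (kf H (sval i)) (phi \_ Rplus).
  by move=> Kg gf i; rewrite -(K_repr_ip Kg (Rp i)); exact: gf.
have [] := @L2_min _ _ R mu I (fun i => kf H (sval i)) (fun i => f (sval i)).
- by move=> i; apply: L2_kf => //; exact: (svalP i).
- exists (phi0 \_ Rplus); first by case: K0.
  by apply: feas K0 _ => t _.
move=> phi [Lphi phif phimin phiuniq].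
have mRp : measurable (Rplus : set (measurableTypeR R)) by exact: measurable_itv.
have [LphiA phiA] := L2_restrict mRp Lphi.
pose fhat t := Rintegral mu `[0, t] (fun s => K_fbm H t s * phi s).
have Kfhat : K_repr H fhat phi by split.
have norm_ge0 psi : 0 <= ip mu (psi \_ Rplus) (psi \_ Rplus) by exact: ip_ge0.
(* The minimization takes place on the whole line. Restricting to the half line keeps the
   constraints and does not increase the norm, so the minimum is the same. *)
have phiAE : ip mu (phi \_ Rplus) (phi \_ Rplus) = ip mu phi phi.
  apply/eqP; rewrite eq_le phiA phimin// => i.
  by rewrite ip_kf_patch; exact: phif.
have fhatf : ge_plus fhat f.
  move=> t tp; have t0 : 0 <= t by move: tp; rewrite /Rplus/= in_itv/= andbT.
  by rewrite (K_repr_ip Kfhat tp) ip_kf_patch; exact: (phif (exist _ t t0)).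
have normE psi : L2plus psi -> L2plus_norm psi = Num.sqrt (ip mu (psi \_ Rplus) (psi \_ Rplus)).
  exact: L2plus_ip.
have mn : min_rkhs_norm H f = L2plus_norm phi.
  apply/eqP; rewrite eq_le; apply/andP; split.
    apply: ge_inf; last by exists fhat; split => //; exists phi.
    by exists 0 => _ [g [[psi [[Lpsi _] ->]] _]]; rewrite normE// sqrtr_ge0.
  apply: lb_le_inf; first by exists (L2plus_norm phi), fhat; split => //; exists phi.
  move=> _ [g [[psi [Kg ->]] gf]]; have [Lpsi _] := Kg.
  rewrite !normE// ler_wsqrtr// phiAE; apply: phimin => //.
  exact: feas Kg gf.
exists fhat, phi; split => //.
move=> h r [psi [Kh ->]] hf; rewrite mn => E t tp; have [Lpsi _] := Kh.
rewrite (K_repr_ip Kh tp) (K_repr_ip Kfhat tp) [RHS]ip_kf_patch; apply: phiuniq => //.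
- exact: feas Kh hf.
- move: E; rewrite !normE// => /eqP.
  by rewrite eqr_sqrt// phiAE => /eqP ->.
- by apply: L2_kf => //; move: tp; rewrite /Rplus/= in_itv/= andbT.
Qed.
End rkhs_minimizer.

(** * The asymptotic lower bound *)

Theorem corollary3p1 (R : realType) (d : measure_display)
    (T : measurableType d) (P : probability T R)
    (H : R) (H_gt0 : 0 < H) (H_lt1 : H < 1)
    (B : R -> {RV P >-> R}) (B_fbm : fbm H B)
    (u : R -> R) (u_meas : measurable_fun Rplus u) (u0 : 0 <= u 0)
    (P0_gt0 : (0 < prob_below B u (fun=> 0%R))%E)
    (P0_lt1 : (prob_below B u (fun=> 0%R) < 1)%E)
    (f : R -> R) (f_rkhs : in_rkhs H f)
    (x0 : R) (x0_gt0 : 0 < x0) (fx0_gt0 : 0 < f x0) :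
  exists (fhat : R -> R) (nhat : R),
    [/\ rkhs_norm H fhat nhat, ge_plus fhat f, min_rkhs_norm H f = nhat,
        (forall (h : R -> R) (r : R),
           rkhs_norm H h r -> ge_plus h f -> min_rkhs_norm H f = r ->
           forall t, Rplus t -> h t = fhat t)
      & exists eps : R -> R,
          eps c @[c --> +oo] --> (0 : R) /\
          \forall c \near +oo,
            ((- ((1 + eps c) * (c ^+ 2 / 2) * nhat ^+ 2))%:E
               <= lne (prob_below B u (fun t => (c * f t)%R)))%E].
Proof.
have [fhat [phi [Kf fhatf mn uniq]]] := rkhs_min H_gt0 H_lt1 f_rkhs.
exists fhat, (L2plus_norm phi); split => //; first by exists phi.
have [Lphi _] := Kf; set psi := phi \_ Rplus.
have Lpsi : psi \in Lfun lebesgue_measure 2%:E := Lphi.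
set N := L2plus_norm phi.
have NE : N = Num.sqrt (ip lebesgue_measure psi psi) by exact: L2plus_ip.
have N2 : ip lebesgue_measure psi psi = N ^+ 2 by rewrite NE sqr_sqrtr// ip_ge0.
(* A zero norm would force [fhat x0 = 0] by Cauchy-Schwarz, against [fhat x0 >= f x0 > 0].
   Positivity is what allows a relative error. *)
have N_gt0 : 0 < N.
  rewrite lt_neqAle {2}NE sqrtr_ge0 andbT eq_sym; apply/eqP => N0.
  have x0p : Rplus x0 by rewrite /Rplus/= in_itv/= ltW.
  have := fhatf x0 x0p; rewrite (K_repr_ip Kf x0p) -/psi => h.
  have Lk := L2_kf H_gt0 H_lt1 (ltW x0_gt0).
  have := ip_CS Lk Lpsi; rewrite N2 N0 expr0n/= mulr0 => h2.
  have h3 : 0 < ip lebesgue_measure (kf H x0) psi by exact: lt_le_trans h.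
  by have := exprn_gt0 2 h3; rewrite ltNge h2.
pose p := fine (prob_below B u (fun=> 0%R)).
have pE : p%:E = prob_below B u (fun=> 0%R).
  by rewrite /p fineK// ge0_fin_numE ?(ltW P0_gt0)// (lt_trans P0_lt1)// ltry.
have p0 : 0 < p by rewrite -lte_fin pE.
(* Solved from [ln p - c^2 N^2 / 2 - c N / p = - (1 + eps c) c^2 N^2 / 2], whose left side is the
   logarithm of the bound for [c * psi]. It is a polynomial in [1 / c] without constant term, hence
   tends to [0]. *)
exists (fun c => (c * N / p - ln p) / (c ^+ 2 / 2 * N ^+ 2)); split.
  have -> : (0 : R) = 2 / (p * N) * 0 - 2 * ln p / N ^+ 2 * (0 * 0) by rewrite !mulr0 subr0.
  have cv : (2 / (p * N) * c^-1 - 2 * ln p / N ^+ 2 * (c^-1 * c^-1)) @[c --> +oo] -->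
      2 / (p * N) * 0 - 2 * ln p / N ^+ 2 * (0 * 0).
    apply: cvgB; first by apply: cvgMr; exact: cvg_invry.
    by apply: cvgMr; apply: cvgM; exact: cvg_invry.
  apply: cvg_trans cv; apply: near_eq_cvg; near=> c.
  have c0 : 0 < c by near: c; exact: nbhs_pinfty_gt.
  by field; rewrite !gt_eqF.
near=> c; have c0 : 0 < c by near: c; exact: nbhs_pinfty_gt.
have LZ : (fun x => c * psi x) \in Lfun lebesgue_measure 2%:E by exact: L2Z.
have ipZ g : g \in Lfun lebesgue_measure 2%:E ->
    ip lebesgue_measure g (fun x => c * psi x) = c * ip lebesgue_measure g psi.
  by move=> Lg; rewrite ipC ipZl// ipC.
have := @prob_below_shift _ _ _ _ H B B_fbm H_gt0 H_lt1 u (fun t => c * f t) (fun x => c * psi x) p LZ.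
have fle t : Rplus t -> c * f t <= ip lebesgue_measure (kf H t) (fun x => c * psi x).
  move=> tp; rewrite ipZ; last by apply: L2_kf => //; move: tp; rewrite /Rplus/= in_itv/= andbT.
  by rewrite ler_wpM2l ?(ltW c0)// -(K_repr_ip Kf tp); exact: fhatf.
move=> /(_ fle p0); rewrite pE => /(_ (lexx _)).
rewrite ipZ// ipC ipZ// N2.
rewrite (_ : Num.sqrt _ = c * N); last first.
  by rewrite mulrA -expr2 -exprMn sqrtr_sqr gtr0_norm// mulr_gt0.
set q := p * _ => h; have q0 : 0 < q by rewrite mulr_gt0 ?expR_gt0.
apply: (@le_trans _ _ (lne q%:E)); last first.
  rewrite lee_lne// in_itv/= leey andbT; first by rewrite lee_fin ltW.
  by apply: le_trans h; rewrite lee_fin ltW.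
rewrite lne_EFin// lee_fin /q lnM ?posrE ?expR_gt0// expRK.
rewrite le_eqVlt; apply/orP; left; apply/eqP; field.
by rewrite !gt_eqF.
Unshelve. all: by end_near. Qed.
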